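(* Let $G$ be a locally compact Hausdorff groupoid with Haar system $\alpha$, let $(\mathsf A,\mathcal D,\theta,w)$ be a twisted partial action of $G$, and let $\mathcal A$ be the associated Fell bundle over $G$. Measurable covariant representations of the twisted partial action are equivalent to measurable Fell-bundle representations of the associated Fell bundle $\mathcal A$.
   Context: Notation. $G$ has unit space $G^0$ (units identified with identity arrows), source and range maps $s,r$; $G^2,G^3$ are the spaces of composable pairs and triples. Fields of Banach spaces or $C^*$-algebras are upper semicontinuous: Banach spaces $(\mathcal B_x)_{x\in X}$ with a topology on $\mathcal B=\bigsqcup_x\mathcal B_x$ such that the projection $\mathcal B\to X$ is continuous and open, the algebraic operations are continuous fibrewise, the norm is upper semicontinuous, and every net $b_i\in\mathcal B_{x_i}$ with $x_i\to x$, $\|b_i\|\to0$ converges to $0\in\mathcal B_x$. $C_0$ and $C_c$ denote continuous sections vanishing at infinity, resp. compactly supported. A family of closed subspaces $\mathcal A_x\subseteq\mathcal B_x$ is continuous if each $a\in\mathcal A_x$ equals $f(x)$ for a continuous section $f$ of $\mathcal B$ with $f(y)\in\mathcal A_y$ for all $y$; it is then a field in the subspace topology. Products of subspaces are closed linear spans. Twisted partial action. It consists of a field of $C^*$-algebras $\mathsf A=(\mathsf A_x)_{x\in G^0}$, closed ideals $\mathcal D_g\triangleleft\mathsf A_{r(g)}$ and $*$-isomorphisms $\theta_g\colon\mathcal D_{g^{-1}}\to\mathcal D_g$ for $g\in G$, and unitary multipliers $w(g,h)$ of $\mathcal D_g\cap\mathcal D_{gh}$ for $(g,h)\in G^2$,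 such that: (i) $\mathcal D_x=\mathsf A_x$ and $\theta_x=\mathrm{id}$ for $x\in G^0$, $w(g,s(g))=1$ and $w(r(g),g)=1$ for $g\in G$; (ii) $\theta_g(\mathcal D_{g^{-1}}\cap\mathcal D_h)\subseteq\mathcal D_{gh}$ for $(g,h)\in G^2$; (iii) $\theta_g(\theta_h(a))=w(g,h)\theta_{gh}(a)w(g,h)^*$ for $(g,h)\in G^2$, $a\in\theta_{h^{-1}}(\mathcal D_{g^{-1}}\cap\mathcal D_h)$; (iv) $\theta_g(a\,w(h,k))\,w(g,hk)=\theta_g(a)\,w(g,h)\,w(gh,k)$ for $(g,h,k)\in G^3$, $a\in\mathcal D_{g^{-1}}\cap\mathcal D_h\cap\mathcal D_{hk}$ (multipliers of ideals being restricted to smaller ideals); (v) $(\mathcal D_g)$ is a continuous family of ideals $\mathcal D$ in $r^*\mathsf A$; (vi) the $\theta_g$ combine to an isomorphism of fields $\mathrm{inv}^*\mathcal D\to\mathcal D$, $\mathrm{inv}(g)=g^{-1}$; (vii) the $w(g,h)$ form a unitary multiplier of $C_0(G^2,J)$, where $J$ is the field of ideals $\mathcal D_g\cap\mathcal D_{gh}$. Associated Fell bundle: $\mathcal A=\mathcal D$ as a field of Banach spaces, with elements of $\mathcal A_g$ written $a\delta_g$ ($a\in\mathcal D_g$) and operations $(a\delta_g)(b\delta_h)=\theta_g(\theta_g^{-1}(a)b)\,w(g,h)\,\delta_{gh}$, $(a\delta_g)^*=\theta_g^{-1}(a^* )\,w(g^{-1},g)^*\,\delta_{g^{-1}}$.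 Here $\mathcal A_g\mathcal A_g^*=\mathcal D_g$ and $\mathcal A|_{G^0}=\mathsf A$. Measures and fields. $\nu$ is a measure on $G^0$ (only its class matters), $\mathcal H=(\mathcal H_x)_{x\in G^0}$ is a $\nu$-measurable field of separable Hilbert spaces (in the sense of Dixmier) with $\mathcal H_x\ne0$ for $\nu$-almost all $x$. The Haar system $\alpha=(\alpha^x)_{x\in G^0}$ is left invariant and $\nu\circ\alpha=\int\alpha^x\,d\nu(x)$. Given nondegenerate representations $\varphi_x\colon\mathsf A_x\to\mathbb B(\mathcal H_x)$, $\nu$ is quasi-invariant relative to $(\varphi_x)$ if the restriction of $\nu\circ\alpha$ to $\{g\in G:\varphi_{r(g)}(\mathcal A_g\mathcal A_g^* )\mathcal H_{r(g)}\neq0\}$ is equivalent to its image under $g\mapsto g^{-1}$. A measurable covariant representation of the twisted partial action consists of $\nu$, $\mathcal H$, a measurable family of nondegenerate representations $\varphi_x\colon\mathsf A_x\to\mathbb B(\mathcal H_x)$ for all $x\in G^0$, and unitaries $U_g\colon\varphi_{s(g)}(\mathcal D_{g^{-1}})\mathcal H_{s(g)}\to\varphi_{r(g)}(\mathcal D_g)\mathcal H_{r(g)}$ for all $g\in G$, such that: $\nu$ is quasi-invariant relative to $(\varphi_x)_{x\in G^0}$; $U_g\varphi_{s(g)}(a)U_g^*=\varphi_{r(g)}(\theta_g(a))$ for $g\in G$, $a\in\mathcal D_{g^{-1}}$; for $(g,h)\in G^2$ the partial map $U_gU_h$ is a restriction of $\varphi_{r(g)}(w(g,h))U_{gh}$;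 and pointwise application of $\varphi_x(a(x))$ for $a\in C_0(G^0,\mathsf A)$ and of $U_g$ maps measurable sections to measurable sections. A measurable Fell-bundle representation of $\mathcal A$ consists of $\nu$, $\mathcal H$ and linear maps $S_g\colon\mathcal A_g\to\mathbb B(\mathcal H_{s(g)},\mathcal H_{r(g)})$ for all $g\in G$ such that: $S_g(a_1)S_h(a_2)=S_{gh}(a_1a_2)$ for $(g,h)\in G^2$, $a_1\in\mathcal A_g$, $a_2\in\mathcal A_h$; $S_g(a)^*=S_{g^{-1}}(a^* )$ for $g\in G$, $a\in\mathcal A_g$; the linear span of $S_x(\mathsf A_x)\mathcal H_x$ is dense in $\mathcal H_x$ for all $x\in G^0$; $g\mapsto S_g(f(g))\xi(g)$ is a measurable section of $r^*\mathcal H$ for each $f\in C_c(G,\mathcal A)$ and each measurable section $\xi$ of $s^*\mathcal H$; and $\nu$ is quasi-invariant relative to $(S_x)_{x\in G^0}$.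
   Formalization: In a covariant representation, U_g need only preserve measurability of sections that are pointwise sequential limits of finite sums of φ(a(g))η(g) with a in C_c, not of all measurable sections; with all of them the claim fails for non-separable fibres, and in the separable case both agree. *)

(* Defs.v *)
From HB Require Import structures.
From mathcomp Require Import all_boot all_order all_algebra.
From mathcomp Require Import all_classical all_reals all_analysis.
From mathcomp Require Import complex.

Set Implicit Arguments.
Unset Strict Implicit.
Unset Printing Implicit Defensive.

Import Order.TTheory GRing.Theory Num.Theory.
Import numFieldNormedType.Exports.

Local Open Scope classical_set_scope.
Local Open Scope ring_scope.

(** * Hilbert spaces, bounded operators, C*-algebras *)

(** [dot u v] is linear in [u] and conjugate linear in [v]. *)
Record hilbertType (R : realType) := HilbertType {
  hilbert_sort :> completeNormedModType R[i];
  dot : {dot hilbert_sort for (Num.conj : R[i] -> R[i])};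
  dot_norm : forall u : hilbert_sort, `|u| ^+ 2 = dot u u }.

Record bop (R : realType) (V W : completeNormedModType R[i]) := Bop {
  bop_fun :> V -> W;
  bop_linear : linear bop_fun;
  bop_continuous : continuous bop_fun }.

Definition adjoint (R : realType) (V W : hilbertType R)
    (T : bop V W) (T' : bop W V) : Prop :=
  forall u v, dot W (T u) v = dot V u (T' v).

Definition lin_span (R : realType) (V : completeNormedModType R[i])
    (X : set V) : set V :=
  [set v | exists (n : nat) (c : 'I_n -> R[i]) (u : 'I_n -> V),
     (forall i, X (u i)) /\ v = \sum_(i < n) c i *: u i].

Definition closed_span (R : realType) (V : completeNormedModType R[i])
    (X : set V) : set V := closure (lin_span X).

Record cstarAlg (R : realType) := CStarAlg {
  cstar_sort :> completeNormedModType R[i];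
  cmul : cstar_sort -> cstar_sort -> cstar_sort;
  cstar : cstar_sort -> cstar_sort;
  cmulA : associative cmul;
  cmul_linearl : forall b, linear (cmul^~ b);
  cmul_linearr : forall a, linear (cmul a);
  cmul_norm : forall a b, `|cmul a b| <= `|a| * `|b|;
  cstarK : involutive cstar;
  cstarM : forall a b, cstar (cmul a b) = cmul (cstar b) (cstar a);
  cstar_semilinear : forall (k : R[i]) a b,
    cstar (k *: a + b) = k^* *: cstar a + cstar b;
  cstar_identity : forall a, `|cmul (cstar a) a| = `|a| ^+ 2 }.

Section CStar.
Variables (R : realType).

(** Invariance under the involution is automatic for closed two-sided
    ideals in C*-algebras. *)
Definition closed_ideal (A : cstarAlg R) (I : set A) : Prop :=
  [/\ closed I, I 0,
      forall (k : R[i]) a b, I a -> I b -> I (k *: a + b),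
      forall a b, I a -> I (cmul a b) /\ I (cmul b a) &
      forall a, I a -> I (cstar a)].

(** The *-isomorphism [theta] from the ideal [I] of [A] onto the ideal [J] of
    [B], with inverse [thetai]; the values outside [I] and [J] are
    irrelevant. *)
Definition star_iso (A B : cstarAlg R) (I : set A) (J : set B)
    (theta : A -> B) (thetai : B -> A) : Prop :=
  [/\ forall a, I a -> J (theta a) /\ thetai (theta a) = a,
      forall b, J b -> I (thetai b) /\ theta (thetai b) = b,
      forall (k : R[i]) a a', I a -> I a' ->
        theta (k *: a + a') = k *: theta a + theta a',
      forall a a', I a -> I a' ->
        theta (cmul a a') = cmul (theta a) (theta a') &
      forall a, I a -> theta (cstar a) = cstar (theta a)].

(** Multipliers of an ideal [I] of [A] are double centralisers:
    [mleft w a] is [w a] and [mright w a] is [a w]. Only the values on [I]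
    are meaningful, so that restricting a multiplier to a smaller ideal
    does not change the underlying pair of functions. *)
Record multiplier (A : cstarAlg R) := Multiplier {
  mleft : A -> A;
  mright : A -> A }.

Definition is_multiplier (A : cstarAlg R) (I : set A) (w : multiplier A) :=
  (forall a, I a -> I (mleft w a) /\ I (mright w a)) /\
  (forall a b, I a -> I b -> cmul a (mleft w b) = cmul (mright w a) b).

Definition madj (A : cstarAlg R) (w : multiplier A) : multiplier A :=
  Multiplier (fun a => cstar (mright w (cstar a)))
             (fun a => cstar (mleft w (cstar a))).

Definition unitary_multiplier (A : cstarAlg R) (I : set A)
    (w : multiplier A) : Prop :=
  is_multiplier I w /\
  forall a, I a -> mleft (madj w) (mleft w a) = a /\
                   mleft w (mleft (madj w) a) = a.

Definition multiplier_one (A : cstarAlg R) (I : set A) (w : multiplier A) :=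
  forall a, I a -> mleft w a = a /\ mright w a = a.

End CStar.

(** * Upper semicontinuous fields of C*-algebras *)

(** The total space is a topological space [ctot] in bijection with the
    disjoint union of the fibres, [cinj] being the inclusion of the fibres.
    Continuity of a fibrewise operation, that is, of a map on a fibre product
    over [X], is spelled out with neighbourhoods. *)
Record cstarField (R : realType) (X : topologicalType) := CStarField {
  cfib :> X -> cstarAlg R;
  ctot : topologicalType;
  cproj : ctot -> X;
  cinj : forall x, cfib x -> ctot;
  cproj_inj : forall x (a : cfib x), cproj (cinj a) = x;
  cinj_inj : forall x, injective (@cinj x);
  cinj_surj : forall e, exists x (a : cfib x), cinj a = e;
  cproj_continuous : continuous cproj;
  cproj_open : forall U : set ctot, open U -> open (cproj @` U);
  cadd_continuous : forall x (a b : cfib x) (W : set ctot),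
    nbhs (cinj (a + b)) W ->
    \forall e \near cinj a & f \near cinj b,
      forall y (a' b' : cfib y), cinj a' = e -> cinj b' = f ->
        W (cinj (a' + b'));
  cscale_continuous : forall x (k : R[i]) (a : cfib x) (W : set ctot),
    nbhs (cinj (k *: a)) W ->
    \forall l \near (k : R[i]^o) & e \near cinj a,
      forall y (a' : cfib y), cinj a' = e -> W (cinj (l *: a'));
  cmul_continuous : forall x (a b : cfib x) (W : set ctot),
    nbhs (cinj (cmul a b)) W ->
    \forall e \near cinj a & f \near cinj b,
      forall y (a' b' : cfib y), cinj a' = e -> cinj b' = f ->
        W (cinj (cmul a' b'));
  cstar_continuous : forall x (a : cfib x) (W : set ctot),
    nbhs (cinj (cstar a)) W ->
    \forall e \near cinj a,
      forall y (a' : cfib y), cinj a' = e -> W (cinj (cstar a'));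
  cnorm_usc : forall x (a : cfib x) (t : R[i]), `|a| < t ->
    \forall e \near cinj a, forall y (a' : cfib y), cinj a' = e -> `|a'| < t;
  czero_limit : forall (F : set_system ctot) (x : X), ProperFilter F ->
    cproj @ F --> x ->
    (forall t : R[i], 0 < t ->
      \forall e \near F, forall y (a' : cfib y), cinj a' = e -> `|a'| < t) ->
    F --> cinj (0 : cfib x) }.

Definition C0_section (R : realType) (X : topologicalType)
    (A : cstarField R X) (a : forall x, A x) : Prop :=
  continuous (fun x => cinj (a x)) /\
  forall t : R[i], 0 < t ->
    exists2 K : set X, compact K & forall x, ~ K x -> `|a x| < t.

(** * Topological groupoids *)

(** The product [gmul g h] is meaningful only if [src g = rng h]. *)
Record groupoid := Groupoid {
  arrows : ptopologicalType;
  objects : ptopologicalType;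
  rng : arrows -> objects;
  src : arrows -> objects;
  gunit : objects -> arrows;
  ginv : arrows -> arrows;
  gmul : arrows -> arrows -> arrows;
  rng_unit : forall x, rng (gunit x) = x;
  src_unit : forall x, src (gunit x) = x;
  rng_inv : forall g, rng (ginv g) = src g;
  src_inv : forall g, src (ginv g) = rng g;
  rng_mul : forall g h, src g = rng h -> rng (gmul g h) = rng g;
  src_mul : forall g h, src g = rng h -> src (gmul g h) = src h;
  gmulA : forall g h k, src g = rng h -> src h = rng k ->
    gmul g (gmul h k) = gmul (gmul g h) k;
  gmul1g : forall g, gmul (gunit (rng g)) g = g;
  gmulg1 : forall g, gmul g (gunit (src g)) = g;
  gmulVg : forall g, gmul (ginv g) g = gunit (src g);
  gmulgV : forall g, gmul g (ginv g) = gunit (rng g);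
  rng_continuous : continuous rng;
  src_continuous : continuous src;
  gunit_continuous : continuous gunit;
  ginv_continuous : continuous ginv;
  gmul_continuous :
    {within [set p : arrows * arrows | src p.1 = rng p.2],
       continuous (fun p : arrows * arrows => gmul p.1 p.2)} }.

(** [ghom G x y] is the type of arrows with range [x] and source [y]. Families
    indexed by [G] with values in families over the object space are indexed
    by [ghom], so that no transport along [src g = rng h] is needed. *)
Record ghom (G : groupoid) (x y : objects G) := Hom {
  hom_arr :> arrows G;
  hom_rng : rng hom_arr = x;
  hom_src : src hom_arr = y }.

Section Hom.
Variable G : groupoid.

Lemma hom_inj (x y : objects G) (g h : ghom x y) :
  hom_arr g = hom_arr h -> g = h.
Proof.
case: g h => [g gx gy] [h hx hy] /= gh; rewrite -gh in hx hy *.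
by congr Hom; exact: Prop_irrelevance.
Qed.

Definition arr (g : arrows G) : ghom (rng g) (src g) :=
  @Hom G _ _ g erefl erefl.

Definition hid (x : objects G) : ghom x x :=
  Hom (rng_unit x) (src_unit x).

Definition hinv (x y : objects G) (g : ghom x y) : ghom y x :=
  Hom (etrans (rng_inv g) (hom_src g)) (etrans (src_inv g) (hom_rng g)).

Lemma hom_composable (x y z : objects G) (g : ghom x y) (h : ghom y z) :
  src g = rng h.
Proof. exact: etrans (hom_src g) (esym (hom_rng h)). Qed.

Definition hmul (x y z : objects G) (g : ghom x y) (h : ghom y z) : ghom x z :=
  Hom (etrans (rng_mul (hom_composable g h)) (hom_rng g))
      (etrans (src_mul (hom_composable g h)) (hom_src h)).

Lemma hmulVg (x y : objects G) (g : ghom x y) : hmul (hinv g) g = hid y.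
Proof. by apply: hom_inj; rewrite /= gmulVg (hom_src g). Qed.

End Hom.

(** * Haar systems *)

Notation borel T := (g_sigma_algebraType (@open T)).

Definition radon (R : realType) (T : ptopologicalType)
    (mu : {measure set (borel T) -> \bar R}) : Prop :=
  [/\ forall K : set T, compact K -> (mu K < +oo)%E,
      forall B : set (borel T), measurable B ->
        mu B = ereal_inf [set mu U | U in [set U : set T |
                                            open U /\ B `<=` U]] &
      forall U : set T, open U ->
        mu U = ereal_sup [set mu K | K in [set K : set T |
                                            compact K /\ K `<=` U]]].

Definition Cc_function (R : realType) (T : topologicalType) (f : T -> R) :=
  continuous f /\
  exists2 K : set T, compact K & forall t, ~ K t -> f t = 0.

Record haar_system (R : realType) (G : groupoid)
    (alpha : objects G -> {measure set (borel (arrows G)) -> \bar R}) : Prop :=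
  HaarSystem {
  haar_radon : forall x, radon (alpha x);
  haar_support : forall x, alpha x [set g | rng g <> x] = 0%E /\
    forall U : set (arrows G), open U ->
      (exists2 g, U g & rng g = x) -> (0 < alpha x U)%E;
  haar_invariant : forall (g : arrows G) (f : arrows G -> R), Cc_function f ->
    \int[alpha (src g)]_(h in [set h | rng h = src g]) f (gmul g h) =
    \int[alpha (rng g)]_(h in setT) f h;
  haar_continuous : forall f : arrows G -> R, Cc_function f ->
    continuous (fun x => \int[alpha x]_(h in setT) f h) }.

(** * Twisted partial actions *)

Section Sections.
Variables (R : realType) (G : groupoid) (A : cstarField R (objects G)).

(** Sections of the pull-backs of [A] along the range map, the source map, and
    [(g, h) |-> rng g] on composable pairs. *)
Definition rsection := forall x y : objects G, ghom x y -> A x.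
Definition ssection := forall x y : objects G, ghom x y -> A y.
Definition section2 := forall x y z : objects G, ghom x y -> ghom y z -> A x.

Definition rcontinuous (f : rsection) : Prop :=
  continuous (fun g : arrows G => cinj (f _ _ (arr g))).

Definition scontinuous (f : ssection) : Prop :=
  continuous (fun g : arrows G => cinj (f _ _ (arr g))).

Definition rcompact_support (f : rsection) : Prop :=
  exists2 K : set (arrows G), compact K &
    forall x y (g : ghom x y), ~ K g -> f x y g = 0.

Definition scompact_support (f : ssection) : Prop :=
  exists2 K : set (arrows G), compact K &
    forall x y (g : ghom x y), ~ K g -> f x y g = 0.

Definition continuous2 (f : section2) : Prop :=
  forall x y z (g : ghom x y) (h : ghom y z) (W : set (ctot A)),
    nbhs (cinj (f x y z g h)) W ->
    \forall p \near (hom_arr g, hom_arr h),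
      forall x' y' z' (g' : ghom x' y') (h' : ghom y' z'),
        hom_arr g' = p.1 -> hom_arr h' = p.2 -> W (cinj (f x' y' z' g' h')).

Definition vanishes2 (f : section2) : Prop :=
  forall t : R[i], 0 < t ->
    exists2 K : set (arrows G * arrows G), compact K &
      forall x y z (g : ghom x y) (h : ghom y z),
        ~ K (hom_arr g, hom_arr h) -> `|f x y z g h| < t.

Definition C0_section2 (J : forall x y z : objects G,
    ghom x y -> ghom y z -> set (A x)) (f : section2) : Prop :=
  [/\ continuous2 f, vanishes2 f &
      forall x y z (g : ghom x y) (h : ghom y z), J x y z g h (f x y z g h)].

End Sections.

(** [tw g h] is a multiplier of [tJ g h]; [tthi g] is the inverse of
    [tth g]. *)
Record twisted_partial_action (R : realType) (G : groupoid) :=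
  TwistedPartialAction {
  tA : cstarField R (objects G);
  tD : forall x y : objects G, ghom x y -> set (tA x);
  tth : forall x y : objects G, ghom x y -> tA y -> tA x;
  tthi : forall x y : objects G, ghom x y -> tA x -> tA y;
  tw : forall x y z : objects G, ghom x y -> ghom y z -> multiplier (tA x);
  tJ := (fun x y z (g : ghom x y) (h : ghom y z) => tD g `&` tD (hmul g h));
  tD_ideal : forall x y (g : ghom x y), closed_ideal (tD g);
  tth_iso : forall x y (g : ghom x y),
    star_iso (tD (hinv g)) (tD g) (tth g) (tthi g);
  tw_unitary : forall x y z (g : ghom x y) (h : ghom y z),
    unitary_multiplier (tJ g h) (tw g h);
  tD_id : forall x : objects G, tD (hid x) = setT;
  tth_id : forall (x : objects G) (a : tA x), tth (hid x) a = a;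
  tw_unitr : forall x y (g : ghom x y),
    multiplier_one (tJ g (hid y)) (tw g (hid y));
  tw_unitl : forall x y (g : ghom x y),
    multiplier_one (tJ (hid x) g) (tw (hid x) g);
  tth_sub : forall x y z (g : ghom x y) (h : ghom y z) (a : tA y),
    tD (hinv g) a -> tD h a -> tD (hmul g h) (tth g a);
  tth_mul : forall x y z (g : ghom x y) (h : ghom y z) (a : tA z),
    (tth (hinv h) @` (tD (hinv g) `&` tD h)) a ->
    tth g (tth h a) =
    mright (madj (tw g h)) (mleft (tw g h) (tth (hmul g h) a));
  tw_cocycle : forall x y z t (g : ghom x y) (h : ghom y z) (k : ghom z t)
      (a : tA y), tD (hinv g) a -> tD h a -> tD (hmul h k) a ->
    mright (tw g (hmul h k)) (tth g (mright (tw h k) a)) =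
    mright (tw (hmul g h) k) (mright (tw g h) (tth g a));
  tD_continuous : forall x y (g : ghom x y) (a : tA x), tD g a ->
    exists f : rsection tA,
      [/\ rcontinuous f, forall x' y' (h : ghom x' y'), tD h (f x' y' h) &
          f x y g = a];
  tth_continuous : forall x y (g : ghom x y) (a : tA y) (W : set (ctot tA)),
    tD (hinv g) a -> nbhs (cinj (tth g a)) W ->
    \forall g' \near hom_arr g & e \near cinj a,
      forall x' y' (h : ghom x' y') (b : tA y'),
        hom_arr h = g' -> cinj b = e -> tD (hinv h) b -> W (cinj (tth h b));
  tthi_continuous : forall x y (g : ghom x y) (a : tA x) (W : set (ctot tA)),
    tD g a -> nbhs (cinj (tthi g a)) W ->
    \forall g' \near hom_arr g & e \near cinj a,
      forall x' y' (h : ghom x' y') (b : tA x'),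
        hom_arr h = g' -> cinj b = e -> tD h b -> W (cinj (tthi h b));
  tw_continuous : forall f : section2 tA, C0_section2 tJ f ->
    C0_section2 tJ (fun x y z g h => mleft (tw g h) (f x y z g h)) /\
    C0_section2 tJ (fun x y z g h => mright (tw g h) (f x y z g h)) }.

Arguments tD {R G} _ {x y} g _.
Arguments tth {R G} _ {x y} g _.
Arguments tthi {R G} _ {x y} g _.
Arguments tw {R G} _ {x y z} g h.
Arguments tJ {R G} _ {x y z} g h _.

(** * The Fell bundle of a twisted partial action *)

Section FellBundle.
Variables (R : realType) (G : groupoid) (T : twisted_partial_action R G).

(** The fibre over [g] of the associated Fell bundle: [Delta g a] is
    [a delta_g]. *)
Record fell_fibre (x y : objects G) (g : ghom x y) := Delta {
  delta_val :> tA T x;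
  delta_in : tD T g delta_val }.

Lemma fell_mul_in (x y z : objects G) (g : ghom x y) (h : ghom y z)
    (a : fell_fibre g) (b : fell_fibre h) :
  tD T (hmul g h)
    (mright (tw T g h) (tth T g (cmul (tthi T g a) b))).
Proof.
have [iso1 iso2 _ _ _] := tth_iso T g.
have [Da _] := iso2 _ (delta_in a).
have [_ _ _ idg _] := tD_ideal T (hinv g).
have [_ _ _ idh _] := tD_ideal T h.
have [D1 _] := idg _ b Da.
have [_ D2] := idh _ (tthi T g a) (delta_in b).
have [mul _] := (tw_unitary T g h).1.
have [|_ []//] := mul (tth T g (cmul (tthi T g a) b)).
by split; [case: (iso1 _ D1)|exact: tth_sub].
Qed.

Definition fell_mul (x y z : objects G) (g : ghom x y) (h : ghom y z)
    (a : fell_fibre g) (b : fell_fibre h) : fell_fibre (hmul g h) :=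
  Delta (fell_mul_in a b).

Lemma fell_star_in (x y : objects G) (g : ghom x y) (a : fell_fibre g) :
  tD T (hinv g)
    (mright (madj (tw T (hinv g) g)) (tthi T g (cstar a))).
Proof.
have [_ iso2 _ _ _] := tth_iso T g.
have [_ _ _ _ stg] := tD_ideal T g.
have sti : forall b, tD T (hinv g) b -> tD T (hinv g) (cstar b).
  by have [_ _ _ _] := tD_ideal T (hinv g).
have [Da _] := iso2 _ (stg _ (delta_in a)).
have [mul _] := (tw_unitary T (hinv g) g).1.
have [|[mulD _] _] := mul (cstar (tthi T g (cstar a))).
  by split; [exact: sti|rewrite hmulVg tD_id].
exact: sti mulD.
Qed.

Definition fell_star (x y : objects G) (g : ghom x y) (a : fell_fibre g) :
  fell_fibre (hinv g) := Delta (fell_star_in a).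

Lemma fell_unit_in (x : objects G) (a : tA T x) : tD T (hid x) a.
Proof. by rewrite tD_id. Qed.

Definition fell_unit (x : objects G) (a : tA T x) : fell_fibre (hid x) :=
  Delta (fell_unit_in a).

Definition fell_Cc (f : forall x y (g : ghom x y), fell_fibre g) : Prop :=
  rcontinuous (A := tA T) (fun x y g => f x y g) /\
  rcompact_support (A := tA T) (fun x y g => f x y g).

(** Compactly supported continuous sections of the pull-back of the field of
    ideals along the inversion. *)
Definition inv_Cc
    (f : forall x y (g : ghom x y), fell_fibre (hinv g)) : Prop :=
  scontinuous (A := tA T) (fun x y g => f x y g) /\
  scompact_support (A := tA T) (fun x y g => f x y g).

End FellBundle.

(** * Measurable fields of Hilbert spaces *)

Section Measurability.
Variables (R : realType) (G : groupoid).

(** Measurability of a complex function with respect to the completion of a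
    measure with null sets [N]. *)
Definition null_measurable (X : ptopologicalType) (N : set (set X))
    (f : X -> R[i]) : Prop :=
  exists f0 : X -> R[i],
    [/\ measurable_fun setT ((fun t => complex.Re (f0 t)) : borel X -> R),
        measurable_fun setT ((fun t => complex.Im (f0 t)) : borel X -> R) &
        N [set t | f t <> f0 t]].

(** A [nu]-measurable field of Hilbert spaces in the sense of Dixmier;
    [hsections] is the space of measurable sections. Separability of the
    fibres is part of [hfundamental]. *)
Record hilbertField (nu : {measure set (borel (objects G)) -> \bar R}) :=
  HilbertField {
  hfib :> objects G -> hilbertType R;
  hsections : set (forall x, hfib x);
  hsections0 : hsections (fun x => 0);
  hsections_linear : forall (k : R[i]) xi eta,
    hsections xi -> hsections eta -> hsections (fun x => k *: xi x + eta x);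
  hsections_norm : forall xi, hsections xi ->
    null_measurable (negligible nu) (fun x => `|xi x|);
  hsections_max : forall eta : forall x, hfib x,
    (forall xi, hsections xi ->
       null_measurable (negligible nu)
         (fun x => dot (hfib x) (xi x) (eta x))) ->
    hsections eta;
  hfundamental : exists e : nat -> forall x, hfib x,
    (forall n, hsections (e n)) /\
    forall x, closed_span (range (fun n => e n x)) = setT;
  hfib_neq0 : negligible nu [set x | forall u : hfib x, u = 0] }.

Arguments hsections {nu} _ _.

Variables (alpha : objects G -> {measure set (borel (arrows G)) -> \bar R})
          (nu : {measure set (borel (objects G)) -> \bar R}).

(** The null sets of [nu o alpha], the integral of [alpha x] against [nu]:
    a Borel set is null if it is [alpha x]-null for [nu]-almost all [x]. *)
Definition nualpha_null (N : set (arrows G)) : Prop :=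
  exists B : set (borel (arrows G)),
    [/\ measurable B, negligible nu [set x | alpha x B != 0%E] & N `<=` B].

(** The null sets of the image of [nu o alpha] under inversion. *)
Definition nualpha_inv_null (N : set (arrows G)) : Prop :=
  nualpha_null (@ginv G @^-1` N).

Variable H : hilbertField nu.

Definition hrsection := forall x y : objects G, ghom x y -> H x.
Definition hssection := forall x y : objects G, ghom x y -> H y.

(** The pull-back of [H] along the range map is a measurable field for
    [nu o alpha], the pull-back along the source map is one for the image of
    [nu o alpha] under inversion. *)
Definition rmeasurable (zeta : hrsection) : Prop :=
  forall eta, hsections H eta ->
    null_measurable nualpha_null
      (fun g => dot (H (rng g)) (zeta _ _ (arr g)) (eta (rng g))).

Definition smeasurable (xi : hssection) : Prop :=
  forall eta, hsections H eta ->
    null_measurable nualpha_inv_null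
      (fun g => dot (H (src g)) (xi _ _ (arr g)) (eta (src g))).

Variable T : twisted_partial_action R G.

(** Quasi-invariance: the restriction of [nu o alpha] to the set [S] of
    arrows [g] with [phi_(r(g))(D_g) H_(r(g)) <> 0] is equivalent to its image
    under inversion. *)
Definition quasi_invariant (phi : forall x, tA T x -> bop (H x) (H x)) : Prop :=
  let S := [set g : arrows G | exists a u,
              tD T (arr g) a /\ phi (rng g) a u <> 0] in
  forall B : set (borel (arrows G)), measurable B ->
    (nualpha_null (B `&` S) <-> nualpha_null ((@ginv G @^-1` B) `&` S)).

(** * Representations *)

Definition nondegenerate_rep (x : objects G)
    (phi : tA T x -> bop (H x) (H x)) : Prop :=
  [/\ forall (k : R[i]) a b u, phi (k *: a + b) u = k *: phi a u + phi b u,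
      forall a b u, phi (cmul a b) u = phi a (phi b u),
      forall a, adjoint (phi a) (phi (cstar a)) &
      closed_span [set v | exists a u, v = phi a u] = setT].

(** The closed subspace [phi(I) H_x]. *)
Definition act_space (x : objects G) (phi : tA T x -> bop (H x) (H x))
    (I : set (tA T x)) : set (H x) :=
  closed_span [set v | exists2 a, I a & exists u, v = phi a u].

(** [W] extends the unitary [phi(w)] of [phi(I) H_x], [w] being a multiplier
    of [I]. *)
Definition multiplier_image (x : objects G) (phi : tA T x -> bop (H x) (H x))
    (I : set (tA T x)) (w : multiplier (tA T x)) (W : bop (H x) (H x)) : Prop :=
  forall a, I a -> forall u, W (phi a u) = phi (mleft w a) u.

(** A unitary from [K] onto [L] is represented by the partial isometry [U]
    that extends it by zero on the orthogonal complement of [K]. *)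
Definition unitary_onto (x y : objects G) (K : set (H y)) (L : set (H x))
    (U : bop (H y) (H x)) : Prop :=
  [/\ forall u, K u -> L (U u),
      forall u v, K u -> K v -> dot (H x) (U u) (U v) = dot (H y) u v,
      forall v, L v -> exists2 u, K u & U u = v &
      forall v, (forall u, K u -> dot (H y) u v = 0) -> U v = 0].

(** The measurable sections of the field of Hilbert spaces
    [g |-> phi_(s(g))(D_(g^-1)) H_(s(g))]. It is generated by the sections
    [g |-> phi_(s(g))(a(g)) eta(g)] for compactly supported continuous [a] and
    measurable [eta]: measurable sections are pointwise limits of sequences of
    finite sums of these. If [G] is second countable and [C_0(G^0, A)] is
    separable, then [C_c(G, inv^* D)] contains a sequence that is an
    approximate unit in each fibre, so that these are all measurable sections
    of the pull-back of [H] along the source map with values in the given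
    subspaces. Without separability there may be more such sections, and the
    unitaries coming from a measurable Fell-bundle representation need not map
    the additional ones to measurable sections. *)
Definition elementary_section (phi : forall x, tA T x -> bop (H x) (H x))
    (xi : hssection) : Prop :=
  exists (n : nat)
    (a : 'I_n -> forall x y (g : ghom x y), fell_fibre T (hinv g))
    (eta : 'I_n -> hssection),
    [/\ forall i, inv_Cc (a i), forall i, smeasurable (eta i) &
        forall x y (g : ghom x y),
          xi x y g = \sum_(i < n) phi y (a i x y g) (eta i x y g)].

Definition domain_measurable (phi : forall x, tA T x -> bop (H x) (H x))
    (xi : hssection) : Prop :=
  exists xi_ : nat -> hssection,
    (forall n, elementary_section phi (xi_ n)) /\
    forall x y (g : ghom x y), (fun n => xi_ n x y g) @ \oo --> xi x y g.

Record covariant_rep := CovariantRep {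
  cr_phi : forall x, tA T x -> bop (H x) (H x);
  cr_U : forall x y : objects G, ghom x y -> bop (H y) (H x);
  cr_dom := (fun x y (g : ghom x y) => act_space (@cr_phi y) (tD T (hinv g)));
  cr_ran := (fun x y (g : ghom x y) => act_space (@cr_phi x) (tD T g));
  cr_phi_rep : forall x, nondegenerate_rep (@cr_phi x);
  cr_U_unitary : forall x y (g : ghom x y),
    unitary_onto (cr_dom g) (cr_ran g) (cr_U g);
  cr_quasi_invariant : quasi_invariant cr_phi;
  cr_covariant : forall x y (g : ghom x y),
    exists2 Us : bop (H x) (H y), adjoint (cr_U g) Us &
      forall a, tD T (hinv g) a -> forall u,
        cr_U g (cr_phi a (Us u)) = cr_phi (tth T g a) u;
  (* the partial map [U_g U_h] is a restriction of [phi(w(g,h)) U_gh] *)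
  cr_mul : forall x y z (g : ghom x y) (h : ghom y z),
    exists2 W : bop (H x) (H x),
      multiplier_image (@cr_phi x) (tJ T g h) (tw T g h) W &
      forall u, cr_dom h u -> cr_dom g (cr_U h u) ->
        [/\ cr_dom (hmul g h) u,
            act_space (@cr_phi x) (tJ T g h) (cr_U (hmul g h) u) &
            cr_U g (cr_U h u) = W (cr_U (hmul g h) u)];
  cr_phi_measurable : forall (a : forall x, tA T x) (xi : forall x, H x),
    C0_section a -> hsections H xi ->
    hsections H (fun x => cr_phi (a x) (xi x));
  cr_U_measurable : forall xi : hssection, domain_measurable cr_phi xi ->
    rmeasurable (fun x y g => cr_U g (xi x y g)) }.

Record fell_rep := FellRep {
  fr_S : forall (x y : objects G) (g : ghom x y),
    fell_fibre T g -> bop (H y) (H x);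
  fr_linear : forall x y (g : ghom x y) (k : R[i]) (a b c : fell_fibre T g),
    delta_val c = k *: delta_val a + delta_val b ->
    forall u, fr_S c u = k *: fr_S a u + fr_S b u;
  fr_mul : forall x y z (g : ghom x y) (h : ghom y z)
      (a : fell_fibre T g) (b : fell_fibre T h) u,
    fr_S a (fr_S b u) = fr_S (fell_mul a b) u;
  fr_star : forall x y (g : ghom x y) (a : fell_fibre T g),
    adjoint (fr_S a) (fr_S (fell_star a));
  fr_nondegenerate : forall x : objects G,
    closed_span [set v : H x | exists a u, v = fr_S (fell_unit a) u] = setT;
  fr_measurable : forall (f : forall x y (g : ghom x y), fell_fibre T g)
      (xi : hssection), fell_Cc f -> smeasurable xi ->
    rmeasurable (fun x y g => fr_S (f x y g) (xi x y g));
  fr_quasi_invariant : quasi_invariant (fun x a => fr_S (fell_unit a)) }.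

End Measurability.

(* Main.v *)
Require Import Defs.
From HB Require Import structures.
From mathcomp Require Import all_boot all_order all_algebra.
From mathcomp Require Import all_classical all_reals all_analysis.
From mathcomp Require Import measurable_realfun complex ring lra.

(** The bijection sends a covariant representation [(phi, U)] to
    [S_g(a) = phi(a) U_g].

    _From covariant to Fell bundle representations._ Covariance gives
    [U_g phi(c) = phi(theta_g(c)) U_g] ([cr_U_adjoint]). Hence
    [phi(a) U_g phi(b) U_h] is [phi(theta_g(c)) U_g U_h] with
    [c = theta_g^(-1)(a) b], and the composition axiom compares it with
    [phi(theta_g(c) w(g, h)) U_gh], the operator of the product in the Fell bundle
    ([cov_S_mul]). The involution is treated in the same way, with the composition axiom
    for [g^-1] and [g] ([cov_S_star]).

    _From Fell bundle representations to covariant representations._ On the units [S] is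
    a representation [phi] of the algebras. The relations
    [S_g(a)^* S_g(b) = phi(theta_g^(-1)(a^* b))] and [S_g(a) S_g(b)^* = phi(a b^* )]
    ([fell_SsS], [fell_SSs]) show that [phi(theta_g^(-1)(a)) u |-> S_g(a) u] extends to a
    unitary from [phi(D_(g^-1)) H] onto [phi(D_g) H]. This is [U_g], and
    [S_g(a) = phi(a) U_g] ([fell_phi_U]). The composition axiom is [fell_cr_mul]; it uses
    that [phi(I) H n phi(J) H] is generated by the vectors [phi(a) phi(b) v]
    ([rep_spanI]). The two constructions are inverse to each other because [U_x = 1] for
    units and [U_g] is determined by its values on [phi(D_(g^-1)) H].

    _Measurability._ For [f] in [C_c(G, A)] the operators satisfy
    [S_g(f(g)) = U_g phi(theta_g^(-1)(f(g)))], which makes the measurability conditions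
    on [U] and on [S] correspond to each other. What remains is that
    [x |-> phi_x(a(x)) xi(x)] is [nu]-measurable for [a] in [C_0(G^0, A)]
    ([fell_phi_measurable]). The measurability of [S] is a condition modulo null sets of
    [nu o alpha], and the units may form such a null set, so that it cannot be restricted
    to units. Instead:

    - for sections [f1], [f2] in [C_c(G, A)] the operators [phi(f1(g) f2(g)^* )] on the
      fibres at the ranges are [nu o alpha]-measurable, through the product
      [S(f1) S(f2)^*]; quasi-invariance is needed to apply [S(f1)] to a section of the
      form [S(f2)^* xi] ([fell_phi_product_measurable]);
    - [phi(f)] is the strong limit of [phi(f - f (1 - f^* f)^n)] when [|f| <= 1], so that
      products may be replaced by single sections ([fell_phi_Cc_measurable]);
    - near a unit, [a] at the range is uniformly close to a section in [C_c(G, A)], since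
      the ideals form a continuous family and representations are contractive
      ([star_rep_contraction]);
    - a function on [G^0] that is, up to a given bound, [nu o alpha]-measurable on an open
      set of arrows is up to the same bound [nu]-measurable on the units in that set. One
      takes fibrewise essential suprema; they are Borel functions because
      [x |-> alpha^x(E)] is Borel for all Borel subsets [E] of a relatively compact open
      set ([haar_measurable], [haar_descent]);
    - since [a] vanishes at infinity, finitely many such local approximations suffice for
      each error bound ([unit_global_approximation]). *)

Set Implicit Arguments.
Unset Strict Implicit.
Unset Printing Implicit Defensive.

Import Order.TTheory GRing.Theory Num.Theory.
Import numFieldNormedType.Exports.

Local Open Scope classical_set_scope.
Local Open Scope ring_scope.

Local Notation "x %:C" := (real_complex _ x)
  (format "x %:C") : ring_scope.

(** * Norms, spans and bounded operators *)

Section RealNorm.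
Variable R : realType.

(** Norms of modules over [R[i]] are complex numbers; this is the norm as a real number. *)
Definition rnorm (V : normedZmodType R[i]) (u : V) : R := complex.Re `|u|.

Lemma rnormE (V : normedZmodType R[i]) (u : V) : `|u| = (rnorm u)%:C.
Proof. by rewrite /rnorm RRe_real// ger0_real. Qed.

Lemma rnorm_ge0 (V : normedZmodType R[i]) (u : V) : 0 <= rnorm u.
Proof. by rewrite -lecR -rnormE normr_ge0. Qed.

Lemma rnorm0 (V : normedZmodType R[i]) : rnorm (0 : V) = 0.
Proof. by rewrite /rnorm normr0. Qed.

Lemma rnorm_eq0 (V : normedZmodType R[i]) (u : V) : rnorm u = 0 -> u = 0.
Proof. by move=> u0; apply: normr0_eq0; rewrite rnormE u0. Qed.

Lemma rnormN (V : normedZmodType R[i]) (u : V) : rnorm (- u) = rnorm u.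
Proof. by rewrite /rnorm normrN. Qed.

Lemma rnormB (V : normedZmodType R[i]) (u v : V) : rnorm (u - v) = rnorm (v - u).
Proof. by rewrite /rnorm distrC. Qed.

Lemma rnormD (V : normedZmodType R[i]) (u v : V) :
  rnorm (u + v) <= rnorm u + rnorm v.
Proof. by rewrite -lecR rmorphD /= -!rnormE ler_normD. Qed.

Lemma rnorm_dist (V : normedZmodType R[i]) (v u w : V) :
  rnorm (u - w) <= rnorm (u - v) + rnorm (v - w).
Proof. by have := rnormD (u - v) (v - w); rewrite addrA subrK. Qed.

Lemma rnormZ (V : normedModType R[i]) (k : R[i]) (u : V) :
  rnorm (k *: u) = rnorm k * rnorm u.
Proof. by apply: complexI; rewrite rmorphM /= -!rnormE normrZ. Qed.

Lemma rnormC (x : R) : rnorm (x%:C : R[i]) = `|x|.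
Proof. by rewrite /rnorm normc_def/= expr0n addr0 sqrtr_sqr. Qed.

Lemma rnorm_ltE (V : normedZmodType R[i]) (u : V) (e : R) :
  (`|u| < e%:C) = (rnorm u < e).
Proof. by rewrite rnormE ltcR. Qed.

Lemma complex_gt0 (t : R[i]) : 0 < t -> exists2 e : R, 0 < e & t = e%:C.
Proof.
move=> t0; exists (complex.Re t); last by rewrite RRe_real// gtr0_real.
by rewrite -ltcR RRe_real// gtr0_real.
Qed.

Lemma cvg_rnormP (V : normedModType R[i]) (F : set_system V) (l : V) :
  Filter F ->
  F --> l <-> forall e : R, 0 < e -> \forall v \near F, rnorm (l - v) < e.
Proof.
move=> FF; split=> [/cvgrPdist_lt Fl e e0|Fl].
  have := Fl e%:C; rewrite ltcR => /(_ e0); apply: filterS => v.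
  by rewrite rnorm_ltE.
apply/cvgrPdist_lt => t /complex_gt0[e e0 ->].
by apply: filterS (Fl e e0) => v; rewrite rnorm_ltE.
Qed.

Lemma closure_rnormP (V : normedModType R[i]) (X : set V) (u : V) :
  closure X u <-> forall e : R, 0 < e -> exists2 v, X v & rnorm (u - v) < e.
Proof.
split=> [Xu e e0|Xu B].
  have : nbhs u (ball u e%:C) by apply: nbhsx_ballx; rewrite ltcR.
  move=> /Xu[v [Xv]]; rewrite -ball_normE /= rnorm_ltE => uv.
  by exists v.
move=> /nbhs_ballP[t /= /complex_gt0[e e0 ->] uB].
have [v Xv uv] := Xu e e0; exists v; split=> //; apply: uB.
by rewrite -ball_normE /= rnorm_ltE.
Qed.

Lemma natSinv_lt (e : R) : 0 < e ->
  exists N, forall n, (N <= n)%N -> n.+1%:R^-1 < e.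
Proof.
move=> e0; have [N _ NP] := near_infty_natSinv_lt (PosNum e0).
by exists N => n /NP.
Qed.

Lemma rnorm_cauchy_cvg (V : completeNormedModType R[i]) (u : nat -> V) :
  (forall e : R, 0 < e -> exists N, forall m n, (N <= m)%N -> (N <= n)%N ->
     rnorm (u m - u n) < e) ->
  exists l : V, u @ \oo --> l.
Proof.
move=> uC; suff : cvg (u @ \oo) by exists (lim (u @ \oo)).
apply/cauchy_cvgP/cauchy_ballP => t /complex_gt0[e e0 ->].
have [N uN] := uC e e0.
have uF : nbhs (u @ \oo) [set v | exists2 n, (N <= n)%N & v = u n].
  by exists N => // n Nn; exists n.
exists ([set v | exists2 n, (N <= n)%N & v = u n],
        [set v | exists2 n, (N <= n)%N & v = u n]) => //=.
case=> v w /= [[m Nm ->] [n Nn ->]].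
by rewrite -ball_normE /= rnorm_ltE; exact: uN.
Qed.

End RealNorm.

Section Spans.
Variables (R : realType) (V : completeNormedModType R[i]).
Implicit Types (X : set V) (u v : V).

Definition linear_set X := X 0 /\
  forall (k : R[i]) u v, X u -> X v -> X (k *: u + v).

Lemma lin_span_ind X (P : set V) : P 0 ->
  (forall (k : R[i]) x v, X x -> P v -> P (k *: x + v)) -> lin_span X `<=` P.
Proof.
move=> P0 PD v [n [c [u [Xu ->]]]] {v}.
elim: n c u Xu => [|n IH] c u Xu; first by rewrite big_ord0.
by rewrite big_ord_recl; apply: PD => //; exact: IH.
Qed.

Lemma lin_span_cons X (k : R[i]) x v :
  X x -> lin_span X v -> lin_span X (k *: x + v).
Proof.
move=> Xx [n [c [u [Xu ->]]]].
exists n.+1, (fun i => oapp c k (unlift ord0 i)),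
  (fun i => oapp u x (unlift ord0 i)); split.
  by move=> i; case: unliftP => [j|] _ /=.
rewrite big_ord_recl unlift_none /=; congr (_ + _).
by apply: eq_bigr => i _; rewrite liftK.
Qed.

Lemma lin_span_linear X : linear_set (lin_span X).
Proof.
have X0 : lin_span X 0.
  by exists 0%N, (fun=> 0), (fun=> 0); split=> [[]//|]; rewrite big_ord0.
split=> // k u v uX vX; move: u uX; apply: lin_span_ind.
  by rewrite scaler0 add0r.
by move=> l x u Xx; rewrite scalerDr scalerA -addrA; exact: lin_span_cons.
Qed.

Lemma sub_lin_span X : X `<=` lin_span X.
Proof.
move=> x Xx; have := lin_span_cons 1 Xx (lin_span_linear X).1.
by rewrite scale1r addr0.
Qed.

Lemma closure_linear X : linear_set X -> linear_set (closure X).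
Proof.
move=> [X0 XD]; split; first exact: subset_closure.
move=> k u v /closure_rnormP uX /closure_rnormP vX; apply/closure_rnormP => e e0.
have k0 : 0 < rnorm k + 1 by rewrite ltr_wpDl// rnorm_ge0.
have [u' Xu' uu'] := uX (e / 2 / (rnorm k + 1)) ltac:(by rewrite !divr_gt0).
have [v' Xv' vv'] := vX (e / 2) ltac:(by rewrite divr_gt0).
exists (k *: u' + v'); first exact: XD.
rewrite opprD addrACA -scalerBr [e]splitr.
apply: (le_lt_trans (rnormD _ _)); apply: ler_ltD => //.
rewrite rnormZ; rewrite ltr_pdivlMr// in uu'.
apply: le_trans (ltW uu'); rewrite mulrC; apply: ler_wpM2l.
  exact: rnorm_ge0.
by rewrite lerDl.
Qed.

Lemma closed_span_linear X : linear_set (closed_span X).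
Proof. exact/closure_linear/lin_span_linear. Qed.

Lemma sub_closed_span X : X `<=` closed_span X.
Proof. by apply: subset_trans (@subset_closure _ _); exact: sub_lin_span. Qed.

Lemma closed_closed_span X : closed (closed_span X).
Proof. exact: closed_closure. Qed.

Lemma closed_span_sub X (P : set V) : closed P -> linear_set P -> X `<=` P ->
  closed_span X `<=` P.
Proof.
move=> clP [P0 PD] XP; rewrite (closure_id P).1//; apply: closureS.
by apply: lin_span_ind => // k x v /XP; exact: PD.
Qed.

Lemma closed_span_mono X Y : X `<=` closed_span Y -> closed_span X `<=` closed_span Y.
Proof.
by apply: closed_span_sub; [exact: closed_closed_span|exact: closed_span_linear].
Qed.

Lemma linear_setZ X k u : linear_set X -> X u -> X (k *: u).
Proof. by move=> [X0 XD] Xu; have := XD k _ _ Xu X0; rewrite addr0. Qed.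

Lemma linear_setD X u v : linear_set X -> X u -> X v -> X (u + v).
Proof. by move=> [X0 XD] Xu Xv; have := XD 1 _ _ Xu Xv; rewrite scale1r. Qed.

Lemma linear_setB X u v : linear_set X -> X u -> X v -> X (u - v).
Proof.
by move=> [X0 XD] Xu Xv; have := XD (-1) _ _ Xv Xu; rewrite scaleN1r addrC.
Qed.

End Spans.

Section BoundedOps.
Variables (R : realType) (V W : completeNormedModType R[i]) (T : bop V W).

Lemma bopP k u v : T (k *: u + v) = k *: T u + T v.
Proof. exact: bop_linear. Qed.

Lemma bop0 : T 0 = 0.
Proof. by have := bopP (-1) 0 0; rewrite scaleN1r addNr scaleN1r addNr. Qed.

Lemma bopD u v : T (u + v) = T u + T v.
Proof. by rewrite -{1}(scale1r u) bopP scale1r. Qed.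

Lemma bopZ k u : T (k *: u) = k *: T u.
Proof. by rewrite -(addr0 (k *: u)) bopP bop0 addr0. Qed.

Lemma bopN u : T (- u) = - T u.
Proof. by rewrite -scaleN1r bopZ scaleN1r. Qed.

Lemma bopB u v : T (u - v) = T u - T v.
Proof. by rewrite bopD bopN. Qed.

Lemma bop_sum n (u : 'I_n -> V) : T (\sum_(i < n) u i) = \sum_(i < n) T (u i).
Proof. exact: (big_morph T bopD bop0). Qed.

Lemma bop_closed_preimage (P : set W) : closed P -> closed [set u | P (T u)].
Proof. by move=> clP; apply: closed_comp => // u _; exact: bop_continuous. Qed.

End BoundedOps.

Lemma bop_ext (R : realType) (V W : completeNormedModType R[i]) (T S : bop V W) :
  (forall u, T u = S u) -> T = S.
Proof.
case: T S => [T Tl Tc] [S Sl Sc] /= TS.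
have {TS}TS : T = S by exact/funext.
by subst S; congr Bop; exact: Prop_irrelevance.
Qed.

Lemma bop_eq_closed (R : realType) (V W : completeNormedModType R[i])
    (T S : bop V W) : closed [set u | T u = S u].
Proof.
have -> : [set u | T u = S u] = (fun u => T u - S u) @^-1` [set 0].
  by apply/seteqP; split=> u /= => [->|/subr0_eq//]; rewrite subrr.
apply: closed_comp => [u _|].
  by apply: cvgB; exact: bop_continuous.
exact/accessible_closed_set1/hausdorff_accessible/norm_hausdorff.
Qed.

Lemma bop_eq_linear (R : realType) (V W : completeNormedModType R[i])
    (T S : bop V W) : linear_set [set u | T u = S u].
Proof.
by split=> [|k u v /= uE vE]; rewrite /= ?bop0// !bopP uE vE.
Qed.

Definition bop_comp (R : realType) (U V W : completeNormedModType R[i])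
  (T : bop V W) (S : bop U V) : bop U W.
Proof.
refine (@Bop _ _ _ (T \o S) _ _).
  by move=> k u v; rewrite /= !bopP.
by move=> u; apply: continuous_comp; exact: bop_continuous.
Defined.

Lemma near_rnorm (R : realType) (V : normedModType R[i]) (u : V) (e : R) :
  0 < e -> \forall v \near u, rnorm (u - v) < e.
Proof.
move=> e0; have : nbhs u (ball u e%:C) by apply: nbhsx_ballx; rewrite ltcR.
by apply: filterS => v; rewrite -ball_normE /= rnorm_ltE.
Qed.

Lemma bop_contraction_continuous (R : realType) (V W : completeNormedModType R[i])
    (T : V -> W) : linear T -> (forall u, rnorm (T u) <= rnorm u) -> continuous T.
Proof.
move=> Tl T1 u; apply/cvg_rnormP => e e0.
apply: filterS (near_rnorm u e0) => v uv; apply: le_lt_trans uv.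
apply: le_trans (T1 (u - v)).
have -> : u - v = (-1) *: v + u by rewrite scaleN1r addrC.
by rewrite Tl scaleN1r addrC.
Qed.

(** * Hilbert spaces *)

Section Hilbert.
Variables (R : realType) (H : hilbertType R).
Implicit Types u v w : H.
Notation "'<< u , v >>" := (dot H u v) (at level 8, format "''<<' u ,  v '>>'").

Definition rdot u v : R := complex.Re '<<u, v>>.

Lemma dotC u v : '<<u, v>> = ('<<v, u>>)^*.
Proof. by rewrite hermC /= expr0 mul1r. Qed.

Lemma dotZl k u v : '<<k *: u, v>> = k * '<<u, v>>.
Proof. by rewrite linearZl_LR. Qed.
Lemma dotZr k u v : '<<u, k *: v>> = k^* * '<<u, v>>.
Proof. by rewrite linearZr_LR. Qed.
Lemma dotDl u v w : '<<u + v, w>> = '<<u, w>> + '<<v, w>>.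
Proof. by rewrite linearDl. Qed.
Lemma dotDr u v w : '<<w, u + v>> = '<<w, u>> + '<<w, v>>.
Proof. by rewrite linearDr. Qed.
Lemma dotBl u v w : '<<u - v, w>> = '<<u, w>> - '<<v, w>>.
Proof. by rewrite linearBl. Qed.
Lemma dotBr u v w : '<<w, u - v>> = '<<w, u>> - '<<w, v>>.
Proof. by rewrite linearBr. Qed.
Lemma dot0l u : '<<0, u>> = 0.
Proof. by rewrite linear0l. Qed.
Lemma dot0r u : '<<u, 0>> = 0.
Proof. by rewrite linear0r. Qed.

Lemma dot_eq0C u v : '<<u, v>> = 0 -> '<<v, u>> = 0.
Proof. by move=> uv; rewrite dotC uv rmorph0. Qed.

Lemma dotE u : '<<u, u>> = (rnorm u ^+ 2)%:C.
Proof. by rewrite -dot_norm rnormE rmorphXn. Qed.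

Lemma rdotE u : rdot u u = rnorm u ^+ 2.
Proof. by rewrite /rdot dotE. Qed.

Lemma dot_eq0 u : '<<u, u>> = 0 -> u = 0.
Proof.
rewrite dotE => /(congr1 (@complex.Re R)) /= /eqP.
by rewrite sqrf_eq0 => /eqP /rnorm_eq0.
Qed.

Lemma dot_inj u v : (forall w, '<<u, w>> = '<<v, w>>) -> u = v.
Proof.
by move=> uv; apply/subr0_eq/dot_eq0; rewrite dotBl uv subrr.
Qed.

Lemma ReD (x y : R[i]) : complex.Re (x + y) = complex.Re x + complex.Re y.
Proof. by case: x y => [a b] []. Qed.
Lemma ReN (x : R[i]) : complex.Re (- x) = - complex.Re x.
Proof. by case: x. Qed.
Lemma Re_conj (x : R[i]) : complex.Re (x^*) = complex.Re x.
Proof. by case: x. Qed.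
Lemma Re_realM (t : R) (x : R[i]) : complex.Re (t%:C * x) = t * complex.Re x.
Proof. by case: x => [a b] /=; rewrite mul0r subr0. Qed.
Lemma conj_real (t : R) : (t%:C : R[i])^* = t%:C.
Proof. by apply: conjc_real. Qed.

Lemma rdotC u v : rdot u v = rdot v u.
Proof. by rewrite /rdot dotC Re_conj. Qed.

Lemma rdotZr (t : R) u v : rdot u (t%:C *: v) = t * rdot u v.
Proof. by rewrite /rdot dotZr conj_real Re_realM. Qed.
Lemma rdotZl (t : R) u v : rdot (t%:C *: u) v = t * rdot u v.
Proof. by rewrite rdotC rdotZr rdotC. Qed.
Lemma rdotDl u v w : rdot (u + v) w = rdot u w + rdot v w.
Proof. by rewrite /rdot dotDl ReD. Qed.
Lemma rdotBl u v w : rdot (u - v) w = rdot u w - rdot v w.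
Proof. by rewrite /rdot dotBl ReD ReN. Qed.
Lemma rdotDr u v w : rdot w (u + v) = rdot w u + rdot w v.
Proof. by rewrite /rdot dotDr ReD. Qed.
Lemma rdotBr u v w : rdot w (u - v) = rdot w u - rdot w v.
Proof. by rewrite /rdot dotBr ReD ReN. Qed.

Lemma rnorm_sqB u v :
  rnorm (u - v) ^+ 2 = rnorm u ^+ 2 - 2 * rdot u v + rnorm v ^+ 2.
Proof. by rewrite -!rdotE rdotBl !rdotBr (rdotC v u); ring. Qed.

Lemma rnorm_sqD u v :
  rnorm (u + v) ^+ 2 = rnorm u ^+ 2 + 2 * rdot u v + rnorm v ^+ 2.
Proof. by rewrite -!rdotE rdotDl !rdotDr (rdotC v u); ring. Qed.

Lemma rdot_cauchy_schwarz u v : rdot u v <= rnorm u * rnorm v.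
Proof.
have := rnorm_ge0 u; rewrite le_eqVlt => /orP[/eqP u0|u0].
  by rewrite (rnorm_eq0 (esym u0)) rnorm0 mul0r /rdot dot0l.
have := rnorm_ge0 v; rewrite le_eqVlt => /orP[/eqP v0|v0].
  by rewrite (rnorm_eq0 (esym v0)) rnorm0 mulr0 /rdot dot0r.
have := sqr_ge0 (rnorm ((rnorm v)%:C *: u - (rnorm u)%:C *: v)).
rewrite rnorm_sqB rdotZl rdotZr !rnormZ !rnormC !ger0_norm ?rnorm_ge0//.
set a := rnorm u; set b := rnorm v => h.
have ab : 0 < a * b by rewrite mulr_gt0.
have : 0 <= (a * b) * (a * b - rdot u v) by nra.
by rewrite pmulr_rge0// subr_ge0.
Qed.

Lemma cauchy_schwarz u v : rnorm '<<u, v>> <= rnorm u * rnorm v.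
Proof.
have := rnorm_ge0 '<<u, v>>; rewrite le_eqVlt => /orP[/eqP <-|z0].
  by rewrite mulr_ge0// rnorm_ge0.
have := rdot_cauchy_schwarz (('<<u, v>>)^* *: u) v.
rewrite /rdot dotZl rnormZ [rnorm (_^*)](_ : _ = rnorm '<<u, v>>); last first.
  by rewrite /rnorm norm_conjC.
have -> : ('<<u, v>>)^* * '<<u, v>> = (rnorm '<<u, v>> ^+ 2)%:C.
  by rewrite mulrC -normCK rnormE rmorphXn.
by rewrite /= expr2 -mulrA ler_pM2l.
Qed.

Lemma dot_continuous v : continuous (fun u => dot H u v : R[i]^o).
Proof.
move=> u; apply/cvg_rnormP => e e0.
have v0 : 0 < rnorm v + 1 by rewrite ltr_wpDl// rnorm_ge0.
have e1 : 0 < e / (rnorm v + 1) by rewrite divr_gt0.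
apply: filterS (near_rnorm u e1) => w; rewrite ltr_pdivlMr// => uw.
change (rnorm ('<<u, v>> - '<<w, v>>) < e); rewrite -dotBl.
apply: le_lt_trans (cauchy_schwarz _ _) _.
by apply: le_lt_trans uw; rewrite ler_wpM2l ?rnorm_ge0// lerDl.
Qed.

Lemma perp_closed v : closed [set u | '<<u, v>> = 0].
Proof.
have -> : [set u | '<<u, v>> = 0] = (fun u => dot H u v : R[i]^o) @^-1` [set 0].
  by [].
apply: closed_comp => [u _|]; first exact: dot_continuous.
exact/accessible_closed_set1/hausdorff_accessible/norm_hausdorff.
Qed.

Lemma perp_linear v : linear_set [set u | '<<u, v>> = 0].
Proof.
split=> [|k u w /= uv wv]; first by rewrite /= dot0l.
by rewrite /= dotDl dotZl uv wv mulr0 addr0.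
Qed.

Lemma closed_span_perp (X : set H) v : (forall x, X x -> '<<x, v>> = 0) ->
  forall u, closed_span X u -> '<<u, v>> = 0.
Proof.
by move=> Xv; exact: (closed_span_sub (@perp_closed v) (@perp_linear v) Xv).
Qed.

Lemma closed_span_perp_eq0 (X : set H) v : closed_span X v ->
  (forall x, X x -> '<<x, v>> = 0) -> v = 0.
Proof. by move=> Xv vX; apply/dot_eq0/(closed_span_perp vX). Qed.

(** Minimising sequences for the distance to [X] are Cauchy by the parallelogram
    identity, and the difference from the minimiser is orthogonal to [X] by the first
    variation. *)
Lemma orthogonal_decomposition (X : set H) u :
  exists2 k, closed_span X k & forall x, X x -> '<<x, u - k>> = 0.
Proof.
have [L0 LD] := lin_span_linear X.
pose D := [set (rnorm (u - v) ^+ 2) | v in lin_span X].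
have D_inf : has_inf D.
  split; first by exists (rnorm (u - 0) ^+ 2), 0.
  by exists 0 => _ [v _ <-]; exact: sqr_ge0.
pose d := inf D.
have d_le v : lin_span X v -> d <= rnorm (u - v) ^+ 2.
  by move=> Xv; apply: inf_lbound; [case: D_inf|exists v].
have approx n : exists v, lin_span X v /\ rnorm (u - v) ^+ 2 < d + n.+1%:R^-1.
  have [|_ [v Xv <-] lt] := @inf_adherent _ D (n.+1%:R^-1) _ D_inf.
    by rewrite invr_gt0.
  by exists v.
have [v /all_and2[Xv vd]] := choice approx.
have close m n : rnorm (v m - v n) ^+ 2 <= 2 * (m.+1%:R^-1 + n.+1%:R^-1).
  have := d_le _ (linear_setZ (2^-1)%:C (lin_span_linear X)
                (linear_setD (lin_span_linear X) (Xv m) (Xv n))).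
  have -> : u - (2^-1)%:C *: (v m + v n) = (2^-1)%:C *: ((u - v m) + (u - v n)).
    have {1}-> : u = (2^-1)%:C *: (u + u).
      rewrite -mulr2n -(scaler_nat 2 u) scalerA.
      by rewrite -(rmorph_nat (real_complex R)) -rmorphM /= mulVf// scale1r.
    by rewrite -scalerBr addrACA opprD.
  have -> : v m - v n = (u - v n) - (u - v m) by rewrite opprB [RHS]addrC addrA subrK.
  have := vd m; have := vd n; set a := u - v m; set b := u - v n => bd ad.
  rewrite rnormZ rnormC ger0_norm// exprMn (rnorm_sqD a) (rnorm_sqB b) (rdotC b).
  move: bd ad; clearbody a b d; move: (rdot a b) (rnorm a ^+ 2) (rnorm b ^+ 2) => p q r.
  move: (m.+1%:R^-1) (n.+1%:R^-1) => mm nn. by lra.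
have [|k vk] := @rnorm_cauchy_cvg _ H v.
  move=> e e0; have [|N small] := @natSinv_lt R (e ^+ 2 / 4).
    by rewrite divr_gt0// exprn_gt0.
  exists N => m n Nm Nn.
  rewrite -(ltr_pXn2r (n := 2)) ?nnegrE ?rnorm_ge0 ?ltW//.
  apply: le_lt_trans (close m n) _.
  move: (small m Nm) (small n Nn).
  by move: (m.+1%:R^-1) (n.+1%:R^-1) => x y; lra.
have kX : closed_span X k.
  apply/closure_rnormP => e e0.
  have [N _ /(_ N (leqnn N)) ?] := (cvg_rnormP k _).1 vk e e0.
  by exists (v N).
have kx x : lin_span X x -> rdot (u - k) x <= 0.
  move=> Xx; rewrite leNgt; apply/negP => r0.
  (* The first variation in the direction [x], with a step [t] for which the quadratic
     term is at most half of the linear one. *)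
  set r := rdot _ _ in r0; pose a := rnorm x; pose t := r / (a ^+ 2 + 1).
  have a0 : 0 <= a by exact: rnorm_ge0.
  have a1 : 0 < a ^+ 2 + 1 by rewrite ltr_wpDl// sqr_ge0.
  have t0 : 0 < t by rewrite divr_gt0.
  have tr : t * a ^+ 2 <= r.
    by rewrite /t mulrAC ler_pdivrMr// ler_pM2l// lerDl.
  have tx n : t * r <= n.+1%:R^-1 + 2 * t * (rnorm (k - v n) * a).
    have := d_le _ (linear_setD (lin_span_linear X) (Xv n)
                 (linear_setZ t%:C (lin_span_linear X) Xx)).
    have := vd n; rewrite opprD addrA.
    have rE : r = rdot (u - v n) x - rdot (k - v n) x.
      by rewrite -rdotBl opprB addrA subrK.
    have qa : - rdot (k - v n) x <= rnorm (k - v n) * a.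
      have := rdot_cauchy_schwarz (v n - k) x.
      by rewrite (rnormB k); rewrite -(opprB (v n) k) /rdot linearNl /= ReN opprK.
    move: rE qa; set z := u - v n; set q := rdot (k - v n) x => rE qa vdn.
    rewrite (rnorm_sqB z) rdotZr rnormZ rnormC (ger0_norm (ltW t0)) -/a exprMn => dx.
    have : t * (t * a ^+ 2) <= t * r by rewrite ler_pM2l.
    have : t * (- q) <= t * (rnorm (k - v n) * a) by rewrite ler_pM2l.
    by move: vdn dx; rewrite rE; move: (n.+1%:R^-1) => y; lra.
  have e0 : 0 < r / (4 * (a + 1)) by rewrite divr_gt0// mulr_gt0// ltr_wpDl.
  have [N1 _ N1P] := (cvg_rnormP k _).1 vk _ e0.
  have tr0 : 0 < t * r / 4 by rewrite divr_gt0// mulr_gt0.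
  have [N2 N2P] := natSinv_lt tr0.
  pose n := maxn N1 N2.
  have n1 : (n.+1%:R^-1 : R) < t * r / 4 by apply: N2P; exact: leq_maxr.
  have /= := N1P n (leq_maxl _ _).
  rewrite ltr_pdivlMr ?mulr_gt0// ?ltr_wpDl// => vn.
  have vn' : rnorm (k - v n) * a <= r / 4.
    by have := rnorm_ge0 (k - v n); nra.
  have : t * (rnorm (k - v n) * a) <= t * (r / 4) by rewrite ler_pM2l.
  by move: (tx n) n1; move: (n.+1%:R^-1) => y; lra.
exists k => // x /sub_lin_span Xx.
have kx0 y : lin_span X y -> rdot (u - k) y = 0.
  move=> Xy; apply/eqP; rewrite eq_le kx//= -oppr_le0.
  have := kx _ (linear_setZ (-1) (lin_span_linear X) Xy).
  by rewrite scaleN1r /rdot linearNr /= ReN.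
apply: dot_eq0C.
have := kx0 _ Xx; have := kx0 _ (linear_setZ 'i (lin_span_linear X) Xx).
rewrite /rdot dotZr; case: ('<<_, _>>) => a b /=.
by rewrite !mul0r !add0r !mulN1r opprK => -> ->.
Qed.

End Hilbert.

Section BopDot.
Variables (R : realType) (V W : hilbertType R) (T : bop V W) (x : W) (y : V).

Lemma bop_dot_closed : closed [set u | dot W (T u) x = dot V u y].
Proof.
have -> : [set u | dot W (T u) x = dot V u y] =
    (fun u => (dot W (T u) x : R[i]^o) - (dot V u y : R[i]^o)) @^-1` [set 0].
  by apply/seteqP; split=> u /= => [->|/subr0_eq//]; rewrite subrr.
apply: closed_comp => [u _|].
  apply: cvgB; last exact: dot_continuous.
  apply: (@continuous_comp _ _ _ T (fun w => dot W w x : R[i]^o)).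
    exact: bop_continuous.
  exact: dot_continuous.
exact/accessible_closed_set1/hausdorff_accessible/norm_hausdorff.
Qed.

Lemma bop_dot_linear : linear_set [set u | dot W (T u) x = dot V u y].
Proof.
split=> [|k u w /= uE wE]; first by rewrite /= bop0 !dot0l.
by rewrite /= bopP !dotDl !dotZl uE wE.
Qed.

End BopDot.

Section IsometryExtension.
Variables (R : realType).

Section OneSided.
Variables (V W : hilbertType R) (I : Type) (p : I -> V) (q : I -> W).
Hypothesis pq : forall i j, dot W (q i) (q j) = dot V (p i) (p j).

(** The linear span of the pairs [(p i, q i)]. Stating the isometry for this relation,
    as in [isom_graph_dot], makes the induced map on the span of [p] well defined
    without a separate argument. *)
Inductive isom_graph : V -> W -> Prop :=
| isom_graph0 : isom_graph 0 0
| isom_graph_cons (k : R[i]) i a b :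
    isom_graph a b -> isom_graph (k *: p i + a) (k *: q i + b).

Lemma isom_graphP k a b a' b' : isom_graph a b -> isom_graph a' b' ->
  isom_graph (k *: a + a') (k *: b + b').
Proof.
move=> ab ab'; elim: ab => [|l i a0 b0 _ IH]; first by rewrite !scaler0 !add0r.
by rewrite !scalerDr -!addrA !scalerA; exact: isom_graph_cons.
Qed.

Lemma isom_graph_gen i : isom_graph (p i) (q i).
Proof.
by have := isom_graph_cons 1 i isom_graph0; rewrite !scale1r !addr0.
Qed.

Lemma isom_graph_dom a : lin_span (range p) a -> exists b, isom_graph a b.
Proof.
move: a; apply: (@lin_span_ind _ _ _ [set a | exists b, isom_graph a b]).
  by exists 0; exact: isom_graph0.
by move=> k _ v [i _ <-] [b vb]; exists (k *: q i + b); exact: isom_graph_cons.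
Qed.

Lemma isom_graph_ran a b : isom_graph a b -> lin_span (range q) b.
Proof.
elim=> [|k i a0 b0 _ IH]; first exact: (lin_span_linear _).1.
by apply: lin_span_cons => //; exists i.
Qed.

Lemma isom_graph_dot a b a' b' : isom_graph a b -> isom_graph a' b' ->
  dot W b b' = dot V a a'.
Proof.
move=> ab ab'.
have gen i : dot W (q i) b' = dot V (p i) a'.
  elim: ab' => [|l j a0 b0 _ IH]; first by rewrite !dot0r.
  by rewrite !dotDr !dotZr pq IH.
elim: ab => [|l j a0 b0 _ IH]; first by rewrite !dot0l.
by rewrite !dotDl !dotZl gen IH.
Qed.

Lemma isom_graph_norm a b : isom_graph a b -> rnorm b = rnorm a.
Proof.
move=> ab; apply/eqP; rewrite -(eqrXn2 (n := 2)) ?rnorm_ge0//.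
by rewrite -!rdotE /rdot (isom_graph_dot ab ab).
Qed.

Definition isom_closure (k : V) (l : W) := forall e : R, 0 < e ->
  exists a b, [/\ isom_graph a b, rnorm (k - a) < e & rnorm (l - b) < e].

Lemma isom_closure_norm k l : isom_closure k l -> rnorm l = rnorm k.
Proof.
move=> kl; apply/eqP; rewrite -subr_eq0 -normr_eq0 eq_le normr_ge0 andbT.
apply/ler_addgt0Pl => e e0; rewrite addr0.
have [a [b [ab ka lb]]] := kl (e / 2) ltac:(by rewrite divr_gt0).
have := isom_graph_norm ab.
have := rnorm_dist 0 k a; have := rnorm_dist a k 0.
have := rnorm_dist 0 l b; have := rnorm_dist b l 0.
rewrite !subr0 !sub0r !rnormN.
have := rnormD (l - b) b; have := rnormD (k - a) a.
have := rnormD (b - l) l; have := rnormD (a - k) k.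
rewrite !subrK (rnormB b) (rnormB a) ler_norml => *; apply/andP; split; lra.
Qed.

Lemma isom_closureP c k l k' l' : isom_closure k l -> isom_closure k' l' ->
  isom_closure (c *: k + k') (c *: l + l').
Proof.
move=> kl kl' e e0.
have c0 : 0 < rnorm c + 1 by rewrite ltr_wpDl// rnorm_ge0.
have [a [b [ab ka lb]]] := kl (e / 2 / (rnorm c + 1)) ltac:(by rewrite !divr_gt0).
have [a' [b' [ab' ka' lb']]] := kl' (e / 2) ltac:(by rewrite divr_gt0).
exists (c *: a + a'), (c *: b + b'); split; first exact: isom_graphP.
  rewrite opprD addrACA -scalerBr; apply: le_lt_trans (rnormD _ _) _.
  rewrite rnormZ; rewrite ltr_pdivlMr// in ka.
  have := rnorm_ge0 (k - a); have := rnorm_ge0 c; nra.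
rewrite opprD addrACA -scalerBr; apply: le_lt_trans (rnormD _ _) _.
rewrite rnormZ; rewrite ltr_pdivlMr// in lb.
have := rnorm_ge0 (l - b); have := rnorm_ge0 c; nra.
Qed.

Lemma isom_closure_gen i : isom_closure (p i) (q i).
Proof.
move=> e e0; exists (p i), (q i); rewrite !subrr !rnorm0; split=> //.
exact: isom_graph_gen.
Qed.

Lemma isom_closure_ran k l : isom_closure k l -> closed_span (range q) l.
Proof.
move=> kl; apply/closure_rnormP => e /kl[a [b [ab _ lb]]].
by exists b => //; exact: isom_graph_ran ab.
Qed.

Lemma isom_closure_dom k : closed_span (range p) k -> exists l, isom_closure k l.
Proof.
move=> /closure_rnormP kp.
have /choice[a aP] n : exists a, lin_span (range p) a /\ rnorm (k - a) < n.+1%:R^-1.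
  by have [|a ? ?] := kp n.+1%:R^-1; [rewrite invr_gt0|exists a].
have /choice[b bP] n := isom_graph_dom (aP n).1.
have [|l bl] := @rnorm_cauchy_cvg _ W b.
  move=> e e0; have [|N NP] := @natSinv_lt R (e / 2); first by rewrite divr_gt0.
  exists N => m n /NP Nm /NP Nn.
  have mn : isom_graph (a m - a n) (b m - b n).
    have := isom_graphP (-1) (bP n) (bP m).
    by rewrite !scaleN1r addrC (addrC _ (b m)).
  rewrite (isom_graph_norm mn); apply: le_lt_trans (rnorm_dist k _ _) _.
  rewrite rnormB; move: (aP m).2 (aP n).2 Nm Nn.
  by move: (m.+1%:R^-1) (n.+1%:R^-1) => x y; lra.
exists l => e e0.
have [N1 N1P] := natSinv_lt e0.
have [N2 _ N2P] := (cvg_rnormP l _).1 bl e e0.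
exists (a (maxn N1 N2)), (b (maxn N1 N2)); split=> //.
  by apply: lt_trans (aP _).2 _; apply: N1P; exact: leq_maxl.
by apply: N2P; exact: leq_maxr.
Qed.

Lemma isometry_extension_half : exists U : bop V W,
  [/\ forall i, U (p i) = q i,
      forall u, closed_span (range q) (U u) &
      forall v, (forall i, dot V (p i) v = 0) -> U v = 0].
Proof.
pose rel u l := exists k, [/\ closed_span (range p) k,
  forall i, dot V (p i) (u - k) = 0 & isom_closure k l].
have relP c u l u' l' : rel u l -> rel u' l' -> rel (c *: u + u') (c *: l + l').
  move=> [k [kp kperp kl]] [k' [kp' kperp' kl']]; exists (c *: k + k'); split.
  - exact: (closed_span_linear _).2.
  - by move=> i; rewrite opprD addrACA -scalerBr dotDr dotZr kperp kperp' mulr0 addr0.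
  - exact: isom_closureP.
have rel_norm u l : rel u l -> rnorm l <= rnorm u.
  move=> [k [kp kperp kl]]; rewrite (isom_closure_norm kl).
  have ku : dot V k (u - k) = 0.
    by apply: (closed_span_perp _ kp) => _ [i _ <-].
  rewrite -(ler_pXn2r (n := 2)) ?nnegrE ?rnorm_ge0//.
  have -> : u = k + (u - k) by rewrite addrC subrK.
  by rewrite rnorm_sqD /rdot ku mulr0 addr0 lerDl sqr_ge0.
have relB u l u' l' : rel u l -> rel u' l' -> rel (u' - u) (l' - l).
  by move=> ul ul'; have := relP (-1) _ _ _ _ ul ul'; rewrite !scaleN1r addrC (addrC _ l').
have rel_fun u l l' : rel u l -> rel u l' -> l = l'.
  move=> ul ul'; have /rel_norm := relB _ _ _ _ ul' ul; rewrite subrr rnorm0 => l0.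
  by apply/subr0_eq/rnorm_eq0/eqP; rewrite eq_le l0 rnorm_ge0.
have rel_tot u : exists l, rel u l.
  have [k kp kperp] := orthogonal_decomposition (range p) u.
  have [l kl] := isom_closure_dom kp.
  by exists l, k; split=> // i; apply: kperp; exists i.
have [U UP] := choice rel_tot.
have Ul : linear U.
  by move=> c u v; apply: rel_fun (UP _) _; exact: relP.
exists (Bop Ul (bop_contraction_continuous Ul (fun u => rel_norm _ _ (UP u)))).
split=> /=.
- move=> i; apply: rel_fun (UP _) _; exists (p i); split.
  + by apply: sub_closed_span; exists i.
  + by move=> j; rewrite subrr dot0r.
  + exact: isom_closure_gen.
- by move=> u; have [k [_ _ /isom_closure_ran]] := UP u.
- move=> v vp; apply: rel_fun (UP _) _; exists 0; split.
  + exact: (closed_span_linear _).1.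
  + by move=> i; rewrite subr0.
  + by move=> e e0; exists 0, 0; rewrite !subrr !rnorm0; split=> //; exact: isom_graph0.
Qed.

End OneSided.

(** [U] is the continuous extension of [p i |-> q i] to the closed span of [p], composed
    with the orthogonal projection; [Us] is built with [p] and [q] exchanged. They are
    adjoint because they are on the spanning vectors. *)
Lemma isometry_extension (V W : hilbertType R) (I : Type) (p : I -> V) (q : I -> W) :
  (forall i j, dot W (q i) (q j) = dot V (p i) (p j)) ->
  exists (U : bop V W) (Us : bop W V),
  [/\ adjoint U Us, forall i, U (p i) = q i, forall i, Us (q i) = p i,
      forall v, (forall i, dot V (p i) v = 0) -> U v = 0 &
      forall w, (forall i, dot W (q i) w = 0) -> Us w = 0].
Proof.
move=> pq.
have [U [Up Uq U0]] := isometry_extension_half pq.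
have [Us [Usq Usp Us0]] := isometry_extension_half (fun i j => esym (pq i j)).
exists U, Us; split=> // u w.
have [k kp kperp] := orthogonal_decomposition (range p) u.
have [l lq lperp] := orthogonal_decomposition (range q) w.
have -> : U u = U k.
  apply/eqP; rewrite -subr_eq0 -bopB; apply/eqP/U0 => i.
  by apply: kperp; exists i.
have -> : Us w = Us l.
  apply/eqP; rewrite -subr_eq0 -bopB; apply/eqP/Us0 => i.
  by apply: lperp; exists i.
have -> : dot W (U k) w = dot W (U k) l.
  apply/eqP; rewrite -subr_eq0 -dotBr; apply/eqP.
  exact: (closed_span_perp lperp (Uq k)).
have -> : dot V u (Us l) = dot V k (Us l).
  apply/eqP; rewrite -subr_eq0 -dotBl; apply/eqP/dot_eq0C.
  exact: (closed_span_perp kperp (Usp l)).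
move: k kp {kperp}; apply: closed_span_sub => [||_ [i _ <-] /=].
- exact: bop_dot_closed.
- exact: bop_dot_linear.
rewrite Up (dotC (q i)) (dotC (p i)); congr (_^*); apply: esym.
move: l lq {lperp}; apply: closed_span_sub => [||_ [j _ <-] /=].
- exact: bop_dot_closed.
- exact: bop_dot_linear.
by rewrite Usq pq.
Qed.

End IsometryExtension.

Section Contraction.
Variables (R : realType) (V W : hilbertType R) (T : bop V W) (Ts : bop W V).
Hypothesis TTs : adjoint T Ts.

Lemma adjoint_sym : adjoint Ts T.
Proof. by move=> u v; rewrite dotC -TTs -dotC. Qed.

Lemma adjoint_contraction (t : R) : 0 <= t ->
  (forall u, rnorm (T u) <= t * rnorm u) -> forall w, rnorm (Ts w) <= t * rnorm w.
Proof.
move=> t0 Tt w; have := rnorm_ge0 (Ts w); rewrite le_eqVlt => /orP[/eqP <-|w0].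
  by rewrite mulr_ge0// rnorm_ge0.
rewrite -(ler_pM2l w0) -expr2 -rdotE /rdot adjoint_sym dotC Re_conj.
have -> : complex.Re (dot W (T (Ts w)) w) = rdot (T (Ts w)) w by [].
apply: le_trans (rdot_cauchy_schwarz _ _) _; rewrite mulrA.
apply: ler_wpM2r; first exact: rnorm_ge0.
by rewrite [leRHS]mulrC; exact: Tt.
Qed.

(** Since [|v - T^* T v|^2 = |v|^2 - 2 |T v|^2 + |T^* T v|^2] and [T^*] is a contraction,
    the squared norms of the [v n] decrease by at least [|T (v n)|^2] in each step. *)
Lemma contraction_iter_cvg0 : (forall u, rnorm (T u) <= rnorm u) ->
  forall v : nat -> V, (forall n, v n.+1 = v n - Ts (T (v n))) ->
  (fun n => T (v n)) @ \oo --> (0 : W).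
Proof.
move=> T1 v vS.
have T1' u' : rnorm (T u') <= 1 * rnorm u' by rewrite mul1r.
have step n : rnorm (T (v n)) ^+ 2 <= rnorm (v n) ^+ 2 - rnorm (v n.+1) ^+ 2.
  rewrite vS rnorm_sqB.
  have -> : rdot (v n) (Ts (T (v n))) = rnorm (T (v n)) ^+ 2.
    by rewrite -rdotE /rdot TTs.
  have := adjoint_contraction ler01 T1' (T (v n)); rewrite mul1r.
  rewrite -(ler_pXn2r (n := 2)) ?nnegrE ?rnorm_ge0//.
  by lra.
pose a n := rnorm (v n) ^+ 2.
have a_dec : nonincreasing_seq a.
  apply/nonincreasing_seqP => n; rewrite -subr_ge0; apply: le_trans (step n).
  exact: sqr_ge0.
have a_lb : has_lbound (range a).
  by exists 0 => _ [n _ <-]; exact: sqr_ge0.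
have a_cvg := nonincreasing_cvgn a_dec a_lb.
apply/cvg_rnormP => e e0.
have e2 : 0 < e ^+ 2 by rewrite exprn_gt0.
have [N _ NP] := (@cvgrPdist_lt _ _ _ _ _ _ _).1 a_cvg (e ^+ 2 / 2) ltac:(by rewrite divr_gt0).
exists N => // n /= Nn; rewrite sub0r rnormN.
rewrite -(ltr_pXn2r (n := 2)) ?nnegrE ?rnorm_ge0 ?ltW//.
apply: le_lt_trans (step n) _; rewrite -/(a n) -/(a n.+1).
have /= := NP n Nn; have /= := NP n.+1 (leqW Nn).
by rewrite !ltr_norml => /andP[? ?] /andP[? ?]; lra.
Qed.

End Contraction.

Definition bop_id (R : realType) (V : completeNormedModType R[i]) : bop V V.
Proof. by refine (@Bop _ _ _ id _ _) => // u; exact: cvg_id. Defined.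

(** The decomposition [y = k + (y - k)] is orthogonal, and the hypothesis makes [y - k]
    orthogonal to itself. *)
Lemma closed_span_double_perp (R : realType) (H : hilbertType R) (X : set H) y :
  (forall v, (forall x, X x -> dot H x v = 0) -> dot H y v = 0) -> closed_span X y.
Proof.
move=> yX; have [k kX kperp] := orthogonal_decomposition X y.
suff -> : y = k by [].
apply/subr0_eq/dot_eq0; rewrite dotBl yX// sub0r.
by rewrite (closed_span_perp kperp kX) oppr0.
Qed.

Lemma bop_eq_perp (R : realType) (H : hilbertType R) (V : completeNormedModType R[i])
    (T S : bop H V) (X : set H) :
  (forall x, X x -> T x = S x) ->
  (forall v, (forall x, X x -> dot H x v = 0) -> T v = S v) -> forall u, T u = S u.
Proof.
move=> TX Tperp u; have [k kX kperp] := orthogonal_decomposition X u.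
have Tk : T k = S k.
  by apply: (closed_span_sub (@bop_eq_closed _ _ _ T S) (@bop_eq_linear _ _ _ T S) _ kX).
by rewrite -[u](subrK k) (bopD T (u - k) k) (bopD S (u - k) k) Tk (Tperp _ kperp).
Qed.

Section ExtensionUnitary.
Variables (R : realType) (V W : hilbertType R) (I : Type) (p : I -> V) (q : I -> W).
Variables (U : bop V W) (Us : bop W V).
Hypotheses (Up : forall i, U (p i) = q i) (Usq : forall i, Us (q i) = p i).

Lemma extension_UsU u : closed_span (range p) u -> Us (U u) = u.
Proof.
move: u; apply: (@closed_span_sub _ _ _ [set u | bop_comp Us U u = bop_id V u]).
- exact: bop_eq_closed.
- exact: bop_eq_linear.
- by move=> _ [i _ <-] /=; rewrite Up Usq.
Qed.

Lemma extension_U u : closed_span (range p) u -> closed_span (range q) (U u).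
Proof.
move: u; apply: (@closed_span_sub _ _ _ (U @^-1` closed_span (range q))).
- by apply: bop_closed_preimage; exact: closed_closed_span.
- have [L0 LP] := closed_span_linear (range q).
  by split=> [|k u v /= uL vL]; rewrite /= ?bop0// bopP; exact: LP.
- by move=> _ [i _ <-] /=; rewrite Up; apply: sub_closed_span; exists i.
Qed.

End ExtensionUnitary.

Lemma extension_unitary_onto (R : realType) (V W : hilbertType R) (I : Type)
    (p : I -> V) (q : I -> W) (U : bop V W) (Us : bop W V) :
  adjoint U Us -> (forall i, U (p i) = q i) -> (forall i, Us (q i) = p i) ->
  (forall v, (forall i, dot V (p i) v = 0) -> U v = 0) ->
  let K := closed_span (range p) in let L := closed_span (range q) in
  [/\ forall u, K u -> L (U u),
      forall u v, K u -> K v -> dot W (U u) (U v) = dot V u v,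
      forall v, L v -> exists2 u, K u & U u = v &
      forall v, (forall u, K u -> dot V u v = 0) -> U v = 0].
Proof.
move=> UUs Up Usq U0 K L; split.
- exact: (extension_U Up).
- by move=> u v uK vK; rewrite UUs (extension_UsU Up Usq vK).
- move=> v vL; exists (Us v); first exact: (extension_U Usq).
  exact: (extension_UsU Usq Up).
- by move=> v vK; apply: U0 => i; apply: vK; apply: sub_closed_span; exists i.
Qed.

(** * C*-algebras *)

Section CStarBasics.
Variables (R : realType) (A : cstarAlg R).
Implicit Types (a b c : A) (k : R[i]).

Lemma cmulDl a b c : cmul (a + b) c = cmul a c + cmul b c.
Proof. by have := cmul_linearl c 1 a b; rewrite !scale1r. Qed.
Lemma cmulDr a b c : cmul c (a + b) = cmul c a + cmul c b.
Proof. by have := cmul_linearr c 1 a b; rewrite !scale1r. Qed.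
Lemma cmul0a a : cmul 0 a = 0.
Proof. by have := cmul_linearl a (-1) 0 0; rewrite !scaleN1r !addNr. Qed.
Lemma cmula0 a : cmul a 0 = 0.
Proof. by have := cmul_linearr a (-1) 0 0; rewrite !scaleN1r !addNr. Qed.
Lemma cmulZl k a b : cmul (k *: a) b = k *: cmul a b.
Proof. by have := cmul_linearl b k a 0; rewrite cmul0a !addr0. Qed.
Lemma cmulZr k a b : cmul a (k *: b) = k *: cmul a b.
Proof. by have := cmul_linearr a k b 0; rewrite cmula0 !addr0. Qed.
Lemma cmulNl a b : cmul (- a) b = - cmul a b.
Proof. by rewrite -scaleN1r cmulZl scaleN1r. Qed.
Lemma cmulNr a b : cmul a (- b) = - cmul a b.
Proof. by rewrite -scaleN1r cmulZr scaleN1r. Qed.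
Lemma cmulBl a b c : cmul (a - b) c = cmul a c - cmul b c.
Proof. by rewrite cmulDl cmulNl. Qed.
Lemma cmulBr a b c : cmul c (a - b) = cmul c a - cmul c b.
Proof. by rewrite cmulDr cmulNr. Qed.

Lemma cstarD a b : cstar (a + b) = cstar a + cstar b.
Proof. by have := cstar_semilinear 1 a b; rewrite rmorph1 !scale1r. Qed.
Lemma cstar0 : cstar (0 : A) = 0.
Proof. by have := cstar_semilinear (-1) (0 : A) 0; rewrite rmorphN rmorph1 !scaleN1r !addNr. Qed.
Lemma cstarZ k a : cstar (k *: a) = k^* *: cstar a.
Proof. by have := cstar_semilinear k a 0; rewrite cstar0 !addr0. Qed.
Lemma cstarN a : cstar (- a) = - cstar a.
Proof. by rewrite -scaleN1r cstarZ rmorphN rmorph1 scaleN1r. Qed.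
Lemma cstarB a b : cstar (a - b) = cstar a - cstar b.
Proof. by rewrite cstarD cstarN. Qed.

Lemma rnorm_cmul a b : rnorm (cmul a b) <= rnorm a * rnorm b.
Proof. by rewrite -lecR rmorphM /= -!rnormE cmul_norm. Qed.

Lemma rnorm_cstar_cmul a : rnorm (cmul (cstar a) a) = rnorm a ^+ 2.
Proof. by apply: complexI; rewrite rmorphXn /= -!rnormE cstar_identity. Qed.

Lemma cstar_cmul_eq0 a : cmul (cstar a) a = 0 -> a = 0.
Proof.
move=> a0; apply: rnorm_eq0; apply/eqP; rewrite -sqrf_eq0 -rnorm_cstar_cmul.
by rewrite a0 rnorm0.
Qed.

Lemma rnorm_cstar_le a : rnorm a <= rnorm (cstar a).
Proof.
have := rnorm_ge0 a; rewrite le_eqVlt => /orP[/eqP <-|a0]; first exact: rnorm_ge0.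
rewrite -(ler_pM2r a0) -expr2 -rnorm_cstar_cmul; exact: rnorm_cmul.
Qed.

Lemma rnorm_cstar a : rnorm (cstar a) = rnorm a.
Proof.
by apply/eqP; rewrite eq_le rnorm_cstar_le andbT -[X in _ <= rnorm X]cstarK rnorm_cstar_le.
Qed.

End CStarBasics.

Lemma geometric_cvg (R : realType) (V : completeNormedModType R[i])
    (u : nat -> V) (q : R) : 0 <= q -> q < 1 ->
  (forall n, rnorm (u n.+1 - u n) <= q ^+ n) -> exists l : V, u @ \oo --> l.
Proof.
move=> q0 q1 uq; have q1' : 0 < 1 - q by rewrite subr_gt0.
have tail k n : rnorm (u (n + k)%N - u n) <= q ^+ n / (1 - q).
  elim: k n => [|k IH] n.
    by rewrite addn0 subrr rnorm0 divr_ge0 ?exprn_ge0// ltW.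
  rewrite addnS -addSn; apply: le_trans (rnorm_dist (u n.+1) _ _) _.
  apply: le_trans (lerD (IH n.+1) (uq n)) _.
  rewrite ler_pdivlMr// mulrDl divfK ?gt_eqF// exprSr.
  by have := exprn_ge0 n q0; lra.
apply: rnorm_cauchy_cvg => e e0.
have qn : (fun n => q ^+ n) @ \oo --> (0 : R) by apply: cvg_expr; rewrite ger0_norm.
have e1 : 0 < e * (1 - q) / 2 by rewrite divr_gt0// mulr_gt0.
have [N _ NP] := (@cvgrPdist_lt _ _ _ _ _ _ _).1 qn _ e1.
exists N => m n Nm Nn; apply: le_lt_trans (rnorm_dist (u N) _ _) _.
rewrite (rnormB (u N)) -(subnKC Nm) -(subnKC Nn).
apply: le_lt_trans (lerD (tail _ _) (tail _ _)) _.
have /= := NP N (leqnn N); rewrite sub0r normrN ger0_norm ?exprn_ge0// => qN.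
have : q ^+ N / (1 - q) < e / 2 by rewrite ltr_pdivrMr//; lra.
by lra.
Qed.

(** The solution is the limit of the iteration [d <- (h + d^2) / 2], a contraction
    on the ball of radius [(1 + |h|) / 2]. *)
Lemma one_sub_sqrt (R : realType) (A : cstarAlg R) (h : A) :
  rnorm h < 1 -> cstar h = h ->
  exists2 d : A, cstar d = d & h = d + d - cmul d d.
Proof.
(* [q < 1] satisfies [(|h| + q^2) / 2 <= q]. *)
move=> h1 hh; pose q := (1 + rnorm h) / 2; have h0 := rnorm_ge0 h.
have q0 : 0 <= q by rewrite divr_ge0// addr_ge0.
have q1 : q < 1 by rewrite /q; lra.
pose S (d : A) := (2^-1)%:C *: (h + cmul d d).
pose d := fix d n := if n is m.+1 then S (d m) else 0.
have half (x : A) : (2^-1)%:C *: (x + x) = x.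
  rewrite -mulr2n -(scaler_nat 2 x) scalerA.
  by rewrite -(rmorph_nat (real_complex R)) -rmorphM /= mulVf// scale1r.
have dq n : rnorm (d n) <= q.
  elim: n => [|n IH] /=; first by rewrite rnorm0.
  rewrite /S rnormZ rnormC ger0_norm//.
  have : rnorm (h + cmul (d n) (d n)) <= rnorm h + q ^+ 2.
    apply: le_trans (rnormD _ _) _; rewrite lerD2l; apply: le_trans (rnorm_cmul _ _) _.
    by rewrite expr2 ler_pM ?rnorm_ge0.
  have hq : rnorm h = 2 * q - 1 by rewrite /q; lra.
  by rewrite hq; clear -q0 q1; nra.
have SB x y : rnorm x <= q -> rnorm y <= q -> rnorm (S x - S y) <= q * rnorm (x - y).
  move=> xq yq; rewrite /S -scalerBr opprD addrACA subrr add0r.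
  have -> : cmul x x - cmul y y = cmul x (x - y) + cmul (x - y) y.
    by rewrite cmulBr cmulBl addrA subrK.
  rewrite rnormZ rnormC ger0_norm//.
  have : rnorm (cmul x (x - y) + cmul (x - y) y) <= q * rnorm (x - y) + rnorm (x - y) * q.
    apply: le_trans (rnormD _ _) _; apply: lerD; apply: le_trans (rnorm_cmul _ _) _.
      by rewrite ler_wpM2r// rnorm_ge0.
    by rewrite ler_wpM2l// rnorm_ge0.
  lra.
have dS n : rnorm (d n.+1 - d n) <= q ^+ n.
  elim: n => [|n IH].
    by rewrite expr0 subr0; apply: le_trans (dq 1%N) (ltW q1).
  apply: (le_trans (SB (d n.+1) (d n) (dq _) (dq _))).
  by rewrite exprS ler_wpM2l.
have [l dl] := geometric_cvg q0 q1 dS.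
have dstar n : cstar (d n) = d n.
  elim: n => [|n IH] /=; first exact: cstar0.
  by rewrite /S cstarZ cstarD hh cstarM IH conj_real.
have close e : 0 < e -> exists n, rnorm (l - d n) < e /\ rnorm (l - d n.+1) < e.
  move=> e0; have [N _ NP] := (cvg_rnormP l _).1 dl e e0.
  by exists N; split; apply: NP => //=; exact: leqnSn.
have small (x : A) : (forall e, 0 < e -> rnorm x <= e) -> x = 0.
  move=> xe; apply: rnorm_eq0; apply/eqP; rewrite eq_le rnorm_ge0 andbT.
  by apply/ler_addgt0Pl => e e0; rewrite addr0; exact: xe.
have lq : rnorm l <= q.
  apply/ler_addgt0Pl => e e0; have [n [ln _]] := close e e0.
  rewrite -(subrK (d n) l); apply: le_trans (rnormD _ _) _.
  by apply: lerD; [exact: ltW|exact: dq].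
exists l.
  apply/subr0_eq/small => e e0; have [n [ln _]] := close (e / 2) ltac:(by rewrite divr_gt0).
  apply: le_trans (rnorm_dist (d n) _ _) _; rewrite -{1}(dstar n) -cstarB rnorm_cstar.
  by rewrite rnormB; rewrite (rnormB l) in ln; rewrite (rnormB (d n)) in ln *; lra.
have lS : l = S l.
  apply/subr0_eq/small => e e0; have [n [ln ln1]] := close (e / 2) ltac:(by rewrite divr_gt0).
  apply: le_trans (rnorm_dist (d n.+1) _ _) _.
  have := SB _ _ (dq n) lq; rewrite -/(d n.+1) (rnormB (d n)).
  have := rnorm_ge0 (l - d n); nra.
apply/esym/eqP; rewrite subr_eq {1 2}lS.
have -> : S l + S l = (2^-1)%:C *: ((h + cmul l l) + (h + cmul l l)).
  by rewrite scalerDr.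
by rewrite half.
Qed.

(** For [|h| < 1] and [h = d + d - d^2] as in [one_sub_sqrt], the operator
    [1 - phi h] is the square of [1 - phi d], hence positive. *)
Lemma star_rep_contraction (R : realType) (A : cstarAlg R) (H : hilbertType R)
    (phi : A -> bop H H) :
  (forall (k : R[i]) a b u, phi (k *: a + b) u = k *: phi a u + phi b u) ->
  (forall a b u, phi (cmul a b) u = phi a (phi b u)) ->
  (forall a, adjoint (phi a) (phi (cstar a))) ->
  forall a u, rnorm (phi a u) <= rnorm a * rnorm u.
Proof.
move=> phiP phiM phiS.
have phi0 u : phi 0 u = 0.
  by have := phiP (-1) 0 0 u; rewrite !scaleN1r !addNr.
have phiZ k a u : phi (k *: a) u = k *: phi a u.
  by have := phiP k a 0 u; rewrite phi0 !addr0.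
have phiD a b u : phi (a + b) u = phi a u + phi b u.
  by have := phiP 1 a b u; rewrite !scale1r.
have small a u : rnorm a < 1 -> rnorm (phi a u) <= rnorm u.
  move=> a1.
  have h1 : rnorm (cmul (cstar a) a) < 1.
    by rewrite rnorm_cstar_cmul exprn_ilt1// rnorm_ge0.
  have [|d dd hd] := one_sub_sqrt h1; first by rewrite cstarM cstarK.
  rewrite -(ler_pXn2r (n := 2)) ?nnegrE ?rnorm_ge0//.
  have -> : rnorm (phi a u) ^+ 2 = rdot (phi (cmul (cstar a) a) u) u.
    rewrite phiM rdotC -rdotE /rdot phiS.
    by [].
  rewrite hd phiD phiD -[- cmul d d]scaleN1r phiZ scaleN1r phiM rdotBl rdotDl.
  have -> : rdot (phi d (phi d u)) u = rnorm (phi d u) ^+ 2.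
    by rewrite -rdotE /rdot phiS dd.
  have := sqr_ge0 (rnorm (u - phi d u)); rewrite (rnorm_sqB u (phi d u)).
  by rewrite (rdotC u); lra.
move=> a u; apply/ler_addgt0Pl => e e0.
have u0 : 0 < rnorm u + 1 by rewrite ltr_wpDl// rnorm_ge0.
pose t := rnorm a + e / (rnorm u + 1).
have t0 : 0 < t by rewrite ltr_wpDl ?rnorm_ge0// divr_gt0.
have := small (t^-1%:C *: a) u; rewrite phiZ !rnormZ rnormC ger0_norm ?invr_ge0 ?(ltW t0)//.
rewrite mulrC ltr_pdivrMr// mul1r /t ltrDl divr_gt0// => /(_ isT).
rewrite mulrC ler_pdivrMr// => /le_trans; apply.
rewrite mulrC mulrDl addrC lerD2r -mulrA ler_piMr ?(ltW e0)//.
by rewrite mulrC ler_pdivrMr// mul1r lerDl.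
Qed.

(** * Multipliers of ideals *)

Section Ideals.
Variables (R : realType) (A : cstarAlg R).
Implicit Types (a b c : A) (I J : set A) (w : multiplier A).

Lemma closed_idealI I J : closed_ideal I -> closed_ideal J -> closed_ideal (I `&` J).
Proof.
move=> [cI I0 IP IM IS] [cJ J0 JP JM JS]; split.
- exact: closedI.
- by [].
- by move=> k a b [aI aJ] [bI bJ]; split; [exact: IP|exact: JP].
- by move=> a b [/IM-/(_ b)[? ?] /JM-/(_ b)[? ?]].
- by move=> a [/IS ? /JS ?].
Qed.

Section Multipliers.
Variables (I : set A) (I_ideal : closed_ideal I).

Lemma cideal0 : I 0. Proof. by case: I_ideal. Qed.
Lemma cidealP k a b : I a -> I b -> I (k *: a + b).
Proof. by case: I_ideal => _ _ + _ _; exact. Qed.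
Lemma cidealZ k a : I a -> I (k *: a).
Proof. by move=> Ia; have := cidealP k Ia cideal0; rewrite addr0. Qed.
Lemma cidealB a b : I a -> I b -> I (a - b).
Proof. by move=> Ia Ib; rewrite addrC -scaleN1r; exact: cidealP. Qed.
Lemma cidealMr a b : I a -> I (cmul a b).
Proof. by case: I_ideal => _ _ _ + _ Ia => /(_ a b Ia)[]. Qed.
Lemma cidealMl a b : I a -> I (cmul b a).
Proof. by case: I_ideal => _ _ _ + _ Ia => /(_ a b Ia)[]. Qed.
Lemma cidealS a : I a -> I (cstar a).
Proof. by case: I_ideal => _ _ _ _; exact. Qed.

Lemma ideal_eq_mulr a b : I a -> I b -> (forall c, I c -> cmul a c = cmul b c) -> a = b.
Proof.
move=> Ia Ib ab; apply/subr0_eq; rewrite -[a - b]cstarK.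
have z : cstar (a - b) = 0 -> cstar (cstar (a - b)) = 0 by move=> ->; exact: cstar0.
apply/z/cstar_cmul_eq0; rewrite cstarK cmulBl; apply/eqP; rewrite subr_eq0.
apply/eqP/ab.
by apply/cidealS/cidealB.
Qed.

Variables (w : multiplier A) (w_unit : unitary_multiplier I w).

Lemma mleft_in a : I a -> I (mleft w a).
Proof. by case: w_unit => -[+ _] _ Ia => /(_ a Ia)[]. Qed.
Lemma mright_in a : I a -> I (mright w a).
Proof. by case: w_unit => -[+ _] _ Ia => /(_ a Ia)[]. Qed.
Lemma mleft_mright a b : I a -> I b -> cmul a (mleft w b) = cmul (mright w a) b.
Proof. by case: w_unit => -[_ +] _; exact. Qed.

Lemma mrightM a b : I a -> mright w (cmul b a) = cmul b (mright w a).
Proof.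
move=> Ia; have Iba : I (cmul b a) by exact: cidealMl.
apply: ideal_eq_mulr; [exact: mright_in|by apply/cidealMl/mright_in|].
by move=> c Ic; rewrite -mleft_mright// -!cmulA mleft_mright.
Qed.

Lemma madj_in a : I a -> I (mleft (madj w) a) /\ I (mright (madj w) a).
Proof.
by move=> Ia; split; apply: cidealS; [apply: mright_in|apply: mleft_in]; exact: cidealS.
Qed.

Lemma madj_mleft_mright a b : I a -> I b ->
  cmul a (mleft (madj w) b) = cmul (mright (madj w) a) b.
Proof.
move=> Ia Ib; apply: (can_inj (@cstarK _ A)); rewrite /= !cstarM !cstarK.
by rewrite mleft_mright//; exact: cidealS.
Qed.

Lemma madjK a : I a -> mleft (madj w) (mleft w a) = a.
Proof. by case: w_unit => _ + Ia => /(_ a Ia)[]. Qed.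
Lemma mleftK a : I a -> mleft w (mleft (madj w) a) = a.
Proof. by case: w_unit => _ + Ia => /(_ a Ia)[]. Qed.

Lemma madj_unitary : unitary_multiplier I (madj w).
Proof.
split; first by split; [exact: madj_in|exact: madj_mleft_mright].
move=> a Ia; have madj2 b : mleft (madj (madj w)) b = mleft w b by rewrite /= !cstarK.
by rewrite !madj2; split; [exact: mleftK|exact: madjK].
Qed.

Lemma mright_madjK a : I a -> mright w (mright (madj w) a) = a.
Proof.
move=> Ia; have Ia' := (madj_in Ia).2.
apply: ideal_eq_mulr => //; first exact: mright_in.
move=> c Ic; rewrite -mleft_mright// -madj_mleft_mright//; last exact: mleft_in.
by rewrite madjK.
Qed.

Lemma cmul_mright_madj_mleft a b : I a -> I b ->
  cmul (mright (madj w) a) (mleft w b) = cmul a b.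
Proof.
by move=> Ia Ib; rewrite -madj_mleft_mright//; [rewrite madjK|exact: mleft_in].
Qed.

Lemma mright_madjE a : mright (madj w) (cstar a) = cstar (mleft w a).
Proof. by rewrite /= cstarK. Qed.

Lemma mleft_cstar_mright a : I a -> mleft w (cstar (mright w a)) = cstar a.
Proof.
by move=> Ia; have := mleftK (cidealS Ia); rewrite /= cstarK.
Qed.

End Multipliers.
End Ideals.

(** * Representations of ideals on Hilbert spaces *)

Section Rep.
Variables (R : realType) (A : cstarAlg R) (H : hilbertType R) (phi : A -> bop H H).

Definition star_rep :=
  [/\ forall (k : R[i]) a b u, phi (k *: a + b) u = k *: phi a u + phi b u,
      forall a b u, phi (cmul a b) u = phi a (phi b u) &
      forall a, adjoint (phi a) (phi (cstar a))].

Definition rep_span (I : set A) : set H :=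
  closed_span [set v | exists2 a, I a & exists u, v = phi a u].

Hypothesis phi_rep : star_rep.

Lemma repM a b u : phi (cmul a b) u = phi a (phi b u).
Proof. by case: phi_rep. Qed.
Lemma repS a u v : dot H (phi a u) v = dot H u (phi (cstar a) v).
Proof. by case: phi_rep => _ _ +; exact. Qed.
Lemma repS' a u v : dot H (phi (cstar a) u) v = dot H u (phi a v).
Proof. by rewrite repS cstarK. Qed.
Lemma rep0 u : phi 0 u = 0.
Proof. by case: phi_rep => P _ _; have := P (-1) 0 0 u; rewrite !scaleN1r !addNr. Qed.
Lemma repD a b u : phi (a + b) u = phi a u + phi b u.
Proof. by case: phi_rep => P _ _; have := P 1 a b u; rewrite !scale1r. Qed.
Lemma repZ k a u : phi (k *: a) u = k *: phi a u.
Proof. by case: phi_rep => P _ _; have := P k a 0 u; rewrite rep0 !addr0. Qed.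
Lemma repB a b u : phi (a - b) u = phi a u - phi b u.
Proof. by rewrite repD -scaleN1r repZ scaleN1r. Qed.
Lemma rep_contraction a u : rnorm (phi a u) <= rnorm a * rnorm u.
Proof. by case: phi_rep => ? ? ?; exact: star_rep_contraction. Qed.

Lemma sub_rep_span (I : set A) a u : I a -> rep_span I (phi a u).
Proof. by move=> Ia; apply: sub_closed_span; exists a => //; exists u. Qed.

Section OneIdeal.
Variables (I : set A) (I_ideal : closed_ideal I).

Lemma rep_span_perp v : (forall a, I a -> phi a v = 0) ->
  forall x, rep_span I x -> dot H x v = 0.
Proof.
move=> vI; apply: closed_span_perp => _ [a Ia [u ->]].
by rewrite repS vI ?dot0r//; exact: cidealS.
Qed.

Lemma rep_span_perp_eq0 v : (forall x, rep_span I x -> dot H x v = 0) ->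
  forall a, I a -> phi a v = 0.
Proof.
move=> vI a Ia; apply: dot_eq0; rewrite -repS' ; apply: vI.
by apply: sub_rep_span; exact: cidealS.
Qed.

Lemma rep_span_eq0 v : rep_span I v -> (forall a, I a -> phi a v = 0) -> v = 0.
Proof. by move=> Iv vI; apply: dot_eq0; exact: rep_span_perp vI _ Iv. Qed.

Lemma rep_span_inv b v : rep_span I v -> rep_span I (phi b v).
Proof.
move: v; apply: (@closed_span_sub _ _ _ (phi b @^-1` rep_span I)).
- by apply: bop_closed_preimage; exact: closed_closed_span.
- have [L0 LP] := closed_span_linear [set v | exists2 a, I a & exists u, v = phi a u].
  by split=> [|k u v /= uL vL]; rewrite /= ?bop0// bopP; exact: LP.
- by move=> _ [a Ia [u ->]] /=; rewrite -repM; apply: sub_rep_span; exact: cidealMl.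
Qed.

Lemma rep_span_decomposition u : exists2 k, rep_span I k &
  forall a, I a -> phi a (u - k) = 0.
Proof.
have [k kI kperp] :=
  orthogonal_decomposition [set v | exists2 a, I a & exists u, v = phi a u] u.
by exists k => //; apply: rep_span_perp_eq0 => x; exact: closed_span_perp.
Qed.

End OneIdeal.

(** A vector in both spaces that is orthogonal to all [phi a (phi b u)] is killed by
    [phi I], since [phi a v] lies in the space of [J] and is killed by [phi J]. *)
Lemma rep_spanI (I J : set A) : closed_ideal I -> closed_ideal J ->
  forall v, rep_span I v -> rep_span J v ->
  closed_span [set x | exists a b u, [/\ I a, J b & x = phi a (phi b u)]] v.
Proof.
move=> idI idJ v vI vJ; set X := [set x | _].
have XI : closed_span X `<=` rep_span I.
  apply: closed_span_mono => _ [a [b [u [Ia Jb ->]]]]; exact: sub_rep_span.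
have XJ : closed_span X `<=` rep_span J.
  apply: closed_span_mono => _ [a [b [u [Ia Jb ->]]]].
  by rewrite -repM; apply: sub_rep_span; exact: cidealMl.
have [k kX kperp] := orthogonal_decomposition X v.
suff /subr0_eq-> : v - k = 0 by [].
have IB : rep_span I (v - k).
  by apply: linear_setB (closed_span_linear _) vI _; exact: XI.
have JB : rep_span J (v - k).
  by apply: linear_setB (closed_span_linear _) vJ _; exact: XJ.
apply: (rep_span_eq0 idI IB) => a Ia.
apply: (rep_span_eq0 idJ); first exact: rep_span_inv.
move=> b Jb; apply: dot_eq0; rewrite -repS' -repS'; apply: kperp.
by exists (cstar a), (cstar b), (phi b (phi a (v - k))); split=> //; exact: cidealS.
Qed.

(** On the vectors [phi a u] with [a] in [I], this is the centraliser identity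
    [b (w a) = (b w) a]. *)
Lemma multiplier_repr (I : set A) w (W : bop H H) : closed_ideal I ->
  unitary_multiplier I w ->
  (forall a, I a -> forall u, W (phi a u) = phi (mleft w a) u) ->
  forall b v, I b -> rep_span I v -> phi b (W v) = phi (mright w b) v.
Proof.
move=> idI uw Ww b v Ib; move: v.
apply: (@closed_span_sub _ _ _ [set v | bop_comp (phi b) W v = phi (mright w b) v]).
- exact: bop_eq_closed.
- exact: bop_eq_linear.
- by move=> _ [a Ia [u ->]] /=; rewrite Ww// -!repM (mleft_mright uw).
Qed.

End Rep.

(** * Groupoid identities *)

Section HomAlgebra.
Variable G : groupoid.

Lemma hmulA (x y z t : objects G) (g : ghom x y) (h : ghom y z) (k : ghom z t) :
  hmul g (hmul h k) = hmul (hmul g h) k.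
Proof. by apply: hom_inj; rewrite /= gmulA//; exact: hom_composable. Qed.

Lemma hmul1g (x y : objects G) (g : ghom x y) : hmul (hid x) g = g.
Proof. by apply: hom_inj; rewrite /= -[in gunit x](hom_rng g) gmul1g. Qed.

Lemma hmulg1 (x y : objects G) (g : ghom x y) : hmul g (hid y) = g.
Proof. by apply: hom_inj; rewrite /= -[in gunit y](hom_src g) gmulg1. Qed.

Lemma hmulgV (x y : objects G) (g : ghom x y) : hmul g (hinv g) = hid x.
Proof. by apply: hom_inj; rewrite /= gmulgV (hom_rng g). Qed.

Lemma hinvK (x y : objects G) (g : ghom x y) : hinv (hinv g) = g.
Proof. by rewrite -[LHS]hmulg1 -(hmulVg g) hmulA hmulVg hmul1g. Qed.

Lemma hmulKg (x y z : objects G) (g : ghom x y) (h : ghom y z) :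
  hmul (hinv g) (hmul g h) = h.
Proof. by rewrite hmulA hmulVg hmul1g. Qed.

Lemma hinv_id (x : objects G) : hinv (hid x) = hid x.
Proof. by rewrite -[LHS]hmulg1 hmulVg. Qed.

Lemma ghom_arr (P : forall x y : objects G, ghom x y -> Prop) :
  (forall g, P _ _ (arr g)) -> forall x y (g : ghom x y), P _ _ g.
Proof.
move=> Parr x y g; have := Parr (hom_arr g).
by case: g => g gx gy; move: gx gy; case: x /; case: y /.
Qed.

Lemma ghom_eq (P : forall x y : objects G, ghom x y -> Prop) x y (g : ghom x y)
    x' y' (g' : ghom x' y') : hom_arr g = hom_arr g' -> P _ _ g -> P _ _ g'.
Proof.
elim/ghom_arr: g' => g'; elim/ghom_arr: g => g /= -> //.
Qed.

End HomAlgebra.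

(** * Twisted partial actions *)

Section Action.
Variables (R : realType) (G : groupoid) (T : twisted_partial_action R G).

Section OneArrow.
Variables (x y : objects G) (g : ghom x y).
Implicit Types (a b : tA T x) (c d : tA T y).

Lemma tth_in c : tD T (hinv g) c -> tD T g (tth T g c).
Proof. by case: (tth_iso T g) => + _ _ _ _ Dc => /(_ c Dc)[]. Qed.
Lemma tthK c : tD T (hinv g) c -> tthi T g (tth T g c) = c.
Proof. by case: (tth_iso T g) => + _ _ _ _ Dc => /(_ c Dc)[]. Qed.
Lemma tthi_in a : tD T g a -> tD T (hinv g) (tthi T g a).
Proof. by case: (tth_iso T g) => _ + _ _ _ Da => /(_ a Da)[]. Qed.
Lemma tthiK a : tD T g a -> tth T g (tthi T g a) = a.
Proof. by case: (tth_iso T g) => _ + _ _ _ Da => /(_ a Da)[]. Qed.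
Lemma tthP k c d : tD T (hinv g) c -> tD T (hinv g) d ->
  tth T g (k *: c + d) = k *: tth T g c + tth T g d.
Proof. by case: (tth_iso T g) => _ _ + _ _; exact. Qed.
Lemma tthM c d : tD T (hinv g) c -> tD T (hinv g) d ->
  tth T g (cmul c d) = cmul (tth T g c) (tth T g d).
Proof. by case: (tth_iso T g) => _ _ _ + _; exact. Qed.
Lemma tthS c : tD T (hinv g) c -> tth T g (cstar c) = cstar (tth T g c).
Proof. by case: (tth_iso T g) => _ _ _ _; exact. Qed.

Lemma tth0 : tth T g 0 = 0.
Proof.
have D0 := cideal0 (tD_ideal T (hinv g)).
by have := tthP (-1) D0 D0; rewrite !scaleN1r !addNr.
Qed.

Lemma tthiP k a b : tD T g a -> tD T g b ->
  tthi T g (k *: a + b) = k *: tthi T g a + tthi T g b.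
Proof.
move=> Da Db; rewrite -[RHS]tthK; last first.
  by apply: (cidealP (tD_ideal T (hinv g))); exact: tthi_in.
by rewrite tthP ?tthiK//; exact: tthi_in.
Qed.

Lemma tthiS a : tD T g a -> tthi T g (cstar a) = cstar (tthi T g a).
Proof.
move=> Da; rewrite -[RHS]tthK; last by apply: (cidealS (tD_ideal T (hinv g))); exact: tthi_in.
by rewrite tthS ?tthiK//; exact: tthi_in.
Qed.

Lemma tthi0 : tthi T g 0 = 0.
Proof.
have D0 := cideal0 (tD_ideal T g).
by have := tthiP (-1) D0 D0; rewrite !scaleN1r !addNr.
Qed.

End OneArrow.

Lemma tJ_ideal (x y z : objects G) (g : ghom x y) (h : ghom y z) :
  closed_ideal (tJ T g h).
Proof. by apply: closed_idealI; exact: tD_ideal. Qed.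

Lemma tthi_id (x : objects G) (a : tA T x) : tthi T (hid x) a = a.
Proof. by rewrite -[LHS]tth_id tthiK// tD_id. Qed.

End Action.

(** * From covariant representations to Fell bundle representations *)

Section CovariantAlgebra.
Variables (R : realType) (G : groupoid).
Variables (alpha : objects G -> {measure set (borel (arrows G)) -> \bar R})
  (nu : {measure set (borel (objects G)) -> \bar R}) (H : hilbertField nu)
  (T : twisted_partial_action R G) (c : covariant_rep alpha H T).

Lemma nondegenerate_star_rep (x : objects G) (phi : tA T x -> bop (H x) (H x)) :
  nondegenerate_rep phi -> star_rep phi.
Proof. by case. Qed.

Lemma cr_rep x : star_rep (@cr_phi _ _ _ _ _ _ c x).
Proof. exact/nondegenerate_star_rep/cr_phi_rep. Qed.

Section OneArrow.
Variables (x y : objects G) (g : ghom x y).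
Let K : set (H y) := rep_span (@cr_phi _ _ _ _ _ _ c y) (tD T (hinv g)).
Let L : set (H x) := rep_span (@cr_phi _ _ _ _ _ _ c x) (tD T g).
Let U : bop (H y) (H x) := cr_U c g.

Lemma cr_U_perp v : (forall a, tD T (hinv g) a -> cr_phi c a v = 0) -> U v = 0.
Proof.
move=> vK; have [_ _ _] := cr_U_unitary c g; apply => u uK.
exact: (rep_span_perp (cr_rep y) (tD_ideal T (hinv g)) vK uK).
Qed.

Lemma cr_U_ran u : L (U u).
Proof.
have [k kK kperp] := rep_span_decomposition (cr_rep y) (tD_ideal T (hinv g)) u.
rewrite -[u](subrK k) bopD (cr_U_perp kperp) add0r.
by have [UL _ _ _] := cr_U_unitary c g; exact: UL.
Qed.

(** The covariance condition is stated for [U phi(a) U^*]. It gives the intertwining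
    relation in the last clause because [U^* U] is the projection onto
    [phi(D_(g^-1)) H], and [phi(a)] vanishes on the orthogonal complement. *)
Lemma cr_U_adjoint : exists Us : bop (H x) (H y),
  [/\ adjoint U Us,
      forall u, K u -> Us (U u) = u,
      forall w, L w -> K (Us w) /\ U (Us w) = w,
      forall w, (forall a, tD T g a -> cr_phi c a w = 0) -> Us w = 0 &
      forall a, tD T (hinv g) a -> forall u, U (cr_phi c a u) = cr_phi c (tth T g a) (U u)].
Proof.
have [Us UUs Uphi] := cr_covariant c g; have [UL Uiso Uonto U0] := cr_U_unitary c g.
have UsU u : K u -> Us (U u) = u.
  move=> uK; apply: dot_inj => v.
  have [k kK kperp] := rep_span_decomposition (cr_rep y) (tD_ideal T (hinv g)) v.
  rewrite -[v](subrK k) !(dotDr (v - k) k) (adjoint_sym UUs) (adjoint_sym UUs) (cr_U_perp kperp).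
  rewrite dot0r (Uiso _ _ uK kK).
  by rewrite (rep_span_perp (cr_rep y) (tD_ideal T (hinv g)) kperp uK).
exists Us; split=> //.
- by move=> w /Uonto[u uK <-]; rewrite UsU.
- move=> w wL; apply: dot_inj => v; rewrite dot0l (adjoint_sym UUs); apply: dot_eq0C.
  exact: (rep_span_perp (cr_rep x) (tD_ideal T g) wL (@cr_U_ran v)).
- move=> a Da u.
  have [k kK kperp] := rep_span_decomposition (cr_rep y) (tD_ideal T (hinv g)) u.
  rewrite -[u](subrK k) !(bopD _ (u - k) k) (cr_U_perp kperp) (kperp _ Da).
  by rewrite !add0r -Uphi// UsU.
Qed.

Lemma cr_phi_U a u : tD T g a ->
  cr_phi c a (U u) = U (cr_phi c (tthi T g a) u).
Proof.
have [Us [_ _ _ _ Uphi]] := cr_U_adjoint.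
by move=> Da; rewrite Uphi ?tthiK//; exact: tthi_in.
Qed.

End OneArrow.

(** [w(x, x) = 1] turns the composition axiom into [U_x U_x = U_x], and [U_x] is
    isometric on all of [H_x]. *)
Lemma cr_U_id x u : cr_U c (hid x) u = u.
Proof.
have idT : tD T (hid x) = setT by exact: tD_id.
have domT (h : ghom x x) : h = hid x ->
    forall v : H x, rep_span (@cr_phi _ _ _ _ _ _ c x) (tD T h) v.
  move=> -> v; rewrite idT.
  have [_ _ _ nd] := cr_phi_rep c x.
  have : closed_span [set v | exists a u, v = cr_phi c a u] v by rewrite nd.
  apply: closed_span_mono => _ [a [w ->]].
  by apply: sub_closed_span; exists a => //; exists w.
have [W Ww Wmul] := cr_mul c (hid x) (hid x).
have W1 v : W v = v.
  have /(_ v) : forall v, W v = bop_id _ v.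
    apply: (bop_eq_perp (X := [set v | exists2 a, tD T (hid x) a & exists u, v = cr_phi c a u])).
      move=> _ [a Da [w ->]] /=.
      have Ja : tJ T (hid x) (hid x) a by split; rewrite ?hmul1g.
      by rewrite Ww//; have [-> _] := tw_unitr Ja.
    move=> v0 v0perp; suff -> : v0 = 0 by rewrite !bop0.
    by apply: closed_span_perp_eq0 v0perp; exact: domT.
  by [].
have [Us [_ UsU _ _ _]] := cr_U_adjoint (hid x).
have dom v : rep_span (@cr_phi _ _ _ _ _ _ c x) (tD T (hinv (hid x))) v.
  by apply: domT; rewrite hinv_id.
rewrite -[RHS](UsU _ (dom u)) -[LHS](UsU _ (dom _)); congr (Us _).
have [|| _ _ ->] := Wmul u; try exact: dom.
by rewrite W1 hmul1g.
Qed.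

Definition cov_S x y (g : ghom x y) (a : fell_fibre T g) : bop (H y) (H x) :=
  bop_comp (cr_phi c a) (cr_U c g).

Lemma cov_S_unit x (a : tA T x) u : cov_S (fell_unit a) u = cr_phi c a u.
Proof. by rewrite /= cr_U_id. Qed.

(** [u] is split along the space of the vectors [U_h^* (phi(D_(g^-1) n D_h) H)], on
    which [U_g U_h] is given by the composition axiom. Both sides vanish on the
    complement: for the right hand side because the composition axiom for [g^-1] and
    [gh] shows that [U_gh^*] maps [phi(D_g n D_gh) H] into this space. *)
Lemma cov_S_mul x y z (g : ghom x y) (h : ghom y z) (a : fell_fibre T g)
    (b : fell_fibre T h) u :
  cov_S a (cov_S b u) = cov_S (fell_mul a b) u.
Proof.
case: a b => [a' Da] [b' Db] /=.
set e := cmul (tthi T g a') b'.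
have De_g : tD T (hinv g) e by apply: (cidealMr (tD_ideal T (hinv g))); exact: tthi_in.
have De_h : tD T h e by exact: (cidealMl (tD_ideal T h)).
have [Ug [adj_g UsUg UUg Ug0 Ugphi]] := cr_U_adjoint g.
have [Uh [adj_h UsUh UUh Uh0 Uhphi]] := cr_U_adjoint h.
have [Ugh [adj_gh UsUgh UUgh Ugh0 Ughphi]] := cr_U_adjoint (hmul g h).
have [W Ww Wmul] := cr_mul c g h.
have J_ideal := tJ_ideal T g h.
have J_unit := tw_unitary T g h.
have Je : tJ T g h (tth T g e) by split; [exact: tth_in|exact: tth_sub].
have -> : cr_phi c a' (cr_U c g (cr_phi c b' (cr_U c h u))) =
    cr_phi c (tth T g e) (cr_U c g (cr_U c h u)).
  by rewrite cr_phi_U// -(repM (cr_rep y)) Ugphi.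
pose X := [set v : H z | exists f w,
  [/\ tD T (hinv g) f, tD T h f & v = Uh (cr_phi c f w)]].
pose A := bop_comp (cr_phi c (tth T g e)) (bop_comp (cr_U c g) (cr_U c h)).
pose B := bop_comp (cr_phi c (mright (tw T g h) (tth T g e))) (cr_U c (hmul g h)).
have E_span : rep_span (@cr_phi _ _ _ _ _ _ c y) (tD T (hinv g) `&` tD T h)
    `<=` rep_span (@cr_phi _ _ _ _ _ _ c y) (tD T (hinv g)).
  apply: closed_span_mono => _ [f [Df _] [w ->]].
  by apply: sub_closed_span; exists f => //; exists w.
suff /(_ u) : forall u, A u = B u by [].
apply: (bop_eq_perp (X := X)) => [_ [f [w [Dgf Dhf ->]]]|v vX] /=.
  have fh : cr_dom c h (Uh (cr_phi c f w)).
    by apply: (UUh _ _).1; exact: sub_rep_span.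
  have fhE : cr_U c h (Uh (cr_phi c f w)) = cr_phi c f w.
    by apply: (UUh _ _).2; exact: sub_rep_span.
  have fg : cr_dom c g (cr_U c h (Uh (cr_phi c f w))).
    by rewrite fhE; exact: sub_rep_span.
  have [_ ghJ ->] := Wmul _ fh fg.
  exact: (multiplier_repr (cr_rep x) J_ideal J_unit Ww).
have -> : cr_phi c (tth T g e) (cr_U c g (cr_U c h v)) = 0.
  rewrite -Ugphi//; have -> : cr_phi c e (cr_U c h v) = 0; last exact: bop0.
  apply: dot_inj => w; rewrite dot0l (repS (cr_rep y)) adj_h; apply: dot_eq0C.
  apply: vX; exists (cstar e), w; split=> //.
    exact: (cidealS (tD_ideal T (hinv g))).
  exact: (cidealS (tD_ideal T h)).
apply: dot_inj => w; rewrite dot0l (repS (cr_rep x)) adj_gh.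
set j := cstar _; set v' := Ugh _.
have Jj : tJ T g h j by apply: (cidealS J_ideal); exact: (mright_in J_unit).
have jgh : rep_span (@cr_phi _ _ _ _ _ _ c x) (tD T (hmul g h)) (cr_phi c j w).
  by apply: sub_rep_span; case: Jj.
have [dom_v' Uv'] := UUgh _ jgh.
have [W' _ /(_ v')] := cr_mul c (hinv g) (hmul g h).
rewrite /tJ hmulKg => -[//||dom_h hE _].
  rewrite Uv' /cr_dom hinvK; apply: sub_rep_span; by case: Jj.
apply/esym/dot_eq0C; rewrite -(UsUh _ dom_h).
have : closed_span X (Uh (cr_U c h v')).
  move: hE; set hv := cr_U c h v'; move: hv.
  apply: (@closed_span_sub _ _ _ (Uh @^-1` closed_span X)).
  - by apply: bop_closed_preimage; exact: closed_closed_span.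
  - have [X0 XP] := closed_span_linear X.
    by split=> [|k p q /= pX qX]; rewrite /= ?bop0// bopP; exact: XP.
  - move=> _ [f [Df Df'] [p ->]] /=; apply: sub_closed_span.
    by exists f, p; split.
exact: closed_span_perp.
Qed.

(** It suffices to see that [phi(f) U_g^* = phi(f w(g^-1, g)^* ) U_(g^-1)] for [f] in
    [D_(g^-1)]. Both sides vanish on the complement of the range of [U_g]. On a vector
    [U_g k] they agree because [U_(g^-1) U_g k = phi(w(g^-1, g)) k]. *)
Lemma cov_S_star x y (g : ghom x y) (a : fell_fibre T g) :
  adjoint (cov_S a) (cov_S (fell_star a)).
Proof.
case: a => [a' Da] u v /=.
have [Us [adj UsU UUs Us0 Uphi]] := cr_U_adjoint g.
rewrite (repS (cr_rep x)) adj; congr (dot _ u _).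
have Da' := cidealS (tD_ideal T g) Da.
have -> : Us (cr_phi c (cstar a') v) = cr_phi c (tthi T g (cstar a')) (Us v).
  apply: dot_inj => w; rewrite (adjoint_sym adj) (repS (cr_rep y)) (adjoint_sym adj).
  by rewrite tthiS// cstarK -cr_phi_U// (repS' (cr_rep x)).
set f := tthi T g (cstar a').
have Df : tD T (hinv g) f by exact: tthi_in.
set w := tw T (hinv g) g.
have Jf : tJ T (hinv g) g f by split=> //; rewrite hmulVg tD_id.
have J_unit := tw_unitary T (hinv g) g; have J_ideal := tJ_ideal T (hinv g) g.
pose X := [set v : H x | exists2 a, tD T g a & exists u, v = cr_phi c a u].
suff /(_ v) : forall v, bop_comp (cr_phi c f) Us v =
  bop_comp (cr_phi c (mright (madj w) f)) (cr_U c (hinv g)) v by [].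
apply: (bop_eq_perp (X := X)) => [l Xl|l lperp] /=; last first.
  have l0 b : tD T g b -> cr_phi c b l = 0.
    by apply: (rep_span_perp_eq0 (cr_rep x) (tD_ideal T g)) => p; exact: closed_span_perp.
  rewrite Us0// (@cr_U_perp _ _ (hinv g)) ?bop0// => b.
  by rewrite hinvK; exact: l0.
have Ll : rep_span (@cr_phi _ _ _ _ _ _ c x) (tD T g) l by exact: sub_closed_span.
have [k_dom <-] := UUs _ Ll; rewrite UsU//.
set k := Us l in k_dom *.
have [W Ww /(_ k k_dom)[|_ kJ ->]] := cr_mul c (hinv g) g.
  by rewrite /cr_dom hinvK; exact: cr_U_ran.
move: kJ; rewrite hmulVg cr_U_id; move: (k).
apply: (@closed_span_sub _ _ _ [set k | cr_phi c f k =
  bop_comp (cr_phi c (mright (madj w) f)) W k]).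
- exact: bop_eq_closed.
- exact: bop_eq_linear.
- move=> _ [b Jb [p ->]] /=; rewrite Ww// -!(repM (cr_rep y)).
  by rewrite (cmul_mright_madj_mleft J_ideal J_unit).
Qed.

End CovariantAlgebra.

(** * From Fell bundle representations to covariant representations *)

Section FellAlgebra.
Variables (R : realType) (G : groupoid).
Variables (alpha : objects G -> {measure set (borel (arrows G)) -> \bar R})
  (nu : {measure set (borel (objects G)) -> \bar R}) (H : hilbertField nu)
  (T : twisted_partial_action R G) (S : fell_rep alpha H T).

Definition fell_phi x (a : tA T x) : bop (H x) (H x) := fr_S S (fell_unit a).

(** The fibres over equal arrows are different types; this moves between them. *)
Lemma fr_S_eq x y (g g' : ghom x y) (a : fell_fibre T g) (a' : fell_fibre T g') u :
  g = g' -> delta_val a = delta_val a' -> fr_S S a u = fr_S S a' u.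
Proof.
move=> gg'; case: _ / gg' a' => -[a' Da'] /= aa'.
have := fr_linear S (k := 0) (a := a) (b := Delta Da') (c := a).
have := fr_linear S (k := 0) (a := a) (b := Delta Da') (c := Delta Da').
rewrite /= scale0r add0r aa' => /(_ erefl u); rewrite scale0r add0r => _.
by move=> /(_ erefl u); rewrite scale0r add0r.
Qed.

Lemma fr_mul_eq x y z (g : ghom x y) (h : ghom y z) (a : fell_fibre T g)
    (b : fell_fibre T h) (k : ghom x z) (d : fell_fibre T k) u :
  hmul g h = k -> delta_val (fell_mul a b) = delta_val d ->
  fr_S S a (fr_S S b u) = fr_S S d u.
Proof. by move=> ghk abd; rewrite fr_mul; exact: fr_S_eq. Qed.

Lemma fell_phi_rep x : star_rep (@fell_phi x).
Proof.
split.
- by move=> k a b u; apply: fr_linear.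
- move=> a b u; apply/esym/fr_mul_eq; first by rewrite hmul1g.
  rewrite /= tth_id tthi_id.
  have Jab : tJ T (hid x) (hid x) (cmul a b) by split; rewrite ?hmul1g tD_id.
  by have [_ ->] := tw_unitr Jab.
- move=> a u v; rewrite fr_star; congr (dot _ u _); apply: fr_S_eq.
    exact: hinv_id.
  rewrite /= tthi_id cstarK.
  have Ja : tJ T (hinv (hid x)) (hid x) a.
    by split; rewrite ?hmulg1 hinv_id tD_id.
  by have [-> _] := tw_unitr Ja.
Qed.

Lemma fell_phi_nondegenerate x : nondegenerate_rep (@fell_phi x).
Proof.
by have [? ? ?] := fell_phi_rep x; split=> //; exact: fr_nondegenerate.
Qed.

Section OneArrow.
Variables (x y : objects G) (g : ghom x y).

Lemma fell_scale_in (a : tA T x) (b : fell_fibre T g) : tD T g (cmul a b).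
Proof. exact: (cidealMl (tD_ideal T g) _ (delta_in b)). Qed.

Lemma fell_phi_S a (b : fell_fibre T g) u :
  fell_phi a (fr_S S b u) = fr_S S (Delta (fell_scale_in a b)) u.
Proof.
apply: fr_mul_eq; first exact: hmul1g.
rewrite /= tth_id tthi_id.
have Jab : tJ T (hid x) g (cmul a b).
  by split; rewrite ?hmul1g ?tD_id//; exact: fell_scale_in.
by have [_ ->] := tw_unitl Jab.
Qed.

Lemma fell_scale_inr (b : fell_fibre T g) (a : tA T y) :
  tD T g (tth T g (cmul (tthi T g b) a)).
Proof.
apply/tth_in/(cidealMr (tD_ideal T (hinv g)))/tthi_in; exact: delta_in.
Qed.

Lemma fell_S_phi (b : fell_fibre T g) a u :
  fr_S S b (fell_phi a u) = fr_S S (Delta (fell_scale_inr b a)) u.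
Proof.
apply: fr_mul_eq; first exact: hmulg1.
rewrite /=; set d := tth _ _ _.
have Jd : tJ T g (hid y) d by split; rewrite ?hmulg1; exact: fell_scale_inr.
by have [_ ->] := tw_unitr Jd.
Qed.

(** [theta_(g^-1) theta_g] is conjugation by [w(g^-1, g)], which cancels the factors
    [w(g^-1, g)] of the involution and of the product. *)
Lemma fell_SsS (a b : fell_fibre T g) u :
  fr_S S (fell_star a) (fr_S S b u) =
  fell_phi (cmul (cstar (tthi T g a)) (tthi T g b)) u.
Proof.
apply: fr_mul_eq; first exact: hmulVg.
case: a b => [a Da] [b Db] /=.
set w := tw T (hinv g) g.
have J_unit := tw_unitary T (hinv g) g; have J_ideal := tJ_ideal T (hinv g) g.
have JE c : tD T (hinv g) c -> tJ T (hinv g) g c by split; rewrite ?hmulVg ?tD_id.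
have Da' : tD T (hinv g) (tthi T g (cstar a)).
  by apply/tthi_in/(cidealS (tD_ideal T g)).
have Db' := tthi_in Db.
set p := cstar (mleft w _).
have pE : p = mright (madj w) (tthi T g (cstar a)) by [].
have Dp : tD T (hinv g) p by rewrite pE; case: (madj_in J_ideal J_unit (JE _ Da')).2.
have Di : tD T (hinv (hinv g)) (tthi T (hinv g) p) by apply: tthi_in.
have Db2 : tD T (hinv (hinv g)) b by rewrite hinvK.
rewrite (tthM Di Db2) tthiK// -[in tth T (hinv g) b](tthiK Db).
rewrite tth_mul; last first.
  have Db3 : tD T (hinv g) (tthi T g b) by [].
  exists (tthi T (hinv g) (tthi T g b)); last exact: tthiK.
  by split; [exact: tthi_in|have := tthi_in Db3; rewrite hinvK].
rewrite hmulVg tth_id (mrightM J_ideal J_unit); last first.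
  by apply: (madj_in J_ideal J_unit _).2; apply: (mleft_in J_unit); exact: JE.
rewrite (mright_madjK J_ideal J_unit); last by apply: (mleft_in J_unit); exact: JE.
rewrite pE (cmul_mright_madj_mleft J_ideal J_unit); try exact: JE.
by rewrite tthiS.
Qed.

(** The cocycle identity for [g], [g^-1], [g] reads
    [theta_g(c w(g^-1, g)) = theta_g(c) w(g, g^-1)], so that the factor
    [w(g, g^-1)] of the product cancels the factor [w(g^-1, g)^*] of the involution. *)
Lemma fell_SSs (a b : fell_fibre T g) u :
  fr_S S a (fr_S S (fell_star b) u) = fell_phi (cmul a (cstar b)) u.
Proof.
apply: fr_mul_eq; first exact: hmulgV.
case: a b => [a Da] [b Db] /=.
set w := tw T (hinv g) g.
have J_unit := tw_unitary T (hinv g) g; have J_ideal := tJ_ideal T (hinv g) g.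
have JE c : tD T (hinv g) c -> tJ T (hinv g) g c by split; rewrite ?hmulVg ?tD_id.
have Db' : tD T (hinv g) (tthi T g (cstar b)).
  by apply/tthi_in/(cidealS (tD_ideal T g)).
have Da' := tthi_in Da.
set p := cstar (mleft w _).
have pE : p = mright (madj w) (tthi T g (cstar b)) by [].
have Dab : tD T (hinv g) (cmul (tthi T g a) (tthi T g (cstar b))).
  exact: (cidealMr (tD_ideal T (hinv g))).
rewrite pE -(mrightM J_ideal (madj_unitary J_ideal J_unit)); last exact: JE.
set q := mright (madj w) _.
have Jq : tJ T (hinv g) g q by apply: (madj_in J_ideal J_unit _).2; exact: JE.
have Dq : tD T (hinv g) q by case: Jq.
have := @tw_cocycle _ _ T _ _ _ _ g (hinv g) g q Dq Dq; rewrite hmulVg hmulgV tD_id => /(_ I).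
have Jr : tJ T g (hid y) (tth T g (mright w q)).
  have Dr : tD T (hinv g) (mright w q) by case: (mright_in J_unit Jq).
  by split; rewrite ?hmulg1; exact: tth_in.
have [_ ->] := tw_unitr Jr.
have Js : tJ T (hid x) g (mright (tw T g (hinv g)) (tth T g q)).
  split; rewrite ?hmul1g ?tD_id//.
  have [|//] := mright_in (tw_unitary T g (hinv g)) (a := tth T g q).
  by split; rewrite ?hmulgV ?tD_id//; exact: tth_in.
have [_ ->] := tw_unitl Js; move=> <-.
rewrite /q (mright_madjK J_ideal J_unit); last exact: JE.
by rewrite tthM// !tthiK//; exact: (cidealS (tD_ideal T g)).
Qed.

Let K : set (H y) := rep_span (@fell_phi y) (tD T (hinv g)).
Let L : set (H x) := rep_span (@fell_phi x) (tD T g).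

Lemma fr_S_star a u v :
  dot (H x) (fr_S S a u) v = dot (H y) u (fr_S S (fell_star (g := g) a) v).
Proof. exact: fr_star. Qed.

(** By [fell_SsS] the vectors [S_g(a) u] have the same inner products as the vectors
    [phi(theta_g^(-1)(a)) u]. *)
Lemma fell_U_exists : exists (U : bop (H y) (H x)) (Us : bop (H x) (H y)),
  [/\ adjoint U Us,
      forall (i : fell_fibre T g * H y), U (fell_phi (tthi T g i.1) i.2) = fr_S S i.1 i.2,
      forall (i : fell_fibre T g * H y), Us (fr_S S i.1 i.2) = fell_phi (tthi T g i.1) i.2,
      forall v, (forall i : fell_fibre T g * H y,
        dot (H y) (fell_phi (tthi T g i.1) i.2) v = 0) -> U v = 0 &
      forall w, (forall i : fell_fibre T g * H y, dot (H x) (fr_S S i.1 i.2) w = 0) ->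
        Us w = 0].
Proof.
apply: (@isometry_extension _ _ _ _
  (fun i : fell_fibre T g * H y => fell_phi (tthi T g i.1) i.2)
  (fun i => fr_S S i.1 i.2)) => -[a u] [b v] /=.
by rewrite fr_S_star fell_SsS (repM (fell_phi_rep y)) (repS (fell_phi_rep y)).
Qed.

Lemma fell_range_dom :
  closed_span (range (fun i : fell_fibre T g * H y => fell_phi (tthi T g i.1) i.2)) = K.
Proof.
congr closed_span; apply/seteqP; split=> [_ [[[a Da] u] _ <-]|_ [a Da [u ->]]] /=.
  by exists (tthi T g a); [exact: tthi_in|exists u].
by exists (Delta (tth_in Da), u) => //=; rewrite tthK.
Qed.

(** By [fell_SSs] a vector is killed by all [S_g(a)^*] if and only if it is killed by
    [phi(D_g)]. *)
Lemma fell_range_ran :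
  closed_span (range (fun i : fell_fibre T g * H y => fr_S S i.1 i.2)) = L.
Proof.
have xrep := fell_phi_rep x.
apply/seteqP; split; apply: closed_span_mono.
  move=> _ [[a u] _ <-] /=; apply: closed_span_double_perp => v vL.
  have v0 b : tD T g b -> fell_phi b v = 0.
    by apply: (rep_span_perp_eq0 xrep (tD_ideal T g)) => p; exact: closed_span_perp.
  rewrite fr_S_star; suff -> : fr_S S (fell_star a) v = 0 by rewrite dot0r.
  apply: dot_eq0; apply: dot_eq0C; rewrite -fr_S_star fell_SSs v0 ?dot0l//.
  exact: (cidealMr (tD_ideal T g) _ (delta_in a)).
move=> _ [a Da [u ->]]; apply: closed_span_double_perp => v vq.
rewrite (repS xrep) -(cstarK a); set b := cstar a.
have Db : tD T g b by exact: (cidealS (tD_ideal T g)).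
suff -> : fell_phi (cstar (cstar b)) v = 0 by rewrite dot0r.
rewrite cstarK; apply: dot_eq0; rewrite (repS xrep) -(repM xrep).
have -> : fell_phi (cmul (cstar b) b) v = 0; last by rewrite dot0r.
have Dbs := cidealS (tD_ideal T g) Db.
rewrite -{2}(cstarK b) -(fell_SSs (Delta Dbs) (Delta Dbs)).
have -> : fr_S S (fell_star (Delta Dbs)) v = 0; last exact: bop0.
apply: dot_inj => w; rewrite dot0l; apply: dot_eq0C; rewrite -fr_S_star.
by apply: vq; exists (Delta Dbs, w).
Qed.

Definition fell_U : bop (H y) (H x) := projT1 (cid fell_U_exists).
Definition fell_Us : bop (H x) (H y) := projT1 (cid (projT2 (cid fell_U_exists))).

Lemma fell_U_spec :
  [/\ adjoint fell_U fell_Us,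
      forall (i : fell_fibre T g * H y), fell_U (fell_phi (tthi T g i.1) i.2) = fr_S S i.1 i.2,
      forall (i : fell_fibre T g * H y), fell_Us (fr_S S i.1 i.2) = fell_phi (tthi T g i.1) i.2,
      forall v, (forall i : fell_fibre T g * H y,
        dot (H y) (fell_phi (tthi T g i.1) i.2) v = 0) -> fell_U v = 0 &
      forall w, (forall i : fell_fibre T g * H y, dot (H x) (fr_S S i.1 i.2) w = 0) ->
        fell_Us w = 0].
Proof. exact: projT2 (cid (projT2 (cid fell_U_exists))). Qed.

Lemma fell_U_adjoint : adjoint fell_U fell_Us.
Proof. by case: fell_U_spec. Qed.

Lemma fell_U_phi (a : fell_fibre T g) u : fell_U (fell_phi (tthi T g a) u) = fr_S S a u.
Proof. by case: fell_U_spec => _ + _ _ _ => /(_ (a, u)). Qed.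

Lemma fell_U_unitary : unitary_onto K L fell_U.
Proof.
have [UUs Up Usq U0 _] := fell_U_spec.
have := extension_unitary_onto UUs Up Usq U0.
by rewrite fell_range_dom fell_range_ran.
Qed.

Lemma fell_U_perp v : (forall a, tD T (hinv g) a -> fell_phi a v = 0) -> fell_U v = 0.
Proof.
move=> v0; have [_ _ _ U0 _] := fell_U_spec; apply: U0 => -[a u] /=.
rewrite (repS (fell_phi_rep y)) v0 ?dot0r//.
by apply/(cidealS (tD_ideal T (hinv g)))/tthi_in/delta_in.
Qed.

Lemma fell_UsU u : K u -> fell_Us (fell_U u) = u.
Proof.
have [_ Up Usq _ _] := fell_U_spec; rewrite -fell_range_dom.
exact: (extension_UsU Up Usq).
Qed.

Lemma fell_UUs u : L u -> fell_U (fell_Us u) = u.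
Proof.
have [_ Up Usq _ _] := fell_U_spec; rewrite -fell_range_ran.
exact: (extension_UsU Usq Up).
Qed.

Lemma fell_Us_perp v : (forall a, tD T g a -> fell_phi a v = 0) -> fell_Us v = 0.
Proof.
move=> v0; have [_ _ _ _ Us0] := fell_U_spec; apply: Us0 => -[a u] /=.
have Lq : L (fr_S S a u).
  by rewrite -fell_range_ran; apply: sub_closed_span; exists (a, u).
exact: (rep_span_perp (fell_phi_rep x) (tD_ideal T g) v0 Lq).
Qed.

Lemma fell_Us_dom v : K (fell_Us v).
Proof.
have [k kL kperp] := rep_span_decomposition (fell_phi_rep x) (tD_ideal T g) v.
rewrite -[v](subrK k) bopD (fell_Us_perp kperp) add0r.
have [_ Up Usq _ _] := fell_U_spec.
rewrite -fell_range_dom; apply: (extension_U Usq).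
by rewrite fell_range_ran.
Qed.

(** On the vectors [phi(b) u] with [b] in [D_(g^-1)] both sides are products in the Fell
    bundle. On the complement [U_g] vanishes by construction and [S_g(a)] by
    [fell_SsS]. *)
Lemma fell_phi_U (a : fell_fibre T g) u : fell_phi a (fell_U u) = fr_S S a u.
Proof.
suff /(_ u) : forall u, bop_comp (fell_phi a) fell_U u = fr_S S a u by [].
apply: (bop_eq_perp (X := [set v | exists2 a, tD T (hinv g) a &
    exists u, v = fell_phi a u])) => {u} [_ [b Db [u ->]]|v vperp] /=.
  rewrite -(tthK Db) (fell_U_phi (Delta (tth_in Db))) fell_phi_S fell_S_phi.
  apply: fr_S_eq => //=; rewrite tthK//.
  rewrite tthM ?tthiK//; first exact: delta_in.
  by apply/tthi_in/delta_in.
have v0 b : tD T (hinv g) b -> fell_phi b v = 0.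
  by apply: (rep_span_perp_eq0 (fell_phi_rep y) (tD_ideal T (hinv g))) => p;
    exact: closed_span_perp.
rewrite fell_U_perp// bop0; apply/esym/dot_eq0; rewrite fr_S_star fell_SsS v0 ?dot0r//.
by apply/(cidealMl (tD_ideal T (hinv g)))/tthi_in/delta_in.
Qed.

Lemma fell_U_tth a u : tD T (hinv g) a ->
  fell_U (fell_phi a u) = fell_phi (tth T g a) (fell_U u).
Proof.
move=> Da; rewrite (fell_phi_U (Delta (tth_in Da))) -(fell_U_phi (Delta (tth_in Da))) /=.
by rewrite tthK.
Qed.

Lemma fell_phi_UUs a u : tD T g a -> fell_phi a (fell_U (fell_Us u)) = fell_phi a u.
Proof.
move=> Da; have [k kL kperp] := rep_span_decomposition (fell_phi_rep x) (tD_ideal T g) u.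
rewrite -[u](subrK k) !(bopD _ (u - k) k) (fell_Us_perp kperp) add0r fell_UUs//.
by rewrite (kperp _ Da) add0r.
Qed.

Lemma fell_phi_UsU a u : tD T (hinv g) a ->
  fell_phi a (fell_Us (fell_U u)) = fell_phi a u.
Proof.
move=> Da; have [k kK kperp] :=
  rep_span_decomposition (fell_phi_rep y) (tD_ideal T (hinv g)) u.
rewrite -[u](subrK k) !(bopD _ (u - k) k) (fell_U_perp kperp) add0r fell_UsU//.
by rewrite (kperp _ Da) add0r.
Qed.

Lemma fell_covariant : exists2 Us : bop (H x) (H y), adjoint fell_U Us &
  forall a, tD T (hinv g) a -> forall u,
    fell_U (fell_phi a (Us u)) = fell_phi (tth T g a) u.
Proof.
exists fell_Us; first exact: fell_U_adjoint.
by move=> a Da u; rewrite fell_U_tth// fell_phi_UUs//; exact: tth_in.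
Qed.

End OneArrow.

(** [phi(a) u |-> phi(w a) u] is isometric because [(w b)^* (w a) = b^* a]. *)
Lemma fell_multiplier_image x y z (g : ghom x y) (h : ghom y z) :
  exists W : bop (H x) (H x), multiplier_image (@fell_phi x) (tJ T g h) (tw T g h) W.
Proof.
have xrep := fell_phi_rep x.
have J_unit := tw_unitary T g h; have J_ideal := tJ_ideal T g h.
pose p (i : {a : tA T x | tJ T g h a} * H x) := fell_phi (sval i.1) i.2.
pose q (i : {a : tA T x | tJ T g h a} * H x) := fell_phi (mleft (tw T g h) (sval i.1)) i.2.
have [|W [_ [_ Wp _ _ _]]] := @isometry_extension _ _ _ _ p q.
  move=> [[a Ja] u] [[b Jb] v]; rewrite /p /q /=.
  rewrite !(repS xrep) -!(repM xrep) -mright_madjE.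
  rewrite (cmul_mright_madj_mleft J_ideal J_unit)//.
  exact: (cidealS J_ideal).
by exists W => a Ja u; exact: (Wp (exist _ a Ja, u)).
Qed.

(** By [rep_spanI] it suffices to treat [U_h u = phi(a) phi(b) v] with [a] in [D_h] and
    [b] in [D_(g^-1)]; then [u] is [S_h(c)^* S_g(e)^* y = S_gh(e c)^* y] for some
    [c], [e] and [y]. *)
Lemma fell_cr_mul x y z (g : ghom x y) (h : ghom y z) :
  exists2 W : bop (H x) (H x),
    multiplier_image (@fell_phi x) (tJ T g h) (tw T g h) W &
    forall u, rep_span (@fell_phi z) (tD T (hinv h)) u ->
      rep_span (@fell_phi y) (tD T (hinv g)) (fell_U h u) ->
      [/\ rep_span (@fell_phi z) (tD T (hinv (hmul g h))) u,
          rep_span (@fell_phi x) (tJ T g h) (fell_U (hmul g h) u) &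
          fell_U g (fell_U h u) = W (fell_U (hmul g h) u)].
Proof.
have [W Ww] := fell_multiplier_image g h; exists W => // u uh ug.
have xrep := fell_phi_rep x; have yrep := fell_phi_rep y.
have J_unit := tw_unitary T g h; have J_ideal := tJ_ideal T g h.
have ranh : rep_span (@fell_phi y) (tD T h) (fell_U h u).
  by have [UL _ _ _] := fell_U_unitary h; exact: UL.
have := rep_spanI yrep (tD_ideal T h) (tD_ideal T (hinv g)) ranh ug.
rewrite -{2 3 5}(fell_UsU uh).
move: (fell_U h u); apply: (@closed_span_sub _ _ _ [set v |
  [/\ rep_span (@fell_phi z) (tD T (hinv (hmul g h))) (fell_Us h v),
      rep_span (@fell_phi x) (tJ T g h) (fell_U (hmul g h) (fell_Us h v)) &
      fell_U g v = W (fell_U (hmul g h) (fell_Us h v))]]).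
- rewrite (_ : [set v | _] = fell_Us h @^-1` rep_span (@fell_phi z) (tD T (hinv (hmul g h)))
    `&` bop_comp (fell_U (hmul g h)) (fell_Us h) @^-1` rep_span (@fell_phi x) (tJ T g h)
    `&` [set v | fell_U g v = bop_comp W (bop_comp (fell_U (hmul g h)) (fell_Us h)) v]);
    last by apply/seteqP; split=> v /= => [[]|[[]]].
  apply: closedI; last exact: bop_eq_closed.
  by apply: closedI; apply: bop_closed_preimage; exact: closed_closed_span.
- split=> [|k v w /= [v1 v2 v3] [w1 w2 w3]]; rewrite /= ?bop0 ?bopP; split=> //.
  + exact: (closed_span_linear _).1.
  + exact: (closed_span_linear _).1.
  + exact: (closed_span_linear _).2.
  + exact: (closed_span_linear _).2.
  + by rewrite v3 w3.
move=> _ [a [b [v [Da Db ->]]]] /=.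
have Da' := cidealS (tD_ideal T h) Da.
have De : tD T g (cstar (tth T g b)) by apply/(cidealS (tD_ideal T g))/tth_in.
set y' := fell_U g v.
pose m := fell_mul (Delta De) (Delta Da').
have mE : fell_Us h (fell_phi a (fell_phi b v)) =
    fell_Us (hmul g h) (fell_phi (cstar m) y').
  apply: dot_inj => w; rewrite !(adjoint_sym (fell_U_adjoint _)).
  rewrite -(fell_phi_UsU _ Db) -/y' (repS yrep) (repS yrep) (repS' xrep).
  rewrite (fell_phi_U m) /m -fr_mul -(fell_phi_U (Delta De)) /= -tthS//.
  rewrite -fell_U_tth; last exact: (cidealS (tD_ideal T (hinv g))).
  by rewrite -(fell_phi_U (Delta Da')) /= (adjoint_sym (fell_U_adjoint g)).
have Dab : tD T (hinv g) (cmul a b) by exact: (cidealMl (tD_ideal T (hinv g))).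
have Dab_h : tD T h (cmul a b) by exact: (cidealMr (tD_ideal T h)).
have Jab : tJ T g h (tth T g (cstar (cmul a b))).
  have Ds := cidealS (tD_ideal T (hinv g)) Dab.
  by split; [exact: tth_in|apply: tth_sub => //; exact: (cidealS (tD_ideal T h))].
have m_val : delta_val m = mright (tw T g h) (tth T g (cstar (cmul a b))).
  rewrite /m /=; congr (mright _ (tth T g _)).
  by rewrite -tthS// tthK ?cstarM//; exact: (cidealS (tD_ideal T (hinv g))).
have Jm : tJ T g h (cstar m).
  by apply: (cidealS J_ideal); rewrite m_val; exact: (mright_in J_unit).
rewrite mE fell_UUs; last by apply: sub_rep_span; case: Jm.
split; [exact: fell_Us_dom|exact: sub_rep_span|].
rewrite Ww// m_val (mleft_cstar_mright J_ideal J_unit)// tthS// cstarK.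
by rewrite -(repM yrep) fell_U_tth.
Qed.

End FellAlgebra.

(** * Measurability modulo null sets *)

Lemma borel_preimage (X Y : ptopologicalType) (f : X -> Y) : continuous f ->
  forall B : set (borel Y), measurable B -> measurable (f @^-1` B : set (borel X)).
Proof.
move=> fc; have mf : measurable_fun setT (f : borel X -> borel Y).
  apply: (@measurability _ _ (borel X) (borel Y) setT f (@open Y)) => //.
  move=> _ [U oU <-]; rewrite setTI; apply: sub_sigma_algebra.
  by move/continuousP : fc; exact.
by move=> B mB; rewrite -[_ @^-1` _]setTI; exact: mf.
Qed.

Section NullMeasurable.
Variables (R : realType) (X : ptopologicalType).
Implicit Types (N : set (set X)) (f g : X -> R).

(** What the null sets of a measure, of [nu o alpha] and of its image under inversion
    have in common. *)
Record null_ideal N : Prop := NullIdeal {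
  null0 : N set0;
  null_sub : forall A B, A `<=` B -> N B -> N A;
  null_bigcup : forall F : nat -> set X, (forall n, N (F n)) -> N (\bigcup_n F n);
  null_hull : forall A, N A -> exists B : set (borel X), [/\ measurable B, N B & A `<=` B] }.

Definition rmeas N f := exists2 f0 : borel X -> R,
  measurable_fun setT f0 & N [set t | f t <> f0 t].

Variables (N : set (set X)) (NI : null_ideal N).

Lemma nullU A B : N A -> N B -> N (A `|` B).
Proof.
move=> NA NB; have := null_bigcup NI (F := fun n => if n is 0%N then A else B).
move=> /(_ _)/(null_sub NI _); apply; last by case.
by move=> t [At|Bt]; [exists 0%N|exists 1%N].
Qed.

Lemma null_measurableP (f : X -> R[i]) : null_measurable N f <->
  rmeas N (fun t => complex.Re (f t)) /\ rmeas N (fun t => complex.Im (f t)).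
Proof.
split=> [[f0 [mRe mIm Nf]]|[[u mu Nu] [v mv Nv]]].
  split; [exists (fun t => complex.Re (f0 t))|exists (fun t => complex.Im (f0 t))] => //;
    by apply: null_sub Nf => // t /= ne ff0; apply: ne; rewrite ff0.
exists (fun t => u t +i* v t)%C; split=> //.
apply: null_sub (nullU Nu Nv) => // t /= ne; apply: contrapT => /not_orP[/contrapT ut /contrapT vt].
by apply: ne; rewrite -ut -vt; case: (f t).
Qed.

Lemma rmeas_measurable (f : borel X -> R) : measurable_fun setT f -> rmeas N f.
Proof. by move=> mf; exists f => //; apply: null_sub (null0 NI) => // t /=. Qed.

Lemma rmeas_ae f g : rmeas N f -> N [set t | f t <> g t] -> rmeas N g.
Proof.
move=> [f0 mf0 Nf] Nfg; exists f0 => //.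
apply: null_sub (nullU Nf Nfg) => // t /= ne.
apply: contrapT => /not_orP[/contrapT ut /contrapT vt].
by apply: ne; rewrite -ut -vt.
Qed.

Lemma rmeas_eq f g : f =1 g -> rmeas N f -> rmeas N g.
Proof. by move=> /funext->. Qed.

Lemma rmeasD f g : rmeas N f -> rmeas N g -> rmeas N (fun t => f t + g t).
Proof.
move=> [f0 mf Nf] [g0 mg Ng]; exists (fun t => f0 t + g0 t); first exact: measurable_funD.
apply: null_sub (nullU Nf Ng) => // t /= ne.
apply: contrapT => /not_orP[/contrapT ut /contrapT vt].
by apply: ne; rewrite -ut -vt.
Qed.

Lemma rmeasZ k f : rmeas N f -> rmeas N (fun t => k * f t).
Proof.
move=> [f0 mf Nf]; exists (fun t => k * f0 t).
  by apply: measurable_funM => //; exact: measurable_cst.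
by apply: null_sub Nf => // t /= ne ft; apply: ne; rewrite ft.
Qed.

(** Off a Borel null set the functions agree with Borel functions, which can be set to
    [0] on that null set. *)
Lemma rmeas_cvg (u : nat -> X -> R) f : (forall n, rmeas N (u n)) ->
  (forall t, (fun n => u n t) @ \oo --> f t) -> rmeas N f.
Proof.
move=> um uf; have /choice[u0 /all_and2[mu0 Nu]] n :
    exists u0 : borel X -> R, measurable_fun setT u0 /\ N [set t | u n t <> u0 t].
  by have [u0] := um n; exists u0.
have [B [mB NB uB]] := null_hull NI (null_bigcup NI Nu).
pose v n t : R := if t \in B then 0 else u0 n t.
have mv n : measurable_fun setT (v n : borel X -> R).
  apply: measurable_fun_ifT => //; apply: (measurable_fun_bool true) => //=.
  rewrite (_ : _ @^-1` _ = B) ?setTI//.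
  by apply/seteqP; split=> t /=; [exact: set_mem|exact: mem_set].
exists (fun t => if t \in B then 0 else f t).
  apply: (measurable_fun_cvg mv) => t _; rewrite /v; case: ifPn => tB.
    exact: cvg_cst.
  rewrite (_ : (fun n => u0 n t) = (fun n => u n t)); first exact: uf.
  apply/funext => n; apply: contrapT => ne; move/negP : tB; apply.
  by apply/mem_set/uB; exists n => //= e; apply: ne; rewrite e.
apply: null_sub NB => // t /=; case: ifPn => // /set_mem //.
Qed.

End NullMeasurable.

Section NullIdeals.
Variables (R : realType) (G : groupoid).
Variables (alpha : objects G -> {measure set (borel (arrows G)) -> \bar R})
  (nu : {measure set (borel (objects G)) -> \bar R}).

Lemma negligible_null_ideal : null_ideal (negligible nu : set (set (objects G))).
Proof.
split.
- exact: negligible_set0.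
- by move=> A B AB; exact: negligibleS.
- by move=> F; exact: negligible_bigcup.
- by move=> A [B [mB B0 AB]]; exists B; split=> //; exists B; split.
Qed.

Lemma nualpha_null_ideal : null_ideal (nualpha_null alpha nu).
Proof.
split.
- exists set0; split=> //; rewrite (_ : [set x | _] = set0); first exact: negligible_set0.
  by apply/seteqP; split=> x //=; rewrite measure0 eqxx.
- by move=> A B AB [C [mC C0 BC]]; exists C; split=> //; exact: subset_trans BC.
- move=> F /choice[B /all_and3[mB B0 FB]]; exists (\bigcup_n B n); split.
  + exact: bigcupT_measurable.
  + apply: negligibleS (negligible_bigcup B0) => x /= /eqP ne; apply: contrapT => nB.
    apply: ne; apply: measure_negligible; first exact: bigcupT_measurable.
    apply: negligible_bigcup => n; exists (B n); split=> //.
    by apply: contrapT => ne; apply: nB; exists n => //=; apply/eqP.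
  + by move=> t [n _ Ft]; exists n => //; exact: FB.
- by move=> A [B [mB B0 AB]]; exists B; split=> //; exists B; split.
Qed.

Lemma ginvK (g : arrows G) : ginv (ginv g) = g.
Proof. by have /(congr1 (@hom_arr _ _ _)) := hinvK (arr g). Qed.

Lemma preimage_ginvK (A : set (arrows G)) : @ginv G @^-1` (@ginv G @^-1` A) = A.
Proof. by apply/seteqP; split=> g /=; rewrite ginvK. Qed.

Lemma measurable_preimage_ginv (B : set (borel (arrows G))) : measurable B ->
  measurable (@ginv G @^-1` B : set (borel (arrows G))).
Proof. by move=> mB; apply: borel_preimage mB; exact: ginv_continuous. Qed.

Lemma nualpha_inv_null_ideal : null_ideal (nualpha_inv_null alpha nu).
Proof.
have [n0 nS nU nH] := nualpha_null_ideal; split.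
- by rewrite /nualpha_inv_null preimage_set0.
- by move=> A B AB; apply: nS => g; exact: AB.
- by move=> F NF; rewrite /nualpha_inv_null preimage_bigcup; exact: nU.
- move=> A /nH[B [mB NB AB]]; exists (@ginv G @^-1` B); split.
  + exact: measurable_preimage_ginv.
  + by rewrite /nualpha_inv_null preimage_ginvK.
  + by move=> g Ag; apply: AB => /=; rewrite ginvK.
Qed.

End NullIdeals.

(** * Descent along the range map of a Haar system *)

Lemma continuous_borel_measurable (R : realType) (X : ptopologicalType) (f : X -> R) :
  continuous f -> measurable_fun setT (f : borel X -> R).
Proof.
move=> fc; apply: (@measurability _ _ (borel X) R setT f (@RGenOInfty.G R)).
  exact: RGenOInfty.measurableE.
move=> _ [_ [x ->] <-]; rewrite setTI; apply: sub_sigma_algebra.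
by move/continuousP : fc; apply; exact: rray_open.
Qed.

Lemma open_borel (X : ptopologicalType) (U : set X) :
  open U -> measurable (U : set (borel X)).
Proof. exact: sub_sigma_algebra. Qed.

Lemma closed_borel (X : ptopologicalType) (K : set X) :
  closed K -> measurable (K : set (borel X)).
Proof.
move=> cK; rewrite -[K]setCK; apply: measurableC; apply: open_borel.
exact: closed_openC.
Qed.

(** Normality of the one-point compactification separates [K] from the complement
    of [U]. *)
Lemma compact_bump (R : realType) (X : topologicalType) (K U : set X) :
  hausdorff_space X -> locally_compact [set: X] -> compact K -> open U -> K `<=` U ->
  exists f : X -> R, [/\ continuous f, forall t, 0 <= f t <= 1,
    forall t, K t -> f t = 1 & forall t, ~ U t -> f t = 0].
Proof.
move=> hX lX cK oU KU; pose Y : topologicalType := one_point_compactification X.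
have hY : hausdorff_space Y by exact: one_point_compactification_hausdorff.
have /(@normal_separatorP R) sep : normal_space Y.
  by apply: compact_normal => //; exact: one_point_compactification_compact.
have cSome : continuous (Some : X -> Y) := @one_point_compactification_some_continuous X.
have [|f [cf f01 f0 f1]] := (@uniform_separatorP Y R (~` (Some @` U)) (Some @` K)).1 _.
  apply: sep.
  - by apply: (@open_closedC Y); exact: one_point_compactification_open_some.
  - apply: (@compact_closed Y) => //; apply: continuous_compact cK.
    exact: continuous_subspaceT.
  - by apply/seteqP; split=> // y [nU [t /KU Ut ty]]; apply: nU; exists t.
exists (f \o Some); split.
- by move=> t; apply: continuous_comp; [exact: cSome|exact: cf].
- move=> t; have /f01 : range f (f (Some t)) by exists (Some t).
  by rewrite /= in_itv.
- by move=> t Kt; apply: f1; exists (Some t) => //; exists t.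
- by move=> t nUt; apply: f0; exists (Some t) => //= -[s Us [st]]; apply: nUt; rewrite -st.
Qed.

Section Objects.
Variables (G : groupoid) (G_hausdorff : hausdorff_space (arrows G)).

Lemma objects_hausdorff : hausdorff_space (objects G).
Proof.
move=> x y xy; suff : gunit x = gunit y.
  by move=> /(congr1 (@rng G)); rewrite !rng_unit.
apply: G_hausdorff => A B /gunit_continuous Ax /gunit_continuous By.
by have [z [Az Bz]] := xy _ _ Ax By; exists (gunit z).
Qed.

Lemma open_rng_neq (x : objects G) : open [set g : arrows G | rng g <> x].
Proof.
apply: (@open_comp _ _ (@rng G) [set~ x]).
  by move=> g _; exact: rng_continuous.
by apply: closed_openC; apply: accessible_closed_set1; apply: hausdorff_accessible;
  exact: objects_hausdorff.
Qed.

End Objects.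

Section Haar.
Variables (R : realType) (G : groupoid).
Hypotheses (G_hausdorff : hausdorff_space (arrows G))
  (G_locally_compact : locally_compact [set: arrows G]).
Variables (alpha : objects G -> {measure set (borel (arrows G)) -> \bar R}).
Hypothesis alpha_haar : haar_system alpha.
Variable C : set (arrows G).
Hypothesis C_compact : compact C.

Let C_borel : measurable (C : set (borel (arrows G))).
Proof. by apply: closed_borel; exact: compact_closed. Qed.

(** [alpha x U] is the supremum of the integrals of the functions in [C_c(U)], which
    are continuous in [x]. *)
Lemma haar_lower_semicontinuous (U : set (arrows G)) (r : R) : open U -> U `<=` C ->
  open [set x | (r%:E < alpha x U)%E].
Proof.
move=> oU UC; rewrite openE => x /= rU.
have [_ _ reg] := haar_radon alpha_haar x.
move: rU; rewrite (reg _ oU) => /ereal_sup_gt[_ [K [cK KU] <-] rK].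
have [f [cf f01 fK fU]] := compact_bump R G_hausdorff G_locally_compact cK oU KU.
have mf : measurable_fun setT (fun g : borel (arrows G) => (f g)%:E).
  by apply/measurable_EFinP; exact: continuous_borel_measurable.
have f0 g : (0 <= (f g)%:E)%E by rewrite lee_fin; case/andP: (f01 g).
have f_le (V : set (borel (arrows G))) y : measurable V -> (forall g, ~ V g -> f g = 0) ->
    (\int[alpha y]_(g in setT) (f g)%:E <= alpha y V)%E.
  move=> mV fV; rewrite -[V]setIT -integral_indic//; apply: ge0_le_integral => //.
    by apply/measurable_EFinP; exact: measurable_indic.
  move=> g _; rewrite lee_fin indicE; case: (boolP (g \in V)) => [_|/negP gV].
    by case/andP: (f01 g).
  by rewrite fV// => Vg; apply: gV; exact: mem_set.
have f_ge : (alpha x K <= \int[alpha x]_(g in setT) (f g)%:E)%E.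
  have mK : measurable (K : set (borel (arrows G))).
    by apply: closed_borel; exact: compact_closed.
  rewrite -[K]setIT -integral_indic//; apply: ge0_le_integral => //.
    by apply/measurable_EFinP; exact: measurable_indic.
  move=> g _; rewrite lee_fin indicE; case: (boolP (g \in K)) => [/set_mem/fK->//|_].
  by case/andP: (f01 g).
have fin y : (\int[alpha y]_(g in setT) (f g)%:E)%E \is a fin_num.
  rewrite ge0_fin_numE; last by apply: integral_ge0 => g _; exact: f0.
  have [C_fin _ _] := haar_radon alpha_haar y.
  apply: le_lt_trans (C_fin _ C_compact); apply: f_le => // g gC; apply: fU => /UC.
  exact: gC.
have CcF : Cc_function f.
  by split=> //; exists C => // g gC; apply: fU => /UC; exact: gC.
have := @haar_continuous _ _ _ alpha_haar f CcF x.
have : r < \int[alpha x]_(g in setT) f g.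
  by rewrite -lte_fin /Rintegral fineK//; exact: lt_le_trans rK f_ge.
move=> rx /(_ _ (open_nbhs_nbhs (conj (@open_gt R r) rx))) near_x.
apply: (@filterS _ (nbhs x) _ _ _ _ near_x) => y /= ry.
rewrite -lte_fin /Rintegral fineK// in ry; apply: lt_le_trans ry _.
by apply: f_le; [exact: open_borel|exact: fU].
Qed.

Variable N : set (arrows G).
Hypotheses (N_open : open N) (NC : N `<=` C).

Let alpha_fin x (E : set (borel (arrows G))) : measurable E ->
  (alpha x (E `&` N) < +oo)%E.
Proof.
move=> mE; have [C_fin _ _] := haar_radon alpha_haar x.
apply: le_lt_trans (C_fin _ C_compact); apply: le_measure; rewrite ?inE//.
  by apply: measurableI => //; exact: open_borel.
by apply: subset_trans NC; exact: subIsetr.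
Qed.

(** The class of all [E] with this property contains the open sets and is a Dynkin
    system, because the measures of subsets of [N] are finite. *)
Lemma haar_measurable (E : set (borel (arrows G))) : measurable E ->
  measurable_fun setT (fun x : borel (objects G) => alpha x (E `&` N)).
Proof.
have mN : measurable (N : set (borel (arrows G))) by exact: open_borel.
have openP U : open U -> measurable_fun setT (fun x : borel (objects G) => alpha x (U `&` N)).
  move=> oU; apply: (@measurability _ _ (borel (objects G)) (\bar R) setT _ (@ErealGenOInfty.G R)).
    exact: ErealGenOInfty.measurableE.
  move=> _ [_ [r ->] <-]; rewrite setTI; apply: sub_sigma_algebra.
  rewrite (_ : _ @^-1` _ = [set x | (r%:E < alpha x (U `&` N))%E]).
    apply: haar_lower_semicontinuous; first exact: openI.
    by apply: subset_trans NC; exact: subIsetr.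
  by apply/seteqP; split=> x /=; rewrite in_itv/= andbT.
move=> mE; apply: (@dynkin_induction _ (borel (arrows G)) (@open (arrows G))
  (fun E => measurable_fun setT (fun x : borel (objects G) => alpha x (E `&` N)))) => //.
- by move=> A B oA oB; exact: openI.
- by apply: openP; exact: openT.
- move=> A mA IH.
  rewrite (_ : (fun x => _) = (fun x => alpha x (setT `&` N)) \- (fun x => alpha x (A `&` N)))%E.
    by apply: emeasurable_funB => //; apply: openP; exact: openT.
  apply/funext => x; rewrite setTI setIC -setDE.
  have := @measureD _ _ _ (alpha x) N A mN mA; rewrite [A `&` N]setIC; apply.
  by have := alpha_fin x measurableT; rewrite setTI.
- move=> F mF tF IH.
  apply: (@emeasurable_fun_cvg _ (borel (objects G)) _ setT
    (fun n x => \sum_(0 <= i < n) alpha x (F i `&` N))%E) => [n|x _].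
    by apply: emeasurable_sum => i; exact: IH.
  rewrite setI_bigcupl.
  apply: (measure_semi_sigma_additive (fun i => F i `&` N)).
  - by move=> i; exact: measurableI.
  - by apply/trivIsetP => i j _ _ ij; rewrite setIACA (trivIsetP.1 tF _ _ I I ij) set0I.
  - by apply: bigcupT_measurable => i; exact: measurableI.
Qed.

Variable nu : {measure set (borel (objects G)) -> \bar R}.

Let rat_seq (n : nat) : R := if unpickle n is Some q then ratr (q : rat) else 0.

(** [F'] is the fibrewise essential supremum of [h] over [N], taken along rational
    levels. The fibres of [N] over the points considered have positive measure, so that
    it inherits the bound on [h]. *)
Lemma haar_descent (h : arrows G -> R) (F b : objects G -> R) :
  rmeas (nualpha_null alpha nu) h ->
  (forall g, N g -> `|h g - F (rng g)| <= b (rng g)) ->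
  exists2 F' : borel (objects G) -> R, measurable_fun setT F' &
    negligible nu [set x | N (gunit x) /\ ~ `|F' x - F x| <= b x].
Proof.
move=> [h0 mh0 [B [mB B0 hB]]] hF.
have mN : measurable (N : set (borel (arrows G))) by exact: open_borel.
pose L n x : \bar R := if (0 < alpha x ((h0 @^-1` `]rat_seq n, +oo[) `&` N))%E
  then (rat_seq n)%:E else -oo%E.
have mh n : measurable (h0 @^-1` `]rat_seq n, +oo[ : set (borel (arrows G))).
  by rewrite -[_ @^-1` _]setTI; apply: mh0.
have mL n : measurable_fun setT (L n : borel (objects G) -> \bar R).
  apply: measurable_fun_ifT => //.
  apply: (measurable_fun_bool true).
  have := haar_measurable (mh n) measurableT (emeasurable_itv `]0%E, +oo[).
  move=> mA; rewrite [X in measurable X](_ : _ = setT `&` (fun x => alpha x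
    ((h0 @^-1` `]rat_seq n, +oo[) `&` N)) @^-1` `]0%E, +oo[)//.
  by apply/seteqP; split=> x; rewrite /= in_itv/= andbT => // -[].
pose M x := esups (fun n => L n x) 0.
have mM : measurable_fun setT (M : borel (objects G) -> \bar R).
  exact: measurable_fun_esups.
exists (fine \o M); first by apply: measurableT_comp => //; exact: fine_measurable.
apply: negligibleS B0 => x [Nx ne] /=; apply/eqP => Bx; apply: ne.
have rx0 : alpha x [set g | rng g <> x] = 0%E by case: (haar_support alpha_haar x).
have mrx : measurable ([set g | rng g <> x] : set (borel (arrows G))).
  by apply: open_borel; exact: open_rng_neq.
have Npos : (0 < alpha x N)%E.
  by have [_] := haar_support alpha_haar x; apply => //; exists (gunit x) => //; exact: rng_unit.
have null_sub (E : set (borel (arrows G))) : measurable E ->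
    (forall g, E g -> ~ B g -> rng g = x -> False) -> alpha x E = 0%E.
  move=> mE EB; apply: measure_negligible => //.
  apply: (@negligibleS _ _ _ _ (B `|` [set g | rng g <> x])).
    move=> g Eg; have [Bg|nBg] := pselect (B g); first by left.
    by right=> rg; exact: EB Eg nBg rg.
  by apply: negligibleU; [exists B; split|exists [set g | rng g <> x]; split].
have hE g : ~ B g -> h g = h0 g.
  by move=> nBg; apply: contrapT => ne; apply: nBg; exact: hB.
have M_le : (M x <= (F x + b x)%:E)%E.
  apply: ge_ereal_sup => _ [n _ <-]; rewrite /L; case: ifPn => [pos|_]; last exact: leNye.
  rewrite lee_fin leNgt; apply/negP => lt; move: pos; rewrite null_sub ?ltxx//.
    exact: measurableI.
  move=> g [/=]; rewrite in_itv/= andbT => hg Ng /hE hg0 rg.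
  by have := hF g Ng; rewrite rg hg0 ler_norml => /andP[]; lra.
have M_ge e : 0 < e -> ((F x - b x - e)%:E <= M x)%E.
  move=> e0; have [q] := @rat_in_itvoo R (F x - b x - e) (F x - b x) ltac:(lra).
  rewrite in_itv/= => /andP[q1 q2].
  have qn : rat_seq (pickle q) = ratr q by rewrite /rat_seq pickleK.
  apply: (@le_trans _ _ (L (pickle q) x)); last by apply: ereal_sup_ubound; exists (pickle q).
  rewrite /L; case: ifPn; first by rewrite qn lee_fin => _; exact: ltW.
  rewrite -leNgt measure_le0 => /eqP null; exfalso.
  suff : alpha x N = 0%E by move=> N0; rewrite N0 ltxx in Npos.
  rewrite -(setUIDK N (h0 @^-1` `]rat_seq (pickle q), +oo[)).
  apply: measure_negligible.
    by rewrite setUIDK.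
  apply: negligibleU.
    by rewrite setIC; apply/negligibleP => //; exact: measurableI.
  apply/negligibleP; first exact: measurableD.
  apply: null_sub; first exact: measurableD.
  move=> g [Ng /=]; rewrite in_itv/= andbT => nh /hE hg0 rg; apply: nh.
  have := hF g Ng; rewrite rg hg0 ler_norml => /andP[] + _.
  by rewrite qn; lra.
have M_fin : M x \is a fin_num.
  rewrite fin_numElt; apply/andP; split; last exact: le_lt_trans M_le (ltry _).
  exact: lt_le_trans (ltNyr _) (M_ge 1 ltr01).
rewrite /= ler_norml; apply/andP; split.
  suff : F x - b x <= fine (M x) by lra.
  apply/ler_addgt0Pr => e e0; have := M_ge e e0.
  by rewrite -{1}(fineK M_fin) lee_fin; lra.
by move: M_le; rewrite -{1}(fineK M_fin) lee_fin; lra.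
Qed.

End Haar.

(** * Continuous sections of upper semicontinuous fields *)

Section FieldSections.
Variables (R : realType) (X Y : topologicalType) (A : cstarField R Y) (r : X -> Y).
Implicit Types s t : forall p : X, A (r p).

Definition continuous_section s := continuous (fun p => cinj (s p)).

Lemma continuous_sectionD s t : continuous_section s -> continuous_section t ->
  continuous_section (fun p => s p + t p).
Proof.
move=> cs ct p W /cadd_continuous[[U V] /= [/cs Us /ct Vt] UVW].
have UV := @filterI _ (nbhs p) (nbhs_filter p)
  (fun q => U (cinj (s q))) (fun q => V (cinj (t q))) Us Vt.
change (nbhs p (fun q => W (cinj (s q + t q)))).
apply: filterS UV => q [Uq Vq].
exact: (UVW (_, _) (conj Uq Vq)).
Qed.

Lemma continuous_sectionM s t : continuous_section s -> continuous_section t ->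
  continuous_section (fun p => cmul (s p) (t p)).
Proof.
move=> cs ct p W /cmul_continuous[[U V] /= [/cs Us /ct Vt] UVW].
have UV := @filterI _ (nbhs p) (nbhs_filter p)
  (fun q => U (cinj (s q))) (fun q => V (cinj (t q))) Us Vt.
change (nbhs p (fun q => W (cinj (cmul (s q) (t q))))).
apply: filterS UV => q [Uq Vq].
exact: (UVW (_, _) (conj Uq Vq)).
Qed.

Lemma continuous_sectionZ (k : X -> R[i]^o) s : continuous k -> continuous_section s ->
  continuous_section (fun p => k p *: s p).
Proof.
move=> ck cs p W /cscale_continuous[[U V] /= [/ck Uk /cs Vs] UVW].
have UV := @filterI _ (nbhs p) (nbhs_filter p)
  (fun q => U (k q)) (fun q => V (cinj (s q))) Uk Vs.
change (nbhs p (fun q => W (cinj (k q *: s q)))).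
apply: filterS UV => q [Uq Vq].
exact: (UVW (_, _) (conj Uq Vq)).
Qed.

Lemma continuous_sectionS s : continuous_section s ->
  continuous_section (fun p => cstar (s p)).
Proof.
move=> cs p W /cstar_continuous/cs.
change (nbhs p (fun q => forall y (a' : A y), cinj a' = cinj (s q) -> W (cinj (cstar a'))) ->
  nbhs p (fun q => W (cinj (cstar (s q))))).
by apply: filterS => q; exact.
Qed.

Lemma continuous_sectionB s t : continuous_section s -> continuous_section t ->
  continuous_section (fun p => s p - t p).
Proof.
move=> cs ct; have -> : (fun p => s p - t p) = (fun p => s p + (-1) *: t p).
  by apply: functional_extensionality_dep => p; rewrite scaleN1r.
apply: continuous_sectionD => //; apply: continuous_sectionZ => //.
by move=> p; exact: cvg_cst.
Qed.

Lemma section_norm_near s p (e : R) : continuous_section s -> rnorm (s p) < e ->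
  \forall q \near p, rnorm (s q) < e.
Proof.
move=> cs; rewrite -rnorm_ltE => /cnorm_usc/cs.
change (nbhs p (fun q => forall y (a' : A y), cinj a' = cinj (s q) -> `|a'| < e%:C) ->
  nbhs p (fun q => rnorm (s q) < e)).
by apply: filterS => q sq; rewrite -rnorm_ltE; exact: sq.
Qed.

End FieldSections.

Section GroupoidSections.
Variables (R : realType) (G : groupoid) (T : twisted_partial_action R G).

Lemma rsection_cinj (f : rsection (tA T)) x y (g : ghom x y) x' y' (g' : ghom x' y') :
  hom_arr g = hom_arr g' -> cinj (f _ _ g) = cinj (f _ _ g').
Proof.
elim/(@ghom_arr G): g' => g'; elim/(@ghom_arr G): g => g /= -> //.
Qed.

Lemma fell_tthi_Cc (f : forall x y (g : ghom x y), fell_fibre T g) : fell_Cc f ->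
  inv_Cc (fun x y (g : ghom x y) => Delta (tthi_in (delta_in (f x y g)))).
Proof.
move=> [cf [K cK fK]]; split; last first.
  by exists K => // x y g gK /=; rewrite fK// tthi0.
move=> g W /= /(tthi_continuous (delta_in _))[[U V] /= [Ug /cf Vf] UVW].
have UV := @filterI _ (nbhs g) (nbhs_filter g) U
  (fun g => V (cinj (delta_val (f _ _ (arr g))))) Ug Vf.
change (nbhs g (fun g' => W (cinj (tthi T (arr g') (f _ _ (arr g')))))).
apply: filterS UV => g' [Ug' Vg'].
by apply: (UVW (_, _) (conj Ug' Vg')) => //; exact: delta_in.
Qed.

Lemma fell_tth_Cc (f : forall x y (g : ghom x y), fell_fibre T (hinv g)) : inv_Cc f ->
  fell_Cc (fun x y (g : ghom x y) => Delta (tth_in (delta_in (f x y g)))).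
Proof.
move=> [cf [K cK fK]]; split; last first.
  by exists K => // x y g gK /=; rewrite fK// tth0.
move=> g W /= /(tth_continuous (delta_in _))[[U V] /= [Ug /cf Vf] UVW].
have UV := @filterI _ (nbhs g) (nbhs_filter g) U
  (fun g => V (cinj (delta_val (f _ _ (arr g))))) Ug Vf.
change (nbhs g (fun g' => W (cinj (tth T (arr g') (f _ _ (arr g')))))).
apply: filterS UV => g' [Ug' Vg'].
by apply: (UVW (_, _) (conj Ug' Vg')) => //; exact: delta_in.
Qed.

End GroupoidSections.

(** * Measurable sections of fields of Hilbert spaces *)

Section MeasurableSections.
Variables (R : realType) (G : groupoid).
Variables (alpha : objects G -> {measure set (borel (arrows G)) -> \bar R})
  (nu : {measure set (borel (objects G)) -> \bar R}) (H : hilbertField nu).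

Lemma null_measurable_sum (X : ptopologicalType) (N : set (set X)) n
    (u : 'I_n -> X -> R[i]) : null_ideal N -> (forall i, null_measurable N (u i)) ->
  null_measurable N (fun t => \sum_(i < n) u i t).
Proof.
move=> NI; elim: n u => [|n IH] u um.
  exists (fun=> 0); split; [exact: measurable_cst|exact: measurable_cst|].
  by apply: (null_sub NI _ (null0 NI)) => t /=; rewrite big_ord0.
have /(null_measurableP NI)[re im] := IH (fun i => u (lift ord0 i)) (fun i => um _).
have /(null_measurableP NI)[re0 im0] := um ord0.
apply/(null_measurableP NI); split.
  apply: rmeas_eq (rmeasD NI re0 re) => t; rewrite big_ord_recl ReD; congr (_ + _).
apply: rmeas_eq (rmeasD NI im0 im) => t; rewrite big_ord_recl.
by case: (u ord0 t) => a b; case: (\sum_(i < n) _) => c d.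
Qed.

Lemma rnorm_Re_Im (z : R[i]) : `|complex.Re z| <= rnorm z /\ `|complex.Im z| <= rnorm z.
Proof.
split; rewrite -(ler_pXn2r (n := 2)) ?nnegrE ?rnorm_ge0// real_normK ?num_real//.
  rewrite /rnorm normc_def /= sqr_sqrtr ?addr_ge0 ?sqr_ge0// lerDl sqr_ge0//.
by rewrite /rnorm normc_def /= sqr_sqrtr ?addr_ge0 ?sqr_ge0// lerDr sqr_ge0.
Qed.

Lemma null_measurable_cvg (X : ptopologicalType) (N : set (set X)) (u : nat -> X -> R[i])
    (f : X -> R[i]) : null_ideal N -> (forall n, null_measurable N (u n)) ->
  (forall t, (fun n => u n t : R[i]^o) @ \oo --> (f t : R[i]^o)) -> null_measurable N f.
Proof.
move=> NI um uf.
have lim (P : R[i] -> R) : (forall z w, P (z - w) = P z - P w) ->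
    (forall z, `|P z| <= rnorm z) -> (forall n, rmeas N (fun t => P (u n t))) ->
    rmeas N (fun t => P (f t)).
  move=> PB Ple Pu; apply: (rmeas_cvg NI Pu) => t.
  apply/cvgrPdist_lt => e e0; have [n0 _ un] := (cvg_rnormP _ _).1 (uf t) e e0.
  exists n0 => // n /un /= unt; rewrite -PB.
  exact: le_lt_trans (Ple _) unt.
apply/(null_measurableP NI); split.
  apply: lim => [[a b] [c d]//|z|n]; first by case: (rnorm_Re_Im z).
  by have /(null_measurableP NI)[] := um n.
apply: lim => [[a b] [c d]//|z|n]; first by case: (rnorm_Re_Im z).
by have /(null_measurableP NI)[] := um n.
Qed.

Lemma rmeas_sqr (X : ptopologicalType) (N : set (set X)) (f : X -> R) : null_ideal N ->
  rmeas N f -> rmeas N (fun t => f t ^+ 2).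
Proof.
move=> NI [f0 mf Nf]; exists (fun t => f0 t ^+ 2); first exact: measurable_funX.
by apply: null_sub Nf => // t /= ne ft; apply: ne; rewrite ft.
Qed.

(** The axioms of a measurable field give the measurability of norms; inner products
    follow by polarisation. *)
Lemma hsections_rdot (xi eta : forall x, H x) : hsections xi -> hsections eta ->
  rmeas (negligible nu) (fun x => rdot (xi x) (eta x)).
Proof.
have NI := negligible_null_ideal nu.
have sq (zeta : forall x, H x) : hsections zeta ->
    rmeas (negligible nu) (fun x => rnorm (zeta x) ^+ 2).
  move=> /hsections_norm/(null_measurableP NI)[re _].
  exact: rmeas_sqr re.
move=> hxi heta.
have := sq _ (hsections_linear 1 hxi heta); have := sq _ (hsections_linear (-1) heta hxi).
move=> /(rmeasZ NI (- 4^-1)) m1 /(rmeasZ NI (4^-1)) m2.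
apply: rmeas_eq (rmeasD NI m1 m2) => x.
rewrite scale1r scaleN1r addrC (addrC (- eta x)) rnorm_sqD rnorm_sqB.
by set p := rdot _ _; set q := rnorm _; set s := rnorm _; lra.
Qed.

Lemma Im_dot (V : hilbertType R) (u v : V) : complex.Im (dot V u v) = rdot ((- 'i) *: u) v.
Proof. by rewrite /rdot dotZl; case: (dot V u v) => a b /=; ring. Qed.

Lemma hsectionsZ k (xi : forall x, H x) : hsections xi -> hsections (fun x => k *: xi x).
Proof.
move=> hxi; have := hsections_linear k hxi (@hsections0 _ _ _ H).
by congr hsections; apply: functional_extensionality_dep => x; rewrite addr0.
Qed.

Lemma hsections_dot (xi eta : forall x, H x) : hsections xi -> hsections eta ->
  null_measurable (negligible nu) (fun x => dot (H x) (xi x) (eta x)).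
Proof.
move=> hxi heta; apply/(null_measurableP (negligible_null_ideal nu)); split.
  exact: hsections_rdot.
apply: rmeas_eq (hsections_rdot (hsectionsZ (- 'i) hxi) heta) => x.
by rewrite Im_dot.
Qed.

Hypotheses (G_hausdorff : hausdorff_space (arrows G)) (alpha_haar : haar_system alpha).

(** The fibre measure [alpha x] is concentrated on the arrows with range [x]. *)
Lemma nualpha_null_rng (N : set (objects G)) : negligible nu N ->
  nualpha_null alpha nu (@rng G @^-1` N).
Proof.
move=> [B [mB B0 NB]].
have mrB : measurable (@rng G @^-1` B : set (borel (arrows G))).
  by apply: borel_preimage mB; exact: rng_continuous.
exists (@rng G @^-1` B); split=> //; last by move=> g /= /NB.
have NB' : negligible nu B by exists B; split.
apply: negligibleS NB' => x /= ne; apply: contrapT => nBx; move/eqP : ne; apply.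
apply: measure_negligible => //; exists [set g | rng g <> x]; split.
- by apply: open_borel; exact: open_rng_neq.
- by case: (haar_support alpha_haar x).
- by move=> g /= Bg gx; apply: nBx; rewrite -gx.
Qed.

Lemma rmeas_src (f : objects G -> R) : rmeas (negligible nu) f ->
  rmeas (nualpha_inv_null alpha nu) (fun g => f (src g)).
Proof.
move=> [f0 mf Nf]; exists (fun g => f0 (src g)).
  move=> _ Y mY; rewrite setTI; have := mf measurableT Y mY; rewrite setTI => mfY.
  by have := borel_preimage (@src_continuous G) mfY.
have := nualpha_null_rng Nf; rewrite /nualpha_inv_null; congr nualpha_null.
by apply/seteqP; split=> g /=; rewrite src_inv.
Qed.

Lemma smeasurable_src (eta : forall x, H x) : hsections eta ->
  smeasurable alpha (H := H) (fun x y g => eta y).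
Proof.
move=> heta zeta hzeta; have NI := nualpha_inv_null_ideal alpha nu.
have /(null_measurableP (negligible_null_ideal nu))[re im] := hsections_dot heta hzeta.
by apply/(null_measurableP NI); split; [exact: (rmeas_src re)|exact: (rmeas_src im)].
Qed.

Lemma rmeasurable_ext (zeta zeta' : hrsection H) :
  (forall x y (g : ghom x y), zeta x y g = zeta' x y g) ->
  rmeasurable alpha zeta -> rmeasurable alpha zeta'.
Proof.
move=> zz m eta heta.
by have := m eta heta; congr null_measurable; apply/funext => g; rewrite zz.
Qed.

Lemma rmeasurable_sum n (zeta : 'I_n -> hrsection H) :
  (forall i, rmeasurable alpha (zeta i)) ->
  rmeasurable alpha (fun x y g => \sum_(i < n) zeta i x y g).
Proof.
move=> zm eta heta.
have := null_measurable_sum (nualpha_null_ideal alpha nu) (fun i => zm i eta heta).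
by congr null_measurable; apply/funext => g; rewrite linear_sumlz.
Qed.

Lemma rmeasurable_cvg (zeta : nat -> hrsection H) (zeta' : hrsection H) :
  (forall n, rmeasurable alpha (zeta n)) ->
  (forall x y (g : ghom x y), (fun n => zeta n x y g) @ \oo --> zeta' x y g) ->
  rmeasurable alpha zeta'.
Proof.
move=> zm zz eta heta.
apply: (null_measurable_cvg (nualpha_null_ideal alpha nu) (fun n => zm n eta heta)) => g.
exact: (continuous_cvg _ (@dot_continuous _ _ (eta (rng g)) _) (zz _ _ (arr g))).
Qed.

Variable T : twisted_partial_action R G.

(** [phi(f) U xi = U (phi(theta^(-1)(f)) xi)], and [phi(theta^(-1)(f)) xi] is an elementary
    section. *)
Lemma cov_S_measurable (c : covariant_rep alpha H T)
    (f : forall x y (g : ghom x y), fell_fibre T g) (xi : hssection H) :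
  fell_Cc f -> smeasurable alpha xi ->
  rmeasurable alpha (fun x y g => cov_S c (f x y g) (xi x y g)).
Proof.
move=> fC xim.
pose a x y (g : ghom x y) := Delta (tthi_in (delta_in (f x y g))).
have aC : inv_Cc a by exact: fell_tthi_Cc.
have : domain_measurable alpha (@cr_phi _ _ _ _ _ _ c)
    (fun x y g => cr_phi c (a x y g) (xi x y g)).
  exists (fun _ x y g => cr_phi c (a x y g) (xi x y g)); split; last first.
    by move=> x y g; exact: cvg_cst.
  by move=> _; exists 1%N, (fun=> a), (fun=> xi); split=> // x y g; rewrite big_ord1.
move=> /(cr_U_measurable (c := c)); apply: rmeasurable_ext => x y g.
by rewrite /= cr_phi_U//; exact: delta_in.
Qed.

Variable S : fell_rep alpha H T.

(** On elementary sections, [U phi(a) eta = S(theta(a)) eta]. *)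
Lemma fell_U_measurable (xi : hssection H) :
  domain_measurable alpha (@fell_phi _ _ _ _ _ _ S) xi ->
  rmeasurable alpha (fun x y g => fell_U S g (xi x y g)).
Proof.
move=> [xi_ [xi_el xi_cvg]].
apply: (@rmeasurable_cvg (fun n x y g => fell_U S g (xi_ n x y g))); last first.
  by move=> x y g; apply: continuous_cvg (xi_cvg x y g); exact: bop_continuous.
move=> n; have [m [a [eta [aC etam xiE]]]] := xi_el n.
have := rmeasurable_sum (fun i => fr_measurable S (fell_tth_Cc (aC i)) (etam i)).
apply: rmeasurable_ext => x y g; rewrite xiE bop_sum; apply: eq_bigr => i _.
rewrite fell_U_tth; last exact: delta_in.
by rewrite (fell_phi_U S (Delta (tth_in (delta_in (a i x y g))))).
Qed.

(** [U_g] is a unitary between the spaces of [D_(g^-1)] and [D_g]. *)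
Lemma nonzero_inv x y (g : ghom x y) :
  (exists a u, tD T g a /\ fell_phi S a u <> 0) ->
  exists a u, tD T (hinv g) a /\ fell_phi S a u <> 0.
Proof.
move=> [a [u [Da au]]]; apply: contrapT => none.
have z (b : tA T y) v : tD T (hinv g) b -> fell_phi S b v = 0.
  by move=> Db; apply: contrapT => bv; apply: none; exists b, v.
apply: au; rewrite -(fell_phi_UUs S u Da).
by rewrite (fell_phi_U S (Delta Da)) -(fell_U_phi S (Delta Da)) /= z ?bop0//; exact: tthi_in.
Qed.

Let supp := [set g : arrows G | exists a u, tD T (arr g) a /\ fell_phi S a u <> 0].

Lemma supp_ginv g : supp g -> supp (ginv g).
Proof.
move=> /nonzero_inv.
by apply: (@ghom_eq G (fun x y g => exists a u, tD T g a /\ fell_phi S (x := x) a u <> 0)).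
Qed.

(** A function that vanishes off [supp] may be modified to a Borel function vanishing on
    a Borel null set [B] containing the exceptional set; then the exceptional set is
    contained in [B `&` supp], to which quasi-invariance applies. *)
Lemma rmeas_nualpha_inv (k : arrows G -> R) : (forall g, ~ supp g -> k g = 0) ->
  rmeas (nualpha_null alpha nu) k -> rmeas (nualpha_inv_null alpha nu) k.
Proof.
move=> k0 [f0 mf Nf]; have NI := nualpha_null_ideal alpha nu.
have [B [mB NB kB]] := null_hull NI Nf.
exists (fun g => if g \in B then 0 else f0 g).
  apply: measurable_fun_ifT => //; apply: (measurable_fun_bool true) => //=.
  rewrite (_ : _ @^-1` _ = B) ?setTI//.
  by apply/seteqP; split=> t /=; [exact: set_mem|exact: mem_set].
have kE g : ~ B g -> k g = f0 g.
  by move=> nB; apply: contrapT => ne; apply: nB; exact: kB.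
have /(fr_quasi_invariant S mB) : nualpha_null alpha nu (B `&` supp).
  by apply: (null_sub NI) NB; exact: subIsetl.
apply: (null_sub NI) => g /= kg.
have Bg : B (ginv g) by apply: contrapT => nB; apply: kg; rewrite memNset// kE.
split=> //; rewrite -(ginvK g); apply: supp_ginv; apply: contrapT => ns.
by apply: kg; rewrite k0// mem_set.
Qed.

End MeasurableSections.

(** * Measurability of the representations of the algebras over the units *)

Section UnitMeasurability.
Variables (R : realType) (G : groupoid).
Hypotheses (G_hausdorff : hausdorff_space (arrows G))
  (G_locally_compact : locally_compact [set: arrows G]).
Variables (alpha : objects G -> {measure set (borel (arrows G)) -> \bar R}).
Hypothesis (alpha_haar : haar_system alpha).
Variables (nu : {measure set (borel (objects G)) -> \bar R}) (H : hilbertField nu).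
Variables (T : twisted_partial_action R G) (S : fell_rep alpha H T).
Implicit Types (f : forall x y (g : ghom x y), fell_fibre T g) (xi eta : forall x, H x).

(** [phi(f1 f2^* ) = S(f1) S(f2)^*], and [S(f2)^* xi] is measurable with respect to
    [nu o alpha] since its inner products are those of [xi] with [S(f2) zeta']. As it
    vanishes where the algebra acts by zero, [rmeas_nualpha_inv] makes it measurable
    with respect to the image under inversion as well, so that [S(f1)] may be
    applied. *)
Lemma fell_phi_product_measurable f1 f2 xi eta : fell_Cc f1 -> fell_Cc f2 ->
  hsections xi -> hsections eta ->
  null_measurable (nualpha_null alpha nu) (fun g =>
    dot (H (rng g)) (fell_phi S (cmul (f1 _ _ (arr g)) (cstar (f2 _ _ (arr g)))) (xi (rng g)))
      (eta (rng g))).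
Proof.
move=> f1C f2C hxi heta.
have NI := nualpha_null_ideal alpha nu.
pose zeta : hssection H := fun x y g => fr_S S (fell_star (f2 x y g)) (xi x).
suff zetam : smeasurable alpha zeta.
  have := fr_measurable S f1C zetam heta; congr null_measurable; apply/funext => g.
  by rewrite /zeta fell_SSs.
move=> zeta' hzeta'; apply/(null_measurableP (nualpha_inv_null_ideal alpha nu)).
have zeta0 g : ~ (exists a u, tD T (arr g) a /\ fell_phi S a u <> 0) -> zeta _ _ (arr g) = 0.
  move=> ns; apply: dot_eq0; apply: dot_eq0C; rewrite /zeta -fr_S_star fell_SSs.
  have -> : fell_phi S (cmul (f2 _ _ (arr g)) (cstar (f2 _ _ (arr g)))) (xi (rng g)) = 0.
    apply: contrapT => ne; apply: ns; eexists; eexists; split; last exact: ne.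
    exact: (cidealMr (tD_ideal T (arr g)) _ (delta_in _)).
  exact: dot0l.
have dotE g : dot (H (src g)) (zeta _ _ (arr g)) (zeta' (src g)) =
    (dot (H (rng g)) (fr_S S (f2 _ _ (arr g)) (zeta' (src g))) (xi (rng g)))^*.
  by rewrite -dotC; apply: (adjoint_sym (fr_star S _)).
have /(null_measurableP NI)[re im] :=
  fr_measurable S f2C (smeasurable_src G_hausdorff alpha_haar hzeta') hxi.
split; apply: (rmeas_nualpha_inv (S := S)).
- by move=> g /zeta0->; rewrite dot0l.
- by apply: rmeas_eq re => g; rewrite dotE; case: (dot _ _ _).
- by move=> g /zeta0->; rewrite dot0l.
- apply: rmeas_eq (rmeasZ NI (-1) im) => g; rewrite dotE.
  by case: (dot _ _ _) => a b /=; rewrite mulN1r.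
Qed.

Lemma fell_iter_in f x y (g : ghom x y) (b : fell_fibre T g) :
  tD T g (delta_val b - cmul (delta_val b) (cmul (cstar (f x y g)) (f x y g))).
Proof.
apply: (cidealB (tD_ideal T g)); first exact: delta_in.
exact: (cidealMr (tD_ideal T g) _ (delta_in b)).
Qed.

(** [fell_iter f n] is [f (1 - f^* f)^n]. *)
Fixpoint fell_iter f n : forall x y (g : ghom x y), fell_fibre T g :=
  if n is m.+1 then fun x y g => Delta (fell_iter_in f (fell_iter f m g)) else f.

Lemma fell_square_in f x y (g : ghom x y) : tD T g (cmul (cstar (f x y g)) (f x y g)).
Proof. exact: (cidealMl (tD_ideal T g) _ (delta_in _)). Qed.

Definition fell_square f x y (g : ghom x y) := Delta (fell_square_in f g).

Lemma fell_square_Cc f : fell_Cc f -> fell_Cc (fell_square f).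
Proof.
move=> [cf [K cK fK]]; split; last by exists K => // x y g /fK /= ->; rewrite cmula0.
apply: (@continuous_sectionM _ _ _ _ (@rng G)) => //.
exact: (@continuous_sectionS _ _ _ _ (@rng G)).
Qed.

Lemma fell_iter_Cc f n : fell_Cc f -> fell_Cc (fell_iter f n).
Proof.
move=> fC; elim: n => [//|n [cb [K cK bK]]]; split; last first.
  by exists K => // x y g /bK /= ->; rewrite cmul0a subr0.
apply: (@continuous_sectionB _ _ _ _ (@rng G)) => //.
apply: (@continuous_sectionM _ _ _ _ (@rng G)) => //.
by case: (fell_square_Cc fC).
Qed.

Lemma fell_iter_phi f n x y (g : ghom x y) u : fell_phi S (fell_iter f n g) u =
  fell_phi S (f x y g) (iter n (fun w => w -
    fell_phi S (cstar (f x y g)) (fell_phi S (f x y g) w)) u).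
Proof.
have phi_rep := fell_phi_rep S x.
elim: n u => [//|n IH] u; rewrite iterSr -IH /= (repB phi_rep) !(repM phi_rep).
by rewrite bopB.
Qed.

(** [phi f] is the strong limit of [phi (f - f (1 - f^* f)^n)], and
    [f - f (1 - f^* f)^n] is a finite sum of products of sections. *)
Lemma fell_phi_Cc_measurable f xi eta : fell_Cc f ->
  (forall x y (g : ghom x y), rnorm (delta_val (f x y g)) <= 1) ->
  hsections xi -> hsections eta ->
  rmeas (nualpha_null alpha nu) (fun g =>
    rdot (fell_phi S (f _ _ (arr g)) (xi (rng g))) (eta (rng g))).
Proof.
move=> fC f1 hxi heta; have NI := nualpha_null_ideal alpha nu.
pose r n g := rdot (fell_phi S (fell_iter f n (arr g)) (xi (rng g))) (eta (rng g)).
apply: (@rmeas_cvg _ _ _ NI (fun n g => r 0%N g - r n g)) => [n|g].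
  elim: n => [|n IH].
    apply: rmeas_eq (rmeas_measurable NI (f := fun=> 0) (measurable_cst _)) => g.
    by rewrite subrr.
  have /(null_measurableP NI)[re _] := fell_phi_product_measurable
    (fell_iter_Cc n fC) (fell_square_Cc fC) hxi heta.
  apply: rmeas_eq (rmeasD NI IH re) => g; have phi_rep := fell_phi_rep S (rng g).
  rewrite [r n.+1 g]/r /= (repB phi_rep) rdotBl -/(r n g) opprB addrCA addrC; congr (_ - _ + _).
  by rewrite /rdot cstarM cstarK.
have phi_rep := fell_phi_rep S (rng g).
pose Tg := fell_phi S (f _ _ (arr g)); pose Tgs := fell_phi S (cstar (f _ _ (arr g))).
have Tg1 u : rnorm (Tg u) <= rnorm u.
  apply: le_trans (rep_contraction phi_rep _ _) _.
  by rewrite ler_piMl ?rnorm_ge0.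
have adj : adjoint Tg Tgs by case: phi_rep => _ _; exact.
have := contraction_iter_cvg0 adj Tg1
  (v := fun n => iter n (fun w => w - Tgs (Tg w)) (xi (rng g))) (fun n => erefl).
move=> Tv; have vn := (cvg_rnormP _ _).1 Tv; apply/cvgrPdist_lt => e e0.
have e1 : 0 < e / (rnorm (eta (rng g)) + 1) by rewrite divr_gt0// ltr_wpDl// rnorm_ge0.
have [n0 _ n0P] := vn _ _ e1; exists n0 => // n /n0P /=.
rewrite sub0r rnormN ltr_pdivlMr ?ltr_wpDl ?rnorm_ge0// => vne.
rewrite -[rdot _ _]/(r 0%N g) opprB addrC subrK.
rewrite /r fell_iter_phi -/Tg -/Tgs; set v := iter _ _ _ in vne *.
apply: le_lt_trans vne; apply: le_trans (rnorm_Re_Im _).1 _.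
apply: le_trans (cauchy_schwarz _ _) _.
by rewrite ler_wpM2l ?rnorm_ge0// lerDl.
Qed.

Section LocalApproximation.
Variables (a : forall x, tA T x) (xi eta : forall x, H x).
Hypotheses (a_cont : continuous (fun x => cinj (a x)))
  (hxi : hsections xi) (heta : hsections eta).

Let F x := rdot (fell_phi S (a x) (xi x)) (eta x).
Let b x := rnorm (xi x) * rnorm (eta x).

Lemma unit_rdot_bound x (c : tA T x) :
  `|rdot (fell_phi S c (xi x)) (eta x)| <= rnorm c * b x.
Proof.
apply: le_trans (rnorm_Re_Im _).1 _; apply: le_trans (cauchy_schwarz _ _) _.
rewrite /b mulrA ler_wpM2r ?rnorm_ge0//.
exact: (rep_contraction (fell_phi_rep S x)).
Qed.

(** Near the unit [x0] the section [a \o r] is approximated by a section of the ideals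
    that agrees with it at [x0]. *)
Lemma unit_local_approximation (x0 : objects G) (e : R) : 0 < e ->
  exists (V : set (objects G)) (F' : borel (objects G) -> R),
    [/\ open V, V x0, measurable_fun setT F' &
      negligible nu [set x | V x /\ ~ `|F' x - F x| <= e * b x]].
Proof.
move=> e0; pose u0 := gunit x0.
have [f0 [cf0 Df0 f0x]] : exists f : rsection (tA T),
    [/\ rcontinuous f, forall x' y' (h : ghom x' y'), tD T h (f x' y' h) &
        f _ _ (hid x0) = a x0].
  by apply: tD_continuous; rewrite tD_id.
have f0u : cinj (f0 _ _ (arr u0)) = cinj (a (rng u0)).
  rewrite (@rsection_cinj _ _ _ f0 _ _ (arr u0) _ _ (hid x0))// f0x.
  by rewrite /u0; case: _ / (esym (rng_unit x0)).
have f0u' : f0 _ _ (arr u0) = a (rng u0) by exact: cinj_inj f0u.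
pose M := rnorm (a (rng u0)) + 1.
have M0 : 0 < M by rewrite ltr_wpDl// rnorm_ge0.
have [D [D_nbhs D_cpt]] : exists D : set (arrows G), nbhs u0 D /\ compact D.
  by have [D] := G_locally_compact (x := u0) I; rewrite withinET => Du [cD _]; exists D.
have cs0 : @continuous_section _ _ _ (tA T) (@rng G) (fun g => f0 _ _ (arr g)) by exact: cf0.
have nM : \forall g \near u0, rnorm (f0 _ _ (arr g)) < M.
  apply: (section_norm_near cs0); by rewrite f0u' /M ltrDl.
pose O := interior (D `&` [set g | rnorm (f0 _ _ (arr g)) < M]).
have Ou : O u0 by apply: nbhs_singleton; apply: nbhs_interior; exact: filterI.
have OD : O `<=` D by move=> g /interior_subset[].
have OM g : O g -> rnorm (f0 _ _ (arr g)) < M by move=> /interior_subset[].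
have [chi [c_chi chi01 chi_u chi_O]] := @compact_bump R _ [set u0] O G_hausdorff
  G_locally_compact (@compact_set1 _ u0) (@open_interior _ _) (fun g gu => eq_ind_r O Ou gu).
(* Dividing by [M] makes [|f| <= 1]; the factor is restored in [hm]. *)
pose k (g : arrows G) : R[i]^o := (chi g / M)%:C.
have Df x y (g : ghom x y) : tD T g (k g *: f0 x y g) by exact: (cidealZ (tD_ideal T g)).
pose f x y (g : ghom x y) := Delta (Df x y g).
have ck : continuous k.
  move=> g; apply/cvg_rnormP => d d0.
  have cM : continuous (fun g => chi g / M) by move=> t; apply: cvgMl; exact: c_chi.
  have cMg : nbhs g (fun g' => `|chi g / M - chi g' / M| < d).
    exact: ((@cvgrPdist_lt _ _ _ _ _ _ _).1 (cM g) d d0).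
  change (nbhs g (fun g' => rnorm (k g - k g') < d)).
  by apply: filterS cMg => g' /=; rewrite /k -rmorphB rnormC.
have fC : fell_Cc f.
  split; first exact: (continuous_sectionZ ck cs0).
  exists D => // x y g gD; rewrite /f /= /k chi_O ?mul0r ?scale0r// => /OD.
  exact: gD.
have f1 x y (g : ghom x y) : rnorm (delta_val (f x y g)) <= 1.
  rewrite /f /= rnormZ rnormC ger0_norm; last first.
    by apply: divr_ge0; [case/andP: (chi01 (hom_arr g))|exact: ltW].
  have [Og|nOg] := pselect (O (hom_arr g)); last by rewrite chi_O// !mul0r.
  have f0M : rnorm (f0 x y g) < M.
    move: x y g Og.
    apply: (@ghom_arr G (fun x y g => O (hom_arr g) -> rnorm (f0 x y g) < M)).
    exact: OM.
  rewrite mulrAC ler_pdivrMr// mul1r; apply: le_trans (ltW f0M).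
  by rewrite ler_piMl ?rnorm_ge0//; case/andP: (chi01 (hom_arr g)).
have hm : rmeas (nualpha_null alpha nu) (fun g => M *
    rdot (fell_phi S (f _ _ (arr g)) (xi (rng g))) (eta (rng g))).
  by apply: rmeasZ; [exact: nualpha_null_ideal|exact: fell_phi_Cc_measurable].
pose s g := M%:C *: delta_val (f _ _ (arr g)) - a (rng g).
have cs : @continuous_section _ _ _ (tA T) (@rng G) s.
  apply: continuous_sectionB.
    apply: continuous_sectionZ; first by move=> g; exact: cvg_cst.
    by case: fC.
  move=> g; apply: (@continuous_comp _ _ _ (@rng G) (fun x => cinj (a x))).
    exact: rng_continuous.
  exact: a_cont.
have su0 : s u0 = 0.
  by rewrite /s /f /= f0u' scalerA /k chi_u// -rmorphM /= mul1r divff ?gt_eqF// scale1r subrr.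
have ne : \forall g \near u0, rnorm (s g) < e.
  by apply: (section_norm_near cs); rewrite su0 rnorm0.
pose N := interior (D `&` [set g | rnorm (s g) < e]).
have Nu : N u0 by apply: nbhs_singleton; apply: nbhs_interior; exact: filterI.
have ND : N `<=` D by move=> g /interior_subset[].
have hF g : N g -> `|M * rdot (fell_phi S (f _ _ (arr g)) (xi (rng g))) (eta (rng g)) -
    F (rng g)| <= e * b (rng g).
  move=> /interior_subset[_ /= sg]; have phi_rep := fell_phi_rep S (rng g).
  rewrite -rdotZl -(repZ phi_rep) -rdotBl -(repB phi_rep).
  apply: le_trans (unit_rdot_bound _) _; apply: ler_wpM2r; last exact: ltW.
  by rewrite mulr_ge0// rnorm_ge0.
have [F' mF' F'F] := haar_descent G_hausdorff G_locally_compact alpha_haar D_cpt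
  (@open_interior _ _) ND (F := F) (b := fun x => e * b x) hm hF.
exists (@gunit G @^-1` N), F'; split=> //.
apply: open_comp => [x _|]; first exact: gunit_continuous.
exact: open_interior.
Qed.

Hypothesis a_C0 : forall t : R[i], 0 < t ->
  exists2 K : set (objects G), compact K & forall x, ~ K x -> `|a x| < t.

(** Off a compact set the section [a] is small; the compact set is covered by finitely
    many of the open sets from [unit_local_approximation]. *)
Lemma unit_global_approximation (e : R) : 0 < e ->
  exists2 F' : borel (objects G) -> R, measurable_fun setT F' &
    negligible nu [set x | ~ `|F' x - F x| <= e * b x].
Proof.
move=> e0; have NI := negligible_null_ideal nu.
have [|K cK aK] := a_C0 (t := e%:C); first by rewrite ltcR.
have /choice[V /choice[F' FP]] := fun x0 => unit_local_approximation x0 e0.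
have patch (s : seq (objects G)) : exists F0 : borel (objects G) -> R,
    [/\ measurable_fun setT F0, forall x, (forall i, i \in s -> ~ V i x) -> F0 x = 0 &
      negligible nu [set x | (exists2 i, i \in s & V i x) /\ ~ `|F0 x - F x| <= e * b x]].
  elim: s => [|i s [F0 [mF0 F0z nF0]]].
    exists (fun=> 0); split=> //; apply: (null_sub NI) (null0 NI) => x /= [[j]].
    by rewrite in_nil.
  have [oV Vi mFi nFi] := FP i.
  exists (fun x => if x \in V i then F' i x else F0 x); split.
  - apply: measurable_fun_ifT => //; apply: (measurable_fun_bool true) => //=.
    rewrite (_ : _ @^-1` _ = V i) ?setTI//; first exact: open_borel.
    by apply/seteqP; split=> t /=; [exact: set_mem|exact: mem_set].
  - move=> x xV; rewrite memNset; last by apply: xV; rewrite mem_head.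
    by apply: F0z => j js; apply: xV; rewrite in_cons js orbT.
  - apply: (null_sub NI) (nullU NI nFi nF0) => x /= [[j js Vj]].
    case: ifPn => [/set_mem Vx|nVx] ne; first by left.
    right; split=> //; exists j => //; move: js; rewrite in_cons => /orP[/eqP ji|//].
    by rewrite ji in Vj; rewrite mem_set in nVx.
have : cover_compact K by rewrite -compact_cover.
move=> /(_ _ setT V)[i _|x _|s _ Ks]; first by have [] := FP i.
  by exists x => //; have [] := FP x.
have [F0 [mF0 F0z nF0]] := patch (finmap.enum_fset s).
exists F0 => //; apply: (null_sub NI) nF0 => x /= ne; split=> //.
apply: contrapT => nx; apply: ne; rewrite F0z; last first.
  by move=> i si Vi; apply: nx; exists i.
rewrite sub0r normrN; apply: le_trans (unit_rdot_bound _) _.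
apply: ler_wpM2r; first by rewrite mulr_ge0// rnorm_ge0.
apply: ltW; rewrite -rnorm_ltE; apply: aK => /Ks[i /= si Vi]; apply: nx.
by exists i.
Qed.

Lemma unit_rdot_measurable : rmeas (negligible nu) F.
Proof.
have NI := negligible_null_ideal nu.
have /choice[F' FP] : forall n, exists F' : borel (objects G) -> R,
    measurable_fun setT F' /\ negligible nu [set x | ~ `|F' x - F x| <= n.+1%:R^-1 * b x].
  by move=> n; have [|F' ? ?] := @unit_global_approximation n.+1%:R^-1;
    [rewrite invr_gt0|exists F'].
pose bad := \bigcup_n [set x | ~ `|F' n x - F x| <= n.+1%:R^-1 * b x].
have nbad : negligible nu bad by apply: (null_bigcup NI) => n; case: (FP n).
apply: (@rmeas_cvg _ _ _ NI (fun n x => if x \in bad then F x else F' n x)) => [n|x].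
  apply: (rmeas_ae NI (rmeas_measurable NI (FP n).1)).
  by apply: (null_sub NI) nbad => x /=; case: ifPn => // /set_mem.
case: (boolP (x \in bad)) => xbad; first exact: cvg_cst.
have close n : `|F' n x - F x| <= n.+1%:R^-1 * b x.
  by apply: contrapT => ne; move/negP : xbad; apply; apply: mem_set; exists n.
apply/cvgrPdist_lt => e e0.
have b0 : 0 <= b x by rewrite mulr_ge0// rnorm_ge0.
have [|N NP] := @natSinv_lt R (e / (b x + 1)); first by rewrite divr_gt0// ltr_wpDl.
exists N => // n /NP nN; rewrite distrC; apply: le_lt_trans (close n) _.
move: nN; rewrite ltr_pdivlMr ?ltr_wpDl//; apply: le_lt_trans.
by rewrite ler_wpM2l ?invr_ge0// lerDl.
Qed.

End LocalApproximation.

Lemma fell_phi_measurable (a : forall x, tA T x) xi : C0_section a -> hsections xi ->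
  hsections (fun x => fell_phi S (a x) (xi x)).
Proof.
move=> [ca a0] hxi; apply: hsections_max => eta heta.
have NI := negligible_null_ideal nu.
apply/(null_measurableP NI); split.
  by apply: rmeas_eq (unit_rdot_measurable ca hxi heta a0) => x; rewrite rdotC.
apply: rmeas_eq (rmeasZ NI (-1) (unit_rdot_measurable ca (hsectionsZ (- 'i) hxi) heta a0)).
move=> x; rewrite bopZ -Im_dot dotC.
by case: (dot _ _ _) => p q /=; rewrite mulN1r opprK.
Qed.

End UnitMeasurability.

(** * The correspondence *)

Section Correspondence.
Variables (R : realType) (G : groupoid).
Hypotheses (G_hausdorff : hausdorff_space (arrows G))
  (G_locally_compact : locally_compact [set: arrows G]).
Variables (alpha : objects G -> {measure set (borel (arrows G)) -> \bar R}).
Hypothesis (alpha_haar : haar_system alpha).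
Variables (nu : {measure set (borel (objects G)) -> \bar R}) (H : hilbertField nu).
Variable (T : twisted_partial_action R G).

Section CovToFell.
Variable c : covariant_rep alpha H T.

Lemma cov_S_unit_eq : (fun x a => cov_S c (fell_unit a)) = @cr_phi _ _ _ _ _ _ c.
Proof.
apply: functional_extensionality_dep => x; apply/funext => a.
by apply: bop_ext => u; exact: cov_S_unit.
Qed.

Lemma cov_S_linear x y (g : ghom x y) (k : R[i]) (a b d : fell_fibre T g) :
  delta_val d = k *: delta_val a + delta_val b ->
  forall u, cov_S c d u = k *: cov_S c a u + cov_S c b u.
Proof. by move=> dab u; rewrite /= dab; case: (cr_rep c x). Qed.

Lemma cov_S_nondegenerate (x : objects G) :
  closed_span [set v : H x | exists a u, v = cov_S c (fell_unit a) u] = setT.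
Proof.
have [_ _ _ <-] := cr_phi_rep c x; congr closed_span.
by apply/seteqP; split=> _ [a [u ->]]; exists a, u; rewrite cov_S_unit.
Qed.

Lemma cov_S_quasi_invariant : quasi_invariant alpha (fun x a => cov_S c (fell_unit a)).
Proof. by rewrite cov_S_unit_eq; exact: cr_quasi_invariant. Qed.

Definition cov_to_fell : fell_rep alpha H T :=
  FellRep cov_S_linear (@cov_S_mul _ _ _ _ _ _ c) (@cov_S_star _ _ _ _ _ _ c)
    cov_S_nondegenerate (@cov_S_measurable _ _ _ _ _ _ c) cov_S_quasi_invariant.

End CovToFell.

Definition fell_to_cov (S : fell_rep alpha H T) : covariant_rep alpha H T :=
  CovariantRep (fell_phi_nondegenerate S) (@fell_U_unitary _ _ _ _ _ _ S)
    (fr_quasi_invariant S) (@fell_covariant _ _ _ _ _ _ S) (@fell_cr_mul _ _ _ _ _ _ S)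
    (@fell_phi_measurable _ _ G_hausdorff G_locally_compact _ alpha_haar _ _ _ S)
    (@fell_U_measurable _ _ _ _ _ _ S).

Lemma covariant_rep_ext (c c' : covariant_rep alpha H T) :
  @cr_phi _ _ _ _ _ _ c = @cr_phi _ _ _ _ _ _ c' ->
  @cr_U _ _ _ _ _ _ c = @cr_U _ _ _ _ _ _ c' -> c = c'.
Proof.
case: c c' => [phi U ? ? p1 p2 p3 p4 p5 p6 p7] [phi' U' ? ? q1 q2 q3 q4 q5 q6 q7] /=.
move=> pp uu; subst phi' U'.
by congr CovariantRep; exact: Prop_irrelevance.
Qed.

Lemma fell_rep_ext (S S' : fell_rep alpha H T) :
  @fr_S _ _ _ _ _ _ S = @fr_S _ _ _ _ _ _ S' -> S = S'.
Proof.
case: S S' => [S p1 p2 p3 p4 p5 p6] [S' q1 q2 q3 q4 q5 q6] /= SS; subst S'.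
by congr FellRep; exact: Prop_irrelevance.
Qed.

Lemma cov_to_fellK : cancel cov_to_fell fell_to_cov.
Proof.
move=> c; set S := cov_to_fell c.
have phiE x (a : tA T x) u : fell_phi S a u = cr_phi c a u by exact: cov_S_unit.
apply: covariant_rep_ext.
  exact: (cov_S_unit_eq c).
apply: functional_extensionality_dep => x; apply: functional_extensionality_dep => y.
apply: functional_extensionality_dep => g; apply: bop_ext.
apply: (bop_eq_perp (X := [set v | exists2 a, tD T (hinv g) a &
    exists u, v = cr_phi c a u])) => [_ [a Da [u ->]]|v vperp] /=.
  have Dta := tth_in Da.
  by rewrite -{1}phiE -{1}(tthK Da) (fell_U_phi S (Delta Dta)) /= cr_phi_U// tthK.
have v0 b : tD T (hinv g) b -> cr_phi c b v = 0.
  by apply: (rep_span_perp_eq0 (cr_rep c y) (tD_ideal T (hinv g))) => p;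
    exact: closed_span_perp.
rewrite (cr_U_perp v0); apply: fell_U_perp => b Db.
by rewrite phiE v0.
Qed.

Lemma fell_to_covK : cancel fell_to_cov cov_to_fell.
Proof.
move=> S; apply: fell_rep_ext.
apply: functional_extensionality_dep => x; apply: functional_extensionality_dep => y.
apply: functional_extensionality_dep => g; apply/funext => a.
by apply: bop_ext => u; exact: fell_phi_U.
Qed.

End Correspondence.

Theorem theorem10p4 (R : realType) (G : groupoid)
    (G_hausdorff : hausdorff_space (arrows G))
    (G_locally_compact : locally_compact [set: arrows G])
    (alpha : objects G -> {measure set (borel (arrows G)) -> \bar R})
    (alpha_haar : haar_system alpha)
    (T : twisted_partial_action R G)
    (nu : {measure set (borel (objects G)) -> \bar R})
    (H : hilbertField nu) :
  exists F : covariant_rep alpha H T -> fell_rep alpha H T,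
    bijective F /\
    forall (c : covariant_rep alpha H T) (x y : objects G) (g : ghom x y)
           (a : fell_fibre T g) (u : H y),
      fr_S (F c) a u = cr_phi c a (cr_U c g u).
Proof.
exists (@cov_to_fell _ _ alpha nu H T); split=> //.
exists (fell_to_cov G_hausdorff G_locally_compact alpha_haar (nu := nu) (H := H) (T := T)).
  exact: cov_to_fellK.
exact: fell_to_covK.
Qed.
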